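(* Let $\kappa,\varepsilon>0$, $\lambda\ge 0$. For fixed $\rho_0,\rho_1\in H^1(0,1)$, let $\rho_0+s\theta\in H^1(0,1)$ be the perturbation of the first signal. If the tuple $(f,v,z)$ denotes the minimizing geodesic between $\rho_0$ and $\rho_1$ under the HV metric, then $$d_{\mathrm{HV}}^2(\rho_0+s\theta,\rho_1)-d_{\mathrm{HV}}^2(\rho_0,\rho_1)=-s\int_0^1 z(x,0)\,\theta(x)\,dx-\frac{s^2}{2}\int_0^1 z_1(x,0)\,\theta(x)\,dx+o(s^2),$$ where $z_1$ is the first-order coefficient in the expansion $z^s=z+sz_1+s^2z_2+o(s^2)$ of the $z$-component of the minimizing geodesic $(\rho^s,v^s,z^s)$ between $\rho_0+s\theta$ and $\rho_1$.
   Context: Signals are real functions on $(0,1)$. For fixed parameters $\kappa,\varepsilon>0$, $\lambda\ge 0$ the squared HV metric is $$d_{\mathrm{HV}}^2(\rho_0,\rho_1)=\inf_{(f,v,z)\in\mathcal A(\rho_0,\rho_1)}\frac12\int_0^1\int_0^1\big(\kappa v^2+\lambda v_x^2+\varepsilon v_{xx}^2+z^2\big)\,dx\,dt,$$ where $\mathcal A(\rho_0,\rho_1)$ is the set of triples $(f,v,z)$ of functions of $(x,t)$ ($x$ space, $t$ time) with $f\in L^2((0,1),L^2(0,1))\cap C([0,1],H^{-1}(0,1))$, $v\in L^2((0,1),H^2(0,1)\cap H^1_0(0,1))$, $z\in L^2((0,1),L^2(0,1))$, such that $\partial_t f+\partial_x f\cdot v=z$ weakly and $f(\cdot,0)=\rho_0$,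 $f(\cdot,1)=\rho_1$. The minimizing geodesic is the triple attaining the infimum. Standing ansatz of the paper: for the perturbed pair $(\rho_0+s\theta,\rho_1)$ the minimizing geodesic $(\rho^s,v^s,z^s)$ solves the Euler–Lagrange system $\varepsilon v^s_{xxxx}-\lambda v^s_{xx}+\kappa v^s+z^s\rho^s_x=0$ weakly on $(0,1)^2$; $v^s=0$ and $v^s_{xx}=0$ on $\{0,1\}\times[0,1]$; $z^s_t+(z^sv^s)_x=0$ weakly on $(0,1)^2$; $\rho^s_t+\rho^s_xv^s-z^s=0$ weakly on $(0,1)^2$; $\rho^s(\cdot,0)=\rho_0+s\theta$, $\rho^s(\cdot,1)=\rho_1$; and it admits expansions, which may be differentiated and substituted order by order in $s$ into this system, $$\rho^s=f+sf_1+s^2f_2+o(s^2),\quad v^s=v+sv_1+s^2v_2+o(s^2),\quad z^s=z+sz_1+s^2z_2+o(s^2).$$ *)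

(* Defs.v *)
From HB Require Import structures.
From mathcomp Require Export all_boot all_order all_algebra.
From mathcomp Require Export all_classical all_reals all_analysis.
Export Order.TTheory GRing.Theory Num.Theory.
Export numFieldNormedType.Exports.

Set Implicit Arguments.
Unset Strict Implicit.
Unset Printing Implicit Defensive.

Local Open Scope classical_set_scope.
Local Open Scope ring_scope.

(** Signals are functions [R -> R] and space-time functions are functions
    [R * R -> R] of [(x, t)], space first; only their values on the open
    interval [I01] and on the open square [Q01] (on the closed interval for [t], when
    time slices are used) matter, and they stand for their classes modulo
    a.e. equality. *)

Local Notation leb1 R := (@lebesgue_measure R).
Local Notation leb2 R := (@lebesgue_measure R \x @lebesgue_measure R)%E.

Section Spaces.
Context {R : realType}.
Implicit Types (u v w g : R * R -> R) (a b : R -> R) (phi : R -> R)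
  (psi : R * R -> R) (s t x : R).

Definition I01 : set R := `]0, 1[.
Definition Q01 : set (R * R) := I01 `*` I01.

Definition slice u t : R -> R := fun x => u (x, t).

(** ** Test functions *)

(* The words [l] range over all finite sequences of directions; Frechet
   differentiability of every iterated directional derivative is C^oo. *)
Definition smooth (V : normedModType R) (phi : V -> R) :=
  forall (l : seq V) (p : V),
    differentiable (foldr (fun h chi => 'D_h chi) phi l) p.

Definition test_function (V : normedModType R) (U : set V) (phi : V -> R) :=
  smooth phi /\
  exists K : set V, [/\ compact K, K `<=` U & forall p, ~ K p -> phi p = 0].

Definition dx psi : R * R -> R := 'D_((1, 0) : R * R) psi.
Definition dt psi : R * R -> R := 'D_((0, 1) : R * R) psi.

(** ** Square-integrable functions *)

Definition L2I a :=
  measurable_fun I01 a /\ (leb1 R).-integrable I01 (fun x => (a x ^+ 2)%:E).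

Definition L2Q u :=
  measurable_fun Q01 u /\ (leb2 R).-integrable Q01 (fun p => (u p ^+ 2)%:E).

Definition intI a : R := \int[leb1 R]_(x in I01) a x.
Definition intQ u : R := \int[leb2 R]_(p in Q01) u p.

Definition normI a : R := Num.sqrt (intI (fun x => a x ^+ 2)).

(** ** Sobolev spaces on (0,1) *)

Definition weak_deriv a b :=
  [/\ L2I a, L2I b &
    forall phi, test_function I01 phi ->
      intI (fun x => a x * derive1 phi x) = - intI (fun x => b x * phi x)].

Definition H1 a := exists b, weak_deriv a b.

Definition normH1 a b : R :=
  Num.sqrt (intI (fun x => a x ^+ 2 + b x ^+ 2)).

(* Closure of the test functions in H^1(0,1). *)
Definition H10 a := exists b, weak_deriv a b /\
  forall e : R, 0 < e -> exists phi, test_function I01 phi /\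
    normH1 (fun x => a x - phi x) (fun x => b x - derive1 phi x) < e.

(* H^{-1}(0,1), the dual of H^1_0(0,1): by density, linear forms on test
   functions that are bounded for the H^1 norm. *)
Definition Hm1 (F : (R -> R) -> R) :=
  (forall (c : R) (phi chi : R -> R),
     test_function I01 phi -> test_function I01 chi ->
     F (fun x => c * phi x + chi x) = c * F phi + F chi) /\
  exists C : R, forall phi, test_function I01 phi ->
    `|F phi| <= C * normH1 phi (derive1 phi).

(* The distribution defined by a function. *)
Definition pairing a : (R -> R) -> R := fun phi => intI (fun x => a x * phi x).

(* The dual-norm distance between F and G is at most e. *)
Definition Hm1_close (e : R) (F G : (R -> R) -> R) :=
  forall phi, test_function I01 phi ->
    `|F phi - G phi| <= e * normH1 phi (derive1 phi).

(** ** Spaces of space-time functions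

    L^2((0,1), L^2(0,1)) is identified with L^2(Q01). *)

(* [g] is the x-derivative of [u] in the sense of L^2((0,1), H^1(0,1)). *)
Definition is_Dx u g :=
  L2Q g /\ {ae leb1 R, forall t, I01 t -> weak_deriv (slice u t) (slice g t)}.

(* The weak x-derivative, unique up to a.e. equality; junk if there is none. *)
Definition Dx u : R * R -> R := xget (fun=> 0) [set g | is_Dx u g].

Definition L2H1 u := L2Q u /\ exists g, is_Dx u g.

(* L^2((0,1), H^2(0,1) /\ H^1_0(0,1)) *)
Definition L2H2H10 u :=
  [/\ L2H1 u, L2H1 (Dx u) & {ae leb1 R, forall t, I01 t -> H10 (slice u t)}].

(* C([0,1], L^2(0,1)) *)
Definition C0L2 u :=
  (forall t, t \in `[0, 1] -> L2I (slice u t)) /\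
  forall t, t \in `[0, 1] -> forall e : R, 0 < e ->
    \forall t' \near t, t' \in `[0, 1] ->
      normI (fun x => u (x, t') - u (x, t)) < e.

Definition C0L2_L2H1 u := C0L2 u /\ L2H1 u.

(* [u] belongs to C([0,1], H^{-1}(0,1)), its continuous representative
   being [F]: the individual time slices of [u] need not make sense. *)
Definition C0Hm1 u (F : R -> (R -> R) -> R) :=
  [/\ forall t, t \in `[0, 1] -> Hm1 (F t),
      forall t, t \in `[0, 1] -> forall e : R, 0 < e ->
        \forall t' \near t, t' \in `[0, 1] -> Hm1_close e (F t') (F t)
    & {ae leb1 R, forall t, I01 t -> forall phi, test_function I01 phi ->
        F t phi = pairing (slice u t) phi}].

Definition norm_L2H2 u : R :=
  Num.sqrt (intQ (fun p => u p ^+ 2 + Dx u p ^+ 2 + Dx (Dx u) p ^+ 2)).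

(* The supremum is finite for [u] in C([0,1], L^2(0,1)). *)
Definition norm_C0L2_L2H1 u : R :=
  sup [set normI (slice u t) | t in `[0, 1]] +
  Num.sqrt (intQ (fun p => u p ^+ 2 + Dx u p ^+ 2)).

(** ** The HV metric *)

(* f_t + f_x v = z weakly on Q01; as f is only in L^2, the product f_x v is the
   distribution  phi |-> - int f (v phi)_x. *)
Definition weak_transport f v z :=
  forall psi, test_function Q01 psi ->
    intQ (fun p => f p * dt psi p + f p * (Dx v p * psi p + v p * dx psi p)
                   + z p * psi p) = 0.

Definition admissible (rho0 rho1 : R -> R) (f v z : R * R -> R) :=
  [/\ L2Q f, L2H2H10 v, L2Q z, weak_transport f v z &
    exists F, [/\ C0Hm1 f F,
      forall phi, test_function I01 phi -> F 0 phi = pairing rho0 phi &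
      forall phi, test_function I01 phi -> F 1 phi = pairing rho1 phi]].

Section Metric.
Variables kappa lambda eps : R.

Definition hv_energy v z : R :=
  2^-1 * intQ (fun p => kappa * v p ^+ 2 + lambda * Dx v p ^+ 2
                        + eps * Dx (Dx v) p ^+ 2 + z p ^+ 2).

Definition dHV2 (rho0 rho1 : R -> R) : R :=
  inf [set E | exists f v z,
         admissible rho0 rho1 f v z /\ E = hv_energy v z].

Definition minimizing_geodesic (rho0 rho1 : R -> R) (f v z : R * R -> R) :=
  admissible rho0 rho1 f v z /\ hv_energy v z = dHV2 rho0 rho1.

(* eps v_xxxx - lambda v_xx + kappa v + z rho_x = 0 weakly on Q01 *)
Definition weak_elliptic (rho v z : R * R -> R) :=
  forall psi, test_function Q01 psi ->
    intQ (fun p => eps * Dx (Dx v) p * dx (dx psi) p + lambda * Dx v p * dx psi p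
                   + kappa * v p * psi p + z p * Dx rho p * psi p) = 0.

(* z_t + (z v)_x = 0 weakly on Q01 *)
Definition weak_conservation (v z : R * R -> R) :=
  forall psi, test_function Q01 psi ->
    intQ (fun p => z p * dt psi p + z p * v p * dx psi p) = 0.

(* The boundary conditions v = v_xx = 0 at x = 0, 1 are expressed by
   membership of the time slices in H^1_0(0,1); for v it is part of
   [L2H2H10]. *)
Definition euler_lagrange (rho0 rho1 : R -> R) (rho v z : R * R -> R) :=
  [/\ [/\ C0L2_L2H1 rho, L2H2H10 v & C0L2_L2H1 z],
      weak_elliptic rho v z /\
        {ae leb1 R, forall t, I01 t -> H10 (slice (Dx (Dx v)) t)},
      weak_conservation v z,
      weak_transport rho v z
    & {ae leb1 R, forall x, I01 x -> rho (x, 0) = rho0 x} /\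
      {ae leb1 R, forall x, I01 x -> rho (x, 1) = rho1 x}].

End Metric.

(* u^s = u0 + s u1 + s^2 u2 + o(s^2) as s -> 0, for the norm [N]. *)
Definition expansion2 (N : (R * R -> R) -> R) (us : R -> R * R -> R) u0 u1 u2 :=
  (fun s => N (fun p => us s p - (u0 p + s * u1 p + s ^+ 2 * u2 p)))
    =o_ (0 : R) (fun s => s ^+ 2).

(* The coefficients lie in the spaces where the expansions take place; in
   these norms all terms of the Euler-Lagrange system may be expanded. *)
Definition geodesic_expansion (rhos vs zs : R -> R * R -> R)
    (f f1 f2 v v1 v2 z z1 z2 : R * R -> R) :=
  [/\ [/\ C0L2_L2H1 f, C0L2_L2H1 f1 & C0L2_L2H1 f2] /\
        [/\ C0L2_L2H1 z, C0L2_L2H1 z1 & C0L2_L2H1 z2],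
      [/\ L2H2H10 v, L2H2H10 v1 & L2H2H10 v2],
      expansion2 norm_C0L2_L2H1 rhos f f1 f2,
      expansion2 norm_L2H2 vs v v1 v2
    & expansion2 norm_C0L2_L2H1 zs z z1 z2].

End Spaces.

(* Main.v *)
Require Import Defs.
From mathcomp Require Import measurable_realfun ring lra.

(** The expansion holds because of an exact identity between two solutions of
    the Euler-Lagrange system; nothing is differentiated in s.

    Write B(v, g) for the integral of
    [kappa v g + lambda v_x g_x + eps v_xx g_xx] and T(p, q, r) for the
    integral of [p q r] over the square, and let (rho, v, z) and
    (rho', v', z') be two solutions. Two kinds of testing are exact:
    - the elliptic equation tested with the velocity of either solution gives
      B(v, g) = - T(z, rho_x, g) ([el_work]);
    - the density z tested with the signal rho' gives
      [<z, rho'>] from t = 0 to t = 1 equal to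
      T(z, rho'_x, v) + <z, z'> - T(z, rho'_x, v') ([el_time]).
    Used for all pairs of solutions, and with the symmetry of B and of <.,.>,
    they yield, E being the energy ([energy_identity])
      E' - E = 1/2 (b(1) - b(0)) - 1/2 T(z' - z, rho'_x - rho_x, v' - v),
    where b(t) is the integral over x of (z' + z)(rho' - rho) at time t. For
    the geodesics with parameters s and 0 the final signals agree, so b(1)
    vanishes, and the initial signals differ by s theta, so that b(0) is s
    times the integral of (z^s + z^0) theta at t = 0. The last term is
    trilinear in increments of size O(s), hence O(s^3) ([trilinear_small]), and
    z^s + z^0 = 2 z + s z_1 + O(s^2) at t = 0 in L^2(0,1)
    ([C0L2_expansion]). This is the expansion, with a cubic remainder.

    The analytic work lies in testing the weak equations with functions that
    are only Sobolev. Both equations are tested with products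
    phi(x) eta(t). A countable family of test functions ([bump_seq]) is enough
    to recognize weak derivatives ([du_bois_reymond]), so each weak equation
    holds on almost every slice for the whole family at once. On a slice in
    space, weakly differentiable functions are absolutely continuous
    ([weak_deriv_abscont]), those of H^1_0 vanish at both ends
    ([H10_abscont]), and every integration by parts becomes the product rule
    [abscontM]. In time, the signal and z are absolutely continuous on almost
    every line x = const ([time_abscont]), with values at t = 0 and t = 1
    given by the continuous curve in L^2 ([time_trace]); integrating the
    product rule on these lines over x gives [time_parts]. All triple products
    are integrable by the one-dimensional Sobolev embedding ([triple_Q]). *)

Set Implicit Arguments.
Unset Strict Implicit.
Unset Printing Implicit Defensive.

Local Open Scope classical_set_scope.
Local Open Scope ring_scope.

(** * Real-valued integrals *)

Section RealIntegrals.
Context d (T : measurableType d) (R : realType).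
Variables (mu : {measure set T -> \bar R}) (D : set T).
Hypothesis mD : measurable D.
Implicit Types f g h : T -> R.

Definition rintegrable f := mu.-integrable D (EFin \o f).

Lemma rintegrable_meas f : rintegrable f -> measurable_fun D f.
Proof. by move=> /measurable_int /measurable_EFinP. Qed.

Lemma rintegrableD f g : rintegrable f -> rintegrable g ->
  rintegrable (fun x => f x + g x).
Proof.
move=> fi gi; rewrite /rintegrable (_ : _ \o _ = (EFin \o f) \+ (EFin \o g))%E//.
exact: integrableD.
Qed.

Lemma rintegrableB f g : rintegrable f -> rintegrable g ->
  rintegrable (fun x => f x - g x).
Proof.
move=> fi gi; rewrite /rintegrable (_ : _ \o _ = (EFin \o f) \- (EFin \o g))%E//.
exact: integrableB.
Qed.

Lemma rintegrableZ c f : rintegrable f -> rintegrable (fun x => c * f x).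
Proof.
move=> fi; rewrite /rintegrable (_ : _ \o _ = fun x => (c%:E * (EFin \o f) x)%E)//.
exact: integrableZl.
Qed.

Lemma rintegrableN f : rintegrable f -> rintegrable (fun x => - f x).
Proof.
by move=> fi; rewrite (_ : (fun _ => _) = fun x => -1 * f x);
  [exact: rintegrableZ | apply/funext => x; rewrite mulN1r].
Qed.

Lemma rintegrable_norm f : rintegrable f -> rintegrable (fun x => `|f x|).
Proof. exact: integrable_norm. Qed.

Lemma rintegrable_le f g : measurable_fun D f -> rintegrable g ->
  (forall x, D x -> `|f x| <= g x) -> rintegrable f.
Proof.
move=> mf gi fg; apply: (le_integrable mD _ _ gi); first exact/measurable_EFinP.
move=> x Dx /=; rewrite lee_fin (le_trans (fg x Dx))//; exact: ler_norm.
Qed.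

Lemma rintegral_ae f g : measurable_fun D f -> measurable_fun D g ->
  {ae mu, forall x, D x -> f x = g x} ->
  \int[mu]_(x in D) f x = \int[mu]_(x in D) g x.
Proof.
move=> mf mg fg; rewrite /Rintegral; congr fine.
apply: ae_eq_integral => //; [exact/measurable_EFinP..|].
by apply: filterS fg => x /= fg Dx; rewrite fg.
Qed.

Lemma rintegrable_ae_le f g : measurable_fun D f -> rintegrable g ->
  {ae mu, forall x, D x -> `|f x| <= g x} ->
  rintegrable f /\ \int[mu]_(x in D) `|f x| <= \int[mu]_(x in D) g x.
Proof.
move=> mf gi fg.
have mg := rintegrable_meas gi.
have le : (\int[mu]_(x in D) `|(f x)%:E| <= \int[mu]_(x in D) `|(g x)%:E|)%E.
  apply: ae_ge0_le_integral => //.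
  - by apply: measurableT_comp => //; exact/measurable_EFinP.
  - by apply: measurableT_comp => //; exact/measurable_EFinP.
  - apply: filterS fg => x /= fg Dx; rewrite lee_fin (le_trans (fg Dx))//.
    exact: ler_norm.
have fi : rintegrable f.
  apply/integrableP; split; first exact/measurable_EFinP.
  by apply: le_lt_trans le _; case/integrableP: gi.
split=> //.
have -> : \int[mu]_(x in D) g x = \int[mu]_(x in D) `|g x|.
  apply: rintegral_ae => //; first exact: measurableT_comp.
  by apply: filterS fg => x /= fg Dx; rewrite ger0_norm// (le_trans _ (fg Dx)).
rewrite /Rintegral fine_le//; apply: integrable_fin_num => //;
  exact: rintegrable_norm.
Qed.

Lemma le_rintegral_ae f g : rintegrable f -> rintegrable g ->
  {ae mu, forall x, D x -> f x <= g x} ->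
  \int[mu]_(x in D) f x <= \int[mu]_(x in D) g x.
Proof.
move=> fi gi fg; rewrite -subr_ge0 -RintegralB//.
have hi := rintegrableB gi fi.
have -> : \int[mu]_(x in D) (g x - f x) = \int[mu]_(x in D) `|g x - f x|.
  apply: rintegral_ae; [exact: rintegrable_meas | |].
    by apply: measurableT_comp => //; exact: rintegrable_meas.
  by apply: filterS fg => x /= fg Dx; rewrite ger0_norm// subr_ge0 fg.
exact: Rintegral_ge0.
Qed.

Lemma rintegrable_ae_eq f g : measurable_fun D f -> rintegrable g ->
  {ae mu, forall x, D x -> f x = g x} -> rintegrable f.
Proof.
move=> mf gi fg.
have gi' := rintegrable_norm gi.
apply: (rintegrable_ae_le mf gi' _).1.
by apply: filterS fg => x /= fg Dx; rewrite fg.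
Qed.

Lemma rintegral_eq0_ae f : rintegrable f -> (forall x, D x -> 0 <= f x) ->
  \int[mu]_(x in D) f x <= 0 -> {ae mu, forall x, D x -> f x = 0}.
Proof.
move=> fi f0 fle0.
have := (ae_eq_integral_abs mu mD (measurable_int _ fi)).1.
have -> : (\int[mu]_(x in D) `|(EFin \o f) x| = 0)%E.
  rewrite (eq_integral (EFin \o f)); last first.
    by move=> x /[!inE] Dx /=; rewrite ger0_norm// f0.
  rewrite -(@fineK _ (integral _ _ _)) ?integrable_fin_num//.
  by congr EFin; apply/eqP; rewrite eq_le fle0 /=; exact: Rintegral_ge0.
move=> /(_ erefl); apply: filterS => x /= H Dx.
by have [] := H Dx.
Qed.

Definition sqintegrable f := measurable_fun D f /\ rintegrable (fun x => f x ^+ 2).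

Lemma sqintegrable_mul f g : sqintegrable f -> sqintegrable g ->
  rintegrable (fun x => f x * g x).
Proof.
move=> [mf fi] [mg gi].
apply: (@rintegrable_le _ (fun x => f x ^+ 2 + g x ^+ 2)).
- exact: measurable_funM.
- exact: rintegrableD.
- move=> x Dx; rewrite normrM -(real_normK (num_real (f x))) -(real_normK (num_real (g x))).
  by nra.
Qed.

Lemma sqintegrableD f g : sqintegrable f -> sqintegrable g ->
  sqintegrable (fun x => f x + g x).
Proof.
move=> fi gi; have fgi := sqintegrable_mul fi gi.
case: fi gi => [mf fi] [mg gi]; split; first exact: measurable_funD.
rewrite (_ : (fun _ => _) = fun x => f x ^+ 2 + 2 * (f x * g x) + g x ^+ 2).
  by apply: rintegrableD => //; apply: rintegrableD => //; exact: rintegrableZ.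
by apply/funext => x; ring.
Qed.

Lemma sqintegrableZ c f : sqintegrable f -> sqintegrable (fun x => c * f x).
Proof.
move=> [mf fi]; split; first exact: measurable_funM.
rewrite (_ : (fun _ => _) = fun x => c ^+ 2 * f x ^+ 2); first exact: rintegrableZ.
by apply/funext => x; ring.
Qed.

Lemma sqintegrableN f : sqintegrable f -> sqintegrable (fun x => - f x).
Proof.
move=> fi; rewrite (_ : (fun _ => _) = fun x => -1 * f x); first exact: sqintegrableZ.
by apply/funext => x; rewrite mulN1r.
Qed.

Lemma sqintegrableB f g : sqintegrable f -> sqintegrable g ->
  sqintegrable (fun x => f x - g x).
Proof. by move=> fi gi; apply: sqintegrableD => //; exact: sqintegrableN. Qed.

Hypothesis fD : (mu D < +oo)%E.

Lemma rintegrable_cst c : rintegrable (fun=> c).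
Proof. 
apply: (@measurable_bounded_integrable _ _ _ mu (fun=> c) D) => //.
exists `|c|; split; first exact: num_real.
by move=> x cx y Dy; exact: ltW.
Qed.

Lemma sqintegrable_rint f : sqintegrable f -> rintegrable f.
Proof.
move=> fi; rewrite (_ : f = fun x => f x * 1); last first.
  by apply/funext => x; rewrite mulr1.
by apply: sqintegrable_mul => //; split => //; exact: rintegrable_cst.
Qed.

End RealIntegrals.

(** * Fubini and Tonelli on the unit square *)

#[global] Instance ae_lebesgue_filter {R : realType} :
  Filter (nbhs (almost_everywhere (@lebesgue_measure R))).
Proof. exact: (ae_filter_ringOfSetsType (@lebesgue_measure R)). Qed.

Section UnitSquare.
Context {R : realType}.
Local Notation leb := (@lebesgue_measure R).
Local Notation leb2 := (@lebesgue_measure R \x @lebesgue_measure R)%E.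
Implicit Types (u : R * R -> R) (a b : R -> R).

Definition itgI a := rintegrable leb I01 a.
Definition itgQ u := rintegrable leb2 Q01 u.

Definition tslice u x : R -> R := fun t => u (x, t).

Lemma mI01 : measurable (I01 : set (measurableTypeR R)).
Proof. exact: measurable_itv. Qed.

Lemma mQ01 : measurable (Q01 : set (measurableTypeR R * measurableTypeR R)).
Proof. by apply: measurableX; exact: measurable_itv. Qed.

Lemma leb_I01 : leb I01 = 1%:E.
Proof. by rewrite /I01 lebesgue_measure_itv /= lte_fin ltr01 oppr0 adde0. Qed.

Lemma fin_I01 : (leb I01 < +oo)%E.
Proof. by rewrite leb_I01 ltry. Qed.

Lemma leb2_Q01 : leb2 Q01 = 1%:E.
Proof.
rewrite /Q01 product_measure1E; [|exact: mI01..].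
by transitivity (leb I01 * leb I01)%E => //; rewrite leb_I01 mule1.
Qed.

Lemma fin_Q01 : (leb2 Q01 < +oo)%E.
Proof. by rewrite leb2_Q01 ltry. Qed.

Lemma norm_intI a : itgI a -> `|intI a| <= intI (fun x => `|a x|).
Proof. by move=> ai; exact: (le_normr_Rintegral mI01 ai). Qed.

Lemma intID a b : itgI a -> itgI b -> intI (fun x => a x + b x) = intI a + intI b.
Proof. by move=> ai bi; exact: (RintegralD mI01 ai bi). Qed.

Lemma intIB a b : itgI a -> itgI b -> intI (fun x => a x - b x) = intI a - intI b.
Proof. by move=> ai bi; exact: (RintegralB mI01 ai bi). Qed.

Lemma intIZ c a : itgI a -> intI (fun x => c * a x) = c * intI a.
Proof. by move=> ai; exact: (RintegralZl _ mI01 ai). Qed.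

Lemma intQD u w : itgQ u -> itgQ w -> intQ (fun x => u x + w x) = intQ u + intQ w.
Proof. by move=> ai bi; exact: (RintegralD mQ01 ai bi). Qed.

Lemma intQB u w : itgQ u -> itgQ w -> intQ (fun x => u x - w x) = intQ u - intQ w.
Proof. by move=> ai bi; exact: (RintegralB mQ01 ai bi). Qed.

Lemma intQZ c u : itgQ u -> intQ (fun x => c * u x) = c * intQ u.
Proof. by move=> ai; exact: (RintegralZl _ mQ01 ai). Qed.

Lemma intI_ge0 a : (forall x, I01 x -> 0 <= a x) -> 0 <= intI a.
Proof. by move=> a0; exact: (@Rintegral_ge0 _ _ _ leb). Qed.

Lemma intQ_ge0 u : (forall p, Q01 p -> 0 <= u p) -> 0 <= intQ u.
Proof. by move=> a0; exact: (@Rintegral_ge0 _ _ _ leb2). Qed.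

Lemma eq_intI a b : (forall x, I01 x -> a x = b x) -> intI a = intI b.
Proof. by move=> ab; apply: (@eq_Rintegral _ _ _ leb) => x /set_mem; exact: ab. Qed.

Lemma eq_intQ u w : (forall x, Q01 x -> u x = w x) -> intQ u = intQ w.
Proof. by move=> ab; apply: (@eq_Rintegral _ _ _ leb2) => x /set_mem; exact: ab. Qed.

Lemma eq_intI_ae a b : measurable_fun I01 a -> measurable_fun I01 b ->
  {ae leb, forall x, I01 x -> a x = b x} -> intI a = intI b.
Proof. exact: (rintegral_ae mI01). Qed.

Lemma intI_cst (c : R) : intI (fun _ : R => c) = c.
Proof.
have -> : intI (fun _ : R => c) = c * fine (leb I01).
  exact: (Rintegral_cst leb mI01).
by rewrite leb_I01 mulr1.
Qed.

Lemma le_intI a b : itgI a -> itgI b ->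
  {ae leb, forall x, I01 x -> a x <= b x} -> intI a <= intI b.
Proof. exact: (le_rintegral_ae mI01). Qed.

Lemma le_intQ u w : itgQ u -> itgQ w ->
  (forall p, Q01 p -> u p <= w p) -> intQ u <= intQ w.
Proof. by move=> ui wi; exact: (le_Rintegral mQ01 ui wi). Qed.

Lemma slice_meas u t : measurable_fun Q01 u -> I01 t ->
  measurable_fun I01 (slice u t).
Proof.
move=> mu It; apply: (@measurable_comp _ _ _ _ _ _ Q01 u I01 (fun x => (x, t))) => //.
- exact: mQ01.
- by move=> _ [x Ix <-].
- exact: measurable_funTS.
Qed.

Lemma tslice_meas u x : measurable_fun Q01 u -> I01 x ->
  measurable_fun I01 (tslice u x).
Proof.
move=> mu Ix; apply: (@measurable_comp _ _ _ _ _ _ Q01 u I01 (fun t => (x, t))) => //.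
- exact: mQ01.
- by move=> _ [t It <-].
- apply: measurable_funTS; exact: pair1_measurable.
Qed.

Lemma in_Q01 x t : ((x, t) \in (Q01 : set (R * R))) = (x \in I01) && (t \in I01).
Proof.
by apply/idP/andP => [/set_mem [Ix It]|[/set_mem Ix /set_mem It]];
  [split|]; apply/mem_set.
Qed.

Lemma patch_slice u x t :
  (u \_ Q01) (x, t) = if t \in I01 then (slice u t \_ I01) x else 0.
Proof.
by rewrite !patchE in_Q01; case: (x \in I01); case: (t \in I01).
Qed.

Lemma patch_tslice u x t :
  (u \_ Q01) (x, t) = if x \in I01 then (tslice u x \_ I01) t else 0.
Proof.
by rewrite !patchE in_Q01; case: (x \in I01); case: (t \in I01).
Qed.

Lemma itgI_patch a : itgI a <-> leb.-integrable setT (EFin \o (a \_ I01)).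
Proof. by rewrite -restrict_EFin; apply: integrable_mkcond; exact: mI01. Qed.

Lemma itgQ_patch u : itgQ u <-> leb2.-integrable setT (EFin \o (u \_ Q01)).
Proof. by rewrite -restrict_EFin; apply: integrable_mkcond; exact: mQ01. Qed.

Lemma fubini_tslice u : itgQ u ->
  [/\ {ae leb, forall x, I01 x -> itgI (tslice u x)},
      itgI (fun x => intI (tslice u x)) &
      intQ u = intI (fun x => intI (tslice u x))].
Proof.
move=> /itgQ_patch ui.
have aeu : {ae leb, forall t, I01 t -> itgI (tslice u t)}.
  apply: filterS (ae_integrable1 ui) => t /= ti It; apply/itgI_patch.
  apply: eq_integrable ti => // x _ /=.
  by rewrite patch_tslice mem_set.
have GE t : fubini_F leb (EFin \o (u \_ Q01)) t =
    if t \in I01 then (\int[leb]_(x in I01) (tslice u t x)%:E)%E else 0%E.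
  rewrite /fubini_F; under eq_integral do rewrite /= patch_tslice.
  case: ifPn => It; last by rewrite integral0.
  by rewrite [RHS]integral_mkcond restrict_EFin.
have Gi := integrable_fubini_F ui.
have mG : measurable_fun I01 (fun t => intI (tslice u t)).
  have := measurable_fubini_F ui => /(measurable_funTS (D := I01)) m1.
  have : measurable_fun I01 (fine \o fubini_F leb (EFin \o (u \_ Q01))).
    by apply: measurableT_comp.
  apply: eq_measurable_fun => t /= tI; by rewrite GE tI.
have Gae : {ae leb, forall t, I01 t ->
   (intI (tslice u t))%:E = fubini_F leb (EFin \o (u \_ Q01)) t}.
  apply: filterS aeu => t /= ti It; rewrite GE mem_set// /intI /Rintegral fineK//.
  by apply: integrable_fin_num; [exact: mI01|exact: ti].
split => //.
- apply/integrableP; split; first exact/measurable_EFinP.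
  have /integrableP[_] := Gi; apply: le_lt_trans.
  rewrite [leRHS](_ : _ = \int[leb]_(x in I01)
      `|fubini_F leb (EFin \o (u \_ Q01)) x|)%E; last first.
    rewrite [RHS]integral_mkcond; apply: eq_integral => t _.
    rewrite patchE; case: ifPn => // /negbTE It; have := GE t; rewrite It => G0.
    by rewrite [X in (`|X|)%E](G0 : fubini_F _ _ t = 0%E) abse0.
  have mG' : measurable_fun I01 (fubini_F leb (EFin \o (u \_ Q01))).
    by apply: measurable_funTS; exact: (measurable_fubini_F ui).
  apply: ae_ge0_le_integral => //; [exact: mI01| | | ].
  + by apply: measurableT_comp => //; exact/measurable_EFinP.
  + exact: measurableT_comp.
  + by apply: filterS Gae => t /= Gt It; rewrite -Gt.
- rewrite /intQ Rintegral_mkcond /Rintegral -[X in fine X]/(integral leb2 setT (EFin \o (u \_ Q01))).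
  rewrite -(integral12_prod_meas1 ui) /intI /Rintegral; congr fine.
  rewrite [RHS]integral_mkcond; apply: ae_eq_integral => //.
  + exact: (measurable_fubini_F ui).
  + apply/(measurable_restrictT _ _).1; [exact: mI01|exact/measurable_EFinP].
  + apply: filterS Gae => t /= Gt _.
    rewrite patchE; case: ifPn => [/set_mem It|/negbTE It]; first exact: (esym (Gt It)).
    by have := GE t; rewrite It.
Qed.

(** Exchanging the two variables transfers each statement on lines x = const to
    lines t = const. *)
Lemma swap_Q u : itgQ u ->
  itgQ (u \o swap_pair) /\ intQ (u \o swap_pair) = intQ u.
Proof.
move=> /itgQ_patch ui.
have patch_swap p : ((u \o swap_pair) \_ Q01) p = (u \_ Q01) (swap_pair p).
  by case: p => x t; rewrite !patchE /= !in_Q01 andbC.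
have mu := measurable_int _ ui.
have ms : measurable_fun setT (EFin \o ((u \o swap_pair) \_ Q01)).
  rewrite (_ : _ \o _ = (EFin \o (u \_ Q01)) \o swap_pair).
    by apply: measurableT_comp => //; exact: measurable_swap.
  by apply/funext => p /=; rewrite patch_swap.
have si : leb2.-integrable setT (EFin \o ((u \o swap_pair) \_ Q01)).
  apply/integrable21ltyP => //; have /(integrable12ltyP _) := ui => /(_ mu).
  by under eq_integral do under eq_integral do rewrite -[(_, _)]/(swap_pair (_, _)) /= -patch_swap.
split; first exact/itgQ_patch.
have -> : intQ u = fine (\int[leb]_x fubini_F leb (EFin \o (u \_ Q01)) x)%E.
  rewrite /intQ Rintegral_mkcond /Rintegral.
  rewrite -[X in fine X]/(integral leb2 setT (EFin \o (u \_ Q01))).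
  by rewrite -(integral12_prod_meas1 ui).
have -> : intQ (u \o swap_pair) =
    fine (\int[leb]_x fubini_G leb (EFin \o ((u \o swap_pair) \_ Q01)) x)%E.
  rewrite /intQ Rintegral_mkcond /Rintegral.
  rewrite -[X in fine X]/(integral leb2 setT (EFin \o ((u \o swap_pair) \_ Q01))).
  by rewrite -(integral21_prod_meas1 si).
apply: (congr1 fine).
by apply: eq_integral => x _; apply: eq_integral => t _ /=; rewrite patch_swap.
Qed.

Lemma fubini_slice u : itgQ u ->
  [/\ {ae leb, forall t, I01 t -> itgI (slice u t)},
      itgI (fun t => intI (slice u t)) &
      intQ u = intI (fun t => intI (slice u t))].
Proof. by move=> /swap_Q [/fubini_tslice [ae iF eF] <-]. Qed.

(** A bound on almost every slice decides integrability on the square. Products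
    of three functions are treated this way: none of the factors is bounded,
    but on a slice one of them is. *)
Lemma tonelli_slice u (G : R -> R) : measurable_fun Q01 u -> itgI G ->
  {ae leb, forall t, I01 t -> itgI (slice u t) /\
     intI (fun x => `|slice u t x|) <= G t} ->
  itgQ u /\ `|intQ u| <= intI G.
Proof.
move=> mu Gi uG.
have ui : itgQ u.
  have mU : measurable_fun setT (u \_ Q01).
    by apply/(measurable_restrictT _ _).1 => //; exact: mQ01.
  apply/itgQ_patch; apply/integrable21ltyP; first exact/measurable_EFinP.
  have /integrableP[_] := Gi; apply: le_lt_trans.
  set f := fun y : R => (\int[leb]_x `|(EFin \o u \_ Q01) (x, y)|)%E.
  have mf : measurable_fun setT f.
    apply: (@measurable_fun_fubini_tonelli_G _ _ _ _ _ leb (abse \o (EFin \o u \_ Q01))) => //.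
      by apply: measurableT_comp => //; exact/measurable_EFinP.
    by move=> p; exact: abse_ge0.
  have fE t : f t = if t \in I01 then (\int[leb]_(x in I01) `|(slice u t x)%:E|)%E else 0%E.
    rewrite /f; under eq_integral do rewrite /= patch_slice.
    case: ifPn => It; last by under eq_integral do rewrite normr0; rewrite integral0.
    rewrite [RHS]integral_mkcond; apply: eq_integral => x _.
    by rewrite !patchE; case: ifPn => //=; rewrite normr0.
  rewrite [leLHS](_ : _ = \int[leb]_(x in I01) f x)%E; last first.
    rewrite [RHS]integral_mkcond; apply: eq_integral => t _.
    by rewrite patchE; case: ifPn => // /negbTE It; have := fE t; rewrite It.
  apply: ae_ge0_le_integral => //.
  + exact: mI01.
  + by move=> t _; exact: integral_ge0.
  + exact: measurable_funTS.
  + by apply: measurableT_comp => //; exact: measurable_int Gi.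
  + apply: filterS uG => t /= + It => /(_ It) [si le].
    rewrite fE mem_set//.
    rewrite (_ : integral _ _ _ = (intI (fun x => `|slice u t x|))%:E).
      by rewrite lee_fin (le_trans le)// ler_norm.
    rewrite /intI /Rintegral fineK//; apply: integrable_fin_num; first exact: mI01.
    exact: rintegrable_norm.
split=> //; have [_ Fi ->] := fubini_slice ui.
apply: (le_trans (norm_intI Fi)); apply: le_intI => //.
  exact: (rintegrable_norm Fi).
apply: filterS uG => t /= + It => /(_ It) [si le].
exact: le_trans (norm_intI si) le.
Qed.

End UnitSquare.

(** * Smooth functions *)

Section SmoothFunctions.
Context {R : realType}.

Section General.
Variable V : normedModType R.
Implicit Types (f g : V -> R).

(** Smoothness quantifies over all words of directions. A class of
    differentiable functions that is stable under every directional derivative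
    only contains smooth functions, so that smoothness is proved by exhibiting
    such a class instead of computing iterated derivatives. *)
Lemma smooth_coind (P : (V -> R) -> Prop) :
  (forall f, P f -> (forall p, differentiable f p) /\ forall h, P ('D_h f)) ->
  forall f, P f -> smooth f.
Proof.
move=> step f Pf l p; suff : P (foldr (fun h chi => 'D_h chi) f l).
  by move=> /step[].
by elim: l => //= h l IH; exact: (step _ IH).2.
Qed.

Lemma smooth_diff f : smooth f -> forall p, differentiable f p.
Proof. by move=> sf p; exact: (sf [::] p). Qed.

Lemma smooth_D f h : smooth f -> smooth ('D_h f).
Proof.
by move=> sf l p; have := sf (rcons l h) p; rewrite foldr_rcons.
Qed.

(** The stable class behind the Leibniz rule: derivatives of products are sums
    of products of smooth functions. *)
Inductive smooth_alg : (V -> R) -> Prop :=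
| SmoothGen f : smooth f -> smooth_alg f
| SmoothAdd f g : smooth_alg f -> smooth_alg g -> smooth_alg (f \+ g)
| SmoothMul f g : smooth_alg f -> smooth_alg g -> smooth_alg (f \* g).

Lemma smooth_algP f : smooth_alg f -> smooth f.
Proof.
apply: smooth_coind => {}f; elim=> {f} [f sf|f g _ [df Df] _ [dg Dg]|f g af [df Df] ag [dg Dg]].
- split; first exact: smooth_diff.
  by move=> h; exact/SmoothGen/smooth_D.
- split; first by move=> p; exact: differentiableD.
  move=> h; rewrite (_ : 'D_h _ = 'D_h f \+ 'D_h g); first exact: SmoothAdd.
  by apply/funext => p; rewrite deriveD//; exact: diff_derivable.
- split; first by move=> p; exact: differentiableM.
  move=> h; rewrite (_ : 'D_h _ = (f \* 'D_h g) \+ (g \* 'D_h f)).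
    by apply: SmoothAdd; exact: SmoothMul.
  by apply/funext => p; rewrite deriveM//; exact: diff_derivable.
Qed.

Lemma smoothD f g : smooth f -> smooth g -> smooth (fun p => f p + g p).
Proof. by move=> sf sg; apply: smooth_algP; apply: SmoothAdd; exact: SmoothGen. Qed.

Lemma smoothM f g : smooth f -> smooth g -> smooth (fun p => f p * g p).
Proof. by move=> sf sg; apply: smooth_algP; apply: SmoothMul; exact: SmoothGen. Qed.

Lemma smooth_cst c : smooth (fun _ : V => c : R).
Proof.
apply: (@smooth_coind (fun f => exists c, f = cst c)); last by exists c.
move=> _ [{}c ->]; split; first by move=> p; exact: differentiable_cst.
by move=> h; exists 0; apply/funext => p; rewrite derive_cst.
Qed.

End General.

(** For L with constant differential l, the directional derivatives of f o L
    are those of f composed with L, so that functions of this form are stable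
    under differentiation. *)
Lemma derive_comp (V W : normedModType R) (f : V -> R) (L l : W -> V) h p :
  differentiable L p -> 'd L p h = l h -> differentiable f (L p) ->
  'D_h (fun p => f (L p)) p = 'D_(l h) f (L p).
Proof.
move=> dL Ll df; rewrite deriveE; last exact: (differentiable_comp dL df).
by rewrite (diff_comp dL df)/= Ll deriveE.
Qed.

Lemma smooth_comp (V W : normedModType R) (f : V -> R) (L l : W -> V) :
  (forall p, differentiable L p) -> (forall p h, 'd L p h = l h) ->
  smooth f -> smooth (fun p => f (L p)).
Proof.
move=> dL Ll sf.
apply: (@smooth_coind W (fun g => exists2 f : V -> R, smooth f & g = f \o L)); last by exists f.
move=> _ [{sf}f sf ->]; split.
  by move=> p; apply: differentiable_comp => //; exact: smooth_diff.
move=> h; exists ('D_(l h) f); first exact: smooth_D.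
by apply/funext => p; exact: (derive_comp (dL p) (Ll p h) (smooth_diff sf _)).
Qed.

Lemma smooth_affine (f : R -> R) (c e : R) :
  smooth f -> smooth (fun x => f (c * x + e)).
Proof.
move=> sf.
have dL (p : R) : is_diff p (fun x : R => c * x + e : R) (fun h : R => c * h : R).
  have -> : (fun x : R => c * x + e) = (c *: id) + cst e by [].
  by apply: is_diff_eq; apply/funext => h; rewrite /= addr0.
apply: (@smooth_comp _ _ f _ (fun h : R => c * h)) => // p; have [dp Dp] := dL p; move=> h.
by rewrite Dp.
Qed.

Lemma diff_fst (p : R * R) :
  differentiable (fst : R * R -> R) p /\ forall h, 'd (fst : R * R -> R) p h = h.1.
Proof.
have cf : continuous (fst : R * R -> R) by move=> q; exact: cvg_fst.
split; first exact: (linear_differentiable (f := fst)).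
by move=> h; rewrite (diff_lin (f := fst)).
Qed.

Lemma diff_snd (p : R * R) :
  differentiable (snd : R * R -> R) p /\ forall h, 'd (snd : R * R -> R) p h = h.2.
Proof.
have cf : continuous (snd : R * R -> R) by move=> q; exact: cvg_snd.
split; first exact: (linear_differentiable (f := snd)).
by move=> h; rewrite (diff_lin (f := snd)).
Qed.

Lemma smooth_fst (f : R -> R) : smooth f -> smooth (fun p : R * R => f p.1).
Proof.
by move=> sf; apply: (@smooth_comp _ _ f _ (fun h : R * R => h.1)) => // p;
  have [] := diff_fst p.
Qed.

Lemma smooth_snd (f : R -> R) : smooth f -> smooth (fun p : R * R => f p.2).
Proof.
by move=> sf; apply: (@smooth_comp _ _ f _ (fun h : R * R => h.2)) => // p;
  have [] := diff_snd p.
Qed.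

Lemma derive_tensor (f g : R -> R) h p : smooth f -> smooth g ->
  'D_h (fun p : R * R => f p.1 * g p.2) p =
  f p.1 * 'D_(h.2) g p.2 + g p.2 * 'D_(h.1) f p.1.
Proof.
move=> sf sg; rewrite deriveM; last 2 first.
- by apply: diff_derivable; exact: (smooth_diff (smooth_fst sf)).
- by apply: diff_derivable; exact: (smooth_diff (smooth_snd sg)).
have [d1 l1] := diff_fst p; have [d2 l2] := diff_snd p.
rewrite (derive_comp (l := fun h : R * R => h.1) d1 (l1 h) (smooth_diff sf _)).
by rewrite (derive_comp (l := fun h : R * R => h.2) d2 (l2 h) (smooth_diff sg _)).
Qed.

Lemma derive_R (f : R -> R) h x : derivable f x 1 -> 'D_h f x = h * derive1 f x.
Proof. by move=> /derivable1_diffP df; rewrite deriveE// diff1E. Qed.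

End SmoothFunctions.

(** * Smooth approximations of indicators *)

Section BumpFunctions.
Context {R : realType}.
Implicit Types (P : {poly R}) (x y : R).

(** The functions P(1/x) exp(-1/x), extended by 0, are the shape of all
    derivatives of exp(-1/x), which is the case P = 1. *)
Definition flat P x : R := if 0 < x then P.[x^-1] * expR (- x^-1) else 0.

(** The exponential series dominates any power. The decay of order 2 is what
    makes [flat P] differentiable at 0, with derivative 0. *)
Lemma poly_expR_bound P : exists2 C : R, 0 <= C &
  forall y, 1 <= y -> `|P.[y] * expR (- y)| <= C / y ^+ 2.
Proof.
pose n := size P.
exists ((\sum_(i < n) `|P`_i|) * (n.+2)`!%:R).
  by rewrite mulr_ge0// sumr_ge0.
move=> y y1; have y0 : 0 < y by exact: lt_le_trans y1.
rewrite normrM (ger0_norm (expR_ge0 _)).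
have h1 : `|P.[y]| <= (\sum_(i < n) `|P`_i|) * y ^+ n.
  rewrite horner_coef (le_trans (ler_norm_sum _ _ _))// mulr_suml ler_sum// => i _.
  rewrite normrM ler_wpM2l// ger0_norm ?exprn_ge0 ?(ltW y0)//.
  by rewrite ler_weXn2l// ltnW.
have h2 : expR (- y) <= (n.+2)`!%:R / y ^+ n.+2.
  have yn0 : 0 < y ^+ n.+2 / (n.+2)`!%:R.
    by rewrite divr_gt0// ?exprn_gt0// ltr0n fact_gt0.
  rewrite expRN -invf_div lef_pV2 ?posrE ?expR_gt0//.
  by rewrite (le_trans _ (expR_ge1Dxn n.+1 (ltW y0)))// lerDr.
apply: (le_trans (ler_pM (normr_ge0 _) (expR_ge0 _) h1 h2)).
rewrite le_eqVlt; apply/orP; left; apply/eqP.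
rewrite -addn2 exprD; field.
by rewrite !gt_eqF ?exprn_gt0.
Qed.

Lemma is_derive_flat P x : is_derive x 1 (flat P) (flat ('X^2 * (P - P^`())) x).
Proof.
have [x0|x0|->] := ltgtP x 0.
- rewrite /flat ltNge (ltW x0)/=.
  apply: (@near_eq_is_derive _ _ _ (cst 0)).
  near=> z; rewrite /flat ltNge; suff -> : z <= 0 by [].
  by apply: ltW; near: z; exact: lt_nbhsl.
- have x0' : x != 0 by rewrite gt_eqF.
  have dV : is_derive x 1 (fun z : R => z^-1) (- x ^- 2).
    by have := is_deriveV (f := id) x0' (is_derive_id x 1); rewrite scaler1.
  have dE : is_derive x 1 (fun z : R => expR (- z^-1)) (expR (- x^-1) * x ^- 2).
    have dN : is_derive x 1 (fun z : R => - z^-1) (x ^- 2).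
      by have := is_deriveN (df := - x ^- 2) (f := fun z : R => z^-1); rewrite opprK; apply.
    exact: (is_derive1_comp (f := expR) (g := fun z : R => - z^-1)).
  have dP : is_derive x 1 (fun z : R => P.[z^-1]) (P^`().[x^-1] * - x ^- 2).
    exact: (is_derive1_comp (f := horner P) (g := fun z : R => z^-1)).
  have dF : is_derive x 1 (fun z : R => P.[z^-1] * expR (- z^-1))
      (flat ('X^2 * (P - P^`())) x).
    have [dM eM] := is_deriveM dP dE; apply: DeriveDef; first exact: dM.
    apply: etrans eM _.
    rewrite /flat x0 !hornerE /GRing.scale /=; field; exact: x0'.
  apply: near_eq_is_derive dF; near=> z; rewrite /flat; suff -> : 0 < z by [].
  by near: z; exact: lt_nbhsr.
- have [C C0 PC] := poly_expR_bound P.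
  have bound h : `|h| <= 1 -> `|flat P h| <= C * h ^+ 2.
    move=> h1; rewrite /flat; case: ltP => [h0|]; last first.
      by rewrite normr0 mulr_ge0// sqr_ge0.
    rewrite (le_trans (PC _ _))//; last by rewrite exprVn invrK.
    by rewrite invf_ge1// (le_trans (ler_norm _) h1).
  have lim0 : h^-1 *: (flat P (h *: 1 + 0) - flat P 0) @[h --> 0^'] --> (0 : R).
    apply/cvgr0Pnorm_le => e e0; near=> h.
    have h0 : h != 0 by near: h; exact: nbhs_dnbhs_neq.
    have h1 : `|h| <= 1.
      by near: h; apply: (dnbhs0_le (V := R)).
    have h2 : `|h| <= e / (C + 1).
      by near: h; apply: (dnbhs0_le (V := R)); rewrite divr_gt0// ltr_wpDl.
    rewrite {2}/flat ltxx subr0 addr0 normrZ normfV /GRing.scale /= mulr1.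
    rewrite ler_pdivrMl ?normr_gt0//.
    apply: (le_trans (bound _ h1)).
    rewrite -(real_normK (num_real h)) expr2 mulrCA ler_wpM2l//.
    move: h2; rewrite ler_pdivlMr ?ltr_wpDl// => h2.
    have := normr_ge0 h; nra.
  have -> : flat ('X^2 * (P - P^`())) 0 = 0 by rewrite /flat ltxx.
  apply: DeriveDef; first by apply/cvg_ex; exists 0.
  by apply: cvg_lim.
Unshelve. all: by end_near. Qed.

Lemma smooth_flat P : smooth (flat P).
Proof.
apply: (@smooth_coind _ _ (fun f => exists P, f = flat P)); last by exists P.
move=> _ [{}P ->].
have dF x : derivable (flat P) x 1 by case: (is_derive_flat P x).
split; first by move=> p; exact/derivable1_diffP.
move=> h; exists (h%:P * ('X^2 * (P - P^`()))); apply/funext => x.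
rewrite derive_R// derive1E; have [_ ->] := is_derive_flat P x.
by rewrite /flat; case: ifP => _; rewrite ?mulr0// !hornerE; exact: erefl.
Qed.

Lemma flat1_ge0 x : 0 <= flat 1 x.
Proof. by rewrite /flat; case: ifP => // _; rewrite hornerE mul1r expR_ge0. Qed.

Lemma flat1_le1 x : flat 1 x <= 1.
Proof.
rewrite /flat; case: ifP => // x0; rewrite hornerE mul1r.
by rewrite expR_le1 oppr_le0 invr_ge0 ltW.
Qed.

(** A smooth function supported between a and b with values between 0 and 1;
    the dilation by n + 1 sends exp(-1/y) to exp(-1/((n + 1) y)), which tends
    to 1, so that these functions tend to the indicator of the open interval.
    *)
Definition bump (a b : R) (n : nat) x : R :=
  flat 1 (n.+1%:R * (x - a)) * flat 1 (n.+1%:R * (b - x)).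

Lemma bump_ge0 a b n x : 0 <= bump a b n x.
Proof. by rewrite mulr_ge0// flat1_ge0. Qed.

Lemma bump_le1 a b n x : bump a b n x <= 1.
Proof. by rewrite mulr_ile1// ?flat1_ge0// flat1_le1. Qed.

Lemma flat1_gt0 x : 0 < x -> 0 < flat 1 x.
Proof. by rewrite /flat => ->; rewrite hornerE mul1r expR_gt0. Qed.

Lemma bump_gt0 a b n x : a < x < b -> 0 < bump a b n x.
Proof.
by move=> /andP[ax xb]; rewrite mulr_gt0// flat1_gt0// pmulr_rgt0 ?ltr0n// subr_gt0.
Qed.

Lemma smooth_bump a b n : smooth (bump a b n).
Proof.
rewrite (_ : bump a b n = fun x => flat 1 (n.+1%:R * x + - (n.+1%:R * a)) *
    flat 1 (- n.+1%:R * x + n.+1%:R * b)).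
  by apply: smoothM; apply: smooth_affine; exact: smooth_flat.
by apply/funext => x; rewrite /bump; congr (flat _ _ * flat _ _); ring.
Qed.

Lemma bump_out a b n x : x \notin `]a, b[ -> bump a b n x = 0.
Proof.
rewrite in_itv /= negb_and -!leNgt /bump /flat => /orP[xa|bx].
  by rewrite pmulr_rgt0 ?ltr0n// subr_gt0 ltNge xa mul0r.
by rewrite [X in _ * X]ifF ?mulr0// pmulr_rgt0 ?ltr0n// subr_gt0 ltNge bx.
Qed.

Lemma test_bump (a b : R) n : 0 < a -> b < 1 -> test_function I01 (bump a b n).
Proof.
move=> a0 b1; split; first exact: smooth_bump.
exists `[a, b]%classic; split; first exact: segment_compact.
  move=> x; rewrite /I01 /= !in_itv /= => /andP[ax xb].
  by rewrite (lt_le_trans a0 ax) (le_lt_trans xb b1).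
move=> x nx; apply: bump_out; apply/negP => xab; apply: nx.
by move: xab; rewrite /= !in_itv /= => /andP[/ltW -> /ltW ->].
Qed.

Lemma cvg_flat (y : R) : 0 < y -> flat 1 (n.+1%:R * y) @[n --> \oo] --> (1 : R).
Proof.
move=> y0.
have -> : (fun n : nat => flat 1 (n.+1%:R * y)) = fun n => expR (- (n.+1%:R^-1 * y^-1)).
  apply/funext => n; rewrite /flat pmulr_rgt0 ?ltr0n// y0 hornerE mul1r.
  by rewrite invfM.
have h : (- ((n.+1%:R : R)^-1 * y^-1)) @[n --> \oo] --> (- (0 * y^-1) : R).
  by apply: cvgN; apply: cvgMl; exact: cvg_harmonic.
rewrite mul0r oppr0 in h.
have := continuous_cvg _ (@continuous_expR R 0) h; rewrite expR0; apply.
Qed.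

Lemma cvg_bump a b x : bump a b n x @[n --> \oo] --> (\1_(`]a, b[%classic) x : R).
Proof.
have [xab|xab] := boolP (x \in `]a, b[); last first.
  rewrite indicE memNset//; last exact/negP.
  by under eq_fun do rewrite (bump_out _ xab); exact: cvg_cst.
rewrite indicE mem_set//; move: xab; rewrite in_itv /= => /andP[ax xb].
rewrite -(mulr1 1); apply: cvgM; apply: cvg_flat; by rewrite subr_gt0.
Qed.

End BumpFunctions.

(** * Test functions on the interval and their tensor products *)

Section TestFunctions.
Context {R : realType}.
Implicit Types (phi eta : R -> R).

Lemma smooth_derivable phi : smooth phi -> forall x, derivable phi x 1.
Proof. by move=> sp x; apply/derivable1_diffP; exact: smooth_diff. Qed.

Lemma smooth_derive1 phi : smooth phi -> smooth (derive1 phi).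
Proof.
move=> sp; rewrite (_ : derive1 phi = 'D_1 phi); first exact: smooth_D.
by apply/funext => x; rewrite derive1E.
Qed.

Lemma smooth_continuous phi : smooth phi -> continuous phi.
Proof. by move=> sp x; apply/differentiable_continuous; exact: smooth_diff. Qed.

(** The derivative in the direction h is h times the ordinary derivative, so
    the words of directions add nothing in dimension one. *)
Lemma smoothP phi : (forall x, derivable phi x 1) -> smooth (derive1 phi) ->
  smooth phi.
Proof.
move=> dp sp.
pose P (f : R -> R) := (forall x, derivable f x 1) /\ smooth (derive1 f).
apply: (@smooth_coind _ _ P); last by [].
move=> f [df sf].
split; first by move=> x; exact/derivable1_diffP.
move=> h; have E : 'D_h f = fun x => h * derive1 f x.
  by apply/funext => x; rewrite derive_R.
have sD : smooth ('D_h f) by rewrite E; apply: smoothM => //; exact: smooth_cst.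
by split; [exact: smooth_derivable|exact: smooth_derive1].
Qed.

Lemma test_derive1 phi : test_function I01 phi -> test_function I01 (derive1 phi).
Proof.
move=> [sp [K [cK KI Kp]]]; split; first exact: smooth_derive1.
exists K; split => // x nKx; rewrite derive1E.
rewrite (@near_eq_derive _ _ _ _ (cst 0)) ?derive_cst//.
have : nbhs x (~` K).
  by apply: open_nbhs_nbhs; split => //; apply: closed_openC; exact: compact_closed.
by apply: filterS => y; exact: Kp.
Qed.

(** The support is a compact subset of the open interval, hence at positive
    distance from both ends. *)
Lemma test_support phi : test_function I01 phi ->
  exists a b : R, [/\ 0 < a, b < 1 & forall x, x \notin `]a, b[ -> phi x = 0].
Proof.
move=> [sp [K [cK KI Kp]]].
have nK x : ~ K x -> \forall e \near (0 : R)^'+, forall y, `|x - y| < e -> ~ K y.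
  move=> nKx; have : nbhs x (~` K).
    by apply: open_nbhs_nbhs; split => //; apply: closed_openC; exact: compact_closed.
  move=> /nbhs_ballP[e /= e0 eK]; near=> d => y xy; apply: eK.
  by apply: (lt_trans xy); near: d; exact: nbhs_right_lt.
have nK0 : ~ K 0 by move=> /KI; rewrite /I01 /= in_itv /= ltxx.
have nK1 : ~ K 1 by move=> /KI; rewrite /I01 /= in_itv /= ltxx andbF.
near ((0 : R)^'+) => d.
have d0 : 0 < d by [].
have nK0e : forall y, `|0 - y| < d -> ~ K y by near: d; exact: nK.
have nK1e : forall y, `|1 - y| < d -> ~ K y by near: d; exact: nK.
pose e := d / 2; have e0 : 0 < e by rewrite divr_gt0.
have ed : e < d by rewrite /e; lra.
exists e, (1 - e); split => //; first by rewrite gtrBl.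
move=> x nx; apply: Kp => Kx.
have := KI _ Kx; rewrite /I01 /= in_itv /= => /andP[x0 x1].
move: nx; rewrite in_itv /= negb_and -!leNgt => /orP[xe|ex].
  by apply: (nK0e x) Kx; rewrite sub0r normrN gtr0_norm// (le_lt_trans xe).
by apply: (nK1e x) Kx; rewrite gtr0_norm ?subr_gt0//; lra.
Unshelve. all: by end_near. Qed.

Lemma test_bounded phi : test_function I01 phi ->
  exists2 M : R, 0 <= M & forall x, `|phi x| <= M.
Proof.
move=> tp; have [sp [K [cK KI Kp]]] := tp.
have : bounded_set (phi @` K).
  apply: compact_bounded; apply: continuous_compact => //.
  by apply: continuous_subspaceT; exact: smooth_continuous.
move=> [M [_ HM]]; exists (`|M| + 1); first by rewrite addr_ge0.
move=> x; have [Kx|/Kp ->] := pselect (K x); last by rewrite normr0 addr_ge0.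
apply: (HM (`|M| + 1)); last by exists x.
by rewrite (le_lt_trans (ler_norm M))// ltrDl.
Qed.

Lemma test_meas phi (D : set R) : test_function I01 phi -> measurable_fun D phi.
Proof.
move=> [sp _]; apply: measurable_funTS; apply: continuous_measurable_fun.
exact: smooth_continuous.
Qed.

Lemma test_tensor phi eta : test_function I01 phi -> test_function I01 eta ->
  test_function Q01 (fun p : R * R => phi p.1 * eta p.2).
Proof.
move=> [sp [K [cK KI Kp]]] [se [L [cL LI Lp]]]; split.
  by apply: smoothM; [exact: smooth_fst|exact: smooth_snd].
exists (K `*` L); split; first exact: compact_setX.
  by move=> [x t] [/= /KI ? /LI].
move=> [x t] /= nKL; have [Kx|/Kp ->] := pselect (K x); last by rewrite mul0r.
have [Lt|/Lp ->] := pselect (L t); last by rewrite mulr0.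
by case: nKL.
Qed.

Lemma tensor_dx phi eta : smooth phi -> smooth eta ->
  dx (fun p : R * R => phi p.1 * eta p.2) = fun p => derive1 phi p.1 * eta p.2.
Proof.
move=> sp se; apply/funext => p.
by rewrite /dx derive_tensor//= derive_R ?mul0r ?mulr0 ?add0r ?derive1E 1?mulrC//;
  exact: smooth_derivable.
Qed.

Lemma tensor_dt phi eta : smooth phi -> smooth eta ->
  dt (fun p : R * R => phi p.1 * eta p.2) = fun p => phi p.1 * derive1 eta p.2.
Proof.
move=> sp se; apply/funext => p.
by rewrite /dt derive_tensor//= [X in _ + _ * X]derive_R ?mul0r ?mulr0 ?addr0 ?derive1E//;
  exact: smooth_derivable.
Qed.

End TestFunctions.

(** * Primitives of integrable functions *)

Section Primitives.
Context {R : realType}.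
Local Notation leb := (@lebesgue_measure R).
Implicit Types (a b A B phi : R -> R) (x y : R).

Definition cut x a : R -> R := fun y => (y < x)%R%:R * a y.

Definition prim a x : R := intI (cut x a).

(** Absolute continuity on the closed unit interval with almost everywhere
    derivative [a], in its integral form. *)
Definition abscont A a := itgI a /\ forall x, 0 <= x <= 1 -> A x = A 0 + prim a x.

Lemma meas_ltl (D : set R) x : measurable_fun D (fun y => (y < x)%R%:R : R).
Proof.
apply: measurable_funTS.
rewrite (_ : (fun y => (y < x)%R%:R) = \1_(`]-oo, x[%classic)).
  by apply: measurable_indic; exact: measurable_itv.
apply/funext => y; rewrite indicE; congr (nat_of_bool _)%:R.
by apply/idP/idP => [yx|/set_mem]; [apply/mem_set|]; rewrite /= in_itv.
Qed.

Lemma cut_itg x a : itgI a -> itgI (cut x a).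
Proof.
move=> ai; apply: (rintegrable_le mI01 _ (rintegrable_norm ai)).
  by apply: measurable_funM; [exact: meas_ltl|exact: rintegrable_meas ai].
move=> y _; rewrite /cut normrM ger0_norm ?ler0n// ler_piMl//.
by case: (y < x).
Qed.

Lemma prim_bound a x : itgI a -> `|prim a x| <= intI (fun y => `|a y|).
Proof.
move=> ai; apply: (le_trans (norm_intI (cut_itg x ai))); apply: le_intI.
- exact: (rintegrable_norm (cut_itg x ai)).
- exact: (rintegrable_norm ai).
- apply: aeW => y _; rewrite /cut normrM ger0_norm ?ler0n// ler_piMl//.
  by case: (y < x).
Qed.

Lemma primE a x : itgI a -> prim a x = \int[leb]_(y in `]-oo, x]) (a \_ I01) y.
Proof.
move=> ai.
have ai' : leb.-integrable setT (EFin \o (a \_ I01)) by exact/itgI_patch.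
rewrite -Rintegral_itv_bndo_bndc; last first.
  by apply: integrableS ai' => //; exact: measurable_itv.
rewrite /prim /intI Rintegral_mkcond [RHS]Rintegral_mkcond.
apply: eq_Rintegral => y _; rewrite !patchE /cut.
have -> : (y \in `]-oo, x[%classic) = (y < x).
  by apply/idP/idP => [/set_mem|yx]; [|apply/mem_set]; rewrite /= in_itv.
by case: (y \in I01); case: (y < x) => //=; rewrite ?mul1r ?mul0r.
Qed.

(** This is the absolute continuity of the integral. *)
Lemma prim_unif a : itgI a -> forall e, 0 < e ->
  exists2 d, 0 < d & forall x y, `|x - y| < d -> `|prim a x - prim a y| < e.
Proof.
move=> ai e e0.
have ai' : leb.-integrable setT (EFin \o (a \_ I01)) by exact/itgI_patch.
have [d [d0 Hd]] := integral_normr_continuous ai' e0.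
exists d => //.
have main x y : x < y -> `|x - y| < d -> `|prim a x - prim a y| < e.
  move=> xy xyd; rewrite distrC !primE//.
  rewrite Rintegral_itvB; [|by apply: integrableS ai' => //; exact: measurable_itv
    |by []|by rewrite bnd_simp ltW].
  apply: le_lt_trans (Hd `]x, y]%classic _ _).
  - apply: le_normr_Rintegral; first exact: measurable_itv.
    by apply: integrableS ai' => //; exact: measurable_itv.
  - exact: measurable_itv.
  - suff : (leb `]x, y]%classic < d%:E)%E by [].
    rewrite lebesgue_measure_itv /= lte_fin xy -EFinD lte_fin.
    by rewrite -[y - x]gtr0_norm ?subr_gt0// distrC.
move=> x y xyd; have [xy|yx|->] := ltgtP x y; first exact: main.
  by rewrite distrC; apply: main => //; rewrite distrC.
by rewrite subrr normr0.
Qed.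

Lemma prim_continuous a : itgI a -> continuous (prim a).
Proof.
move=> ai x; apply/cvgrPdist_lt => e e0.
have [d d0 Hd] := prim_unif ai e0.
by near=> y; apply: Hd; near: y; exact: cvgr_dist_lt.
Unshelve. all: by end_near. Qed.

Lemma prim_meas a (D : set R) : itgI a -> measurable_fun D (prim a).
Proof.
move=> ai; apply: measurable_funTS; apply: continuous_measurable_fun.
exact: prim_continuous.
Qed.

Lemma cut_le0 x a y : x <= 0 -> I01 y -> cut x a y = 0.
Proof.
move=> x0; rewrite /I01 /cut /= in_itv /= => /andP[y0 _].
by rewrite ltNge (le_trans x0 (ltW y0)) mul0r.
Qed.

Lemma cut_ge1 x a y : 1 <= x -> I01 y -> cut x a y = a y.
Proof.
move=> x1; rewrite /I01 /cut /= in_itv /= => /andP[_ y1].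
by rewrite (lt_le_trans y1 x1) mul1r.
Qed.

Lemma prim_le0 a x : x <= 0 -> prim a x = 0.
Proof.
move=> x0; rewrite -[RHS](intI_cst (0 : R)); apply: eq_intI => y Iy.
exact: cut_le0.
Qed.

Lemma prim_ge1 a x : 1 <= x -> prim a x = intI a.
Proof. by move=> x1; apply: eq_intI => y Iy; exact: cut_ge1. Qed.

Lemma abscont_int A a : abscont A a -> intI a = A 1 - A 0.
Proof. by move=> [ai ->]; rewrite ?lexx ?ler01// prim_ge1// addrC addKr. Qed.

Lemma abscont_meas A a : abscont A a -> measurable_fun I01 A.
Proof.
move=> [ai Aa]; apply: (eq_measurable_fun (fun x => A 0 + prim a x)).
  move=> x /set_mem; rewrite /I01 /= in_itv /= => /andP[x0 x1].
  by rewrite -Aa// !ltW.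
by apply: measurable_funD => //; exact: prim_meas.
Qed.

Lemma abscont_bounded A a : abscont A a ->
  exists2 M, 0 <= M & forall x, 0 <= x <= 1 -> `|A x| <= M.
Proof.
move=> [ai Aa]; exists (`|A 0| + intI (fun y => `|a y|)).
  by rewrite addr_ge0//; apply: intI_ge0.
move=> x x01; rewrite Aa// (le_trans (ler_normD _ _))// lerD2l.
exact: prim_bound.
Qed.

Lemma itgI_bounded A a M : measurable_fun I01 A ->
  (forall x, I01 x -> `|A x| <= M) -> itgI a -> itgI (fun x => a x * A x).
Proof.
move=> mA AM ai.
apply: (rintegrable_le mI01 (g := fun x => M * `|a x|)).
- by apply: measurable_funM => //; exact: rintegrable_meas ai.
- exact: (rintegrableZ mI01 _ (rintegrable_norm ai)).
- by move=> x Ix; rewrite normrM mulrC ler_wpM2r// AM.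
Qed.

Lemma abscont_itg A a b : abscont A a -> itgI b -> itgI (fun x => b x * A x).
Proof.
move=> Aa bi; have [M _ AM] := abscont_bounded Aa.
apply: (itgI_bounded (abscont_meas Aa) (M := M)) => // x.
by rewrite /I01 /= in_itv /= => /andP[x0 x1]; apply: AM; rewrite !ltW.
Qed.

(** Both terms are integrals of a(x) b(y), over y < x and over x < y; together
    they cover the square up to the diagonal, which is null. *)
Lemma prim_parts a b : itgI a -> itgI b ->
  intI (fun x => a x * prim b x) + intI (fun x => b x * prim a x) =
  intI a * intI b.
Proof.
move=> ai bi.
pose u (p : R * R) := a p.1 * ((p.2 < p.1)%R%:R * b p.2).
have ma := rintegrable_meas ai; have mb := rintegrable_meas bi.
have m1 : measurable_fun (Q01 : set (R * R)) (fun p => a p.1).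
  apply: (measurable_comp (F := I01)) => //.
  - exact: mI01.
  - by move=> _ [[x y] [/= Ix Iy] <-].
  - by apply: measurable_funTS; exact: measurable_fst.
have m2 : measurable_fun (Q01 : set (R * R)) (fun p => b p.2).
  apply: (measurable_comp (F := I01)) => //.
  - exact: mI01.
  - by move=> _ [[x y] [/= Ix Iy] <-].
  - by apply: measurable_funTS; exact: measurable_snd.
have m3 : measurable_fun (Q01 : set (R * R)) (fun p => (p.2 < p.1)%R%:R : R).
  apply: measurable_funTS.
  rewrite (_ : (fun p : R * R => _) = fun p => if p.2 < p.1 then 1 else 0 : R).
    by apply: measurable_fun_ifT => //; exact: measurable_fun_ltr.
  by apply/funext => p; case: ifP.
have mu : measurable_fun Q01 u by apply: measurable_funM => //; exact: measurable_funM.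
have [ui _] : itgQ u /\ `|intQ u| <= intI (fun y => `|b y| * intI (fun x => `|a x|)).
  apply: tonelli_slice => //.
    rewrite (_ : (fun _ => _) = fun y => intI (fun x => `|a x|) * `|b y|).
      exact: (rintegrableZ mI01 _ (rintegrable_norm bi)).
    by apply/funext => y; rewrite mulrC.
  apply: aeW => y Iy.
  have le x : `|slice u y x| <= `|b y| * `|a x|.
    rewrite /slice /u /= !normrM mulrC ler_wpM2r// ger0_norm ?ler0n// ler_piMl//.
    by case: (y < x).
  have bai : itgI (fun x => `|b y| * `|a x|).
    exact: (rintegrableZ mI01 _ (rintegrable_norm ai)).
  have si : itgI (slice u y).
    by apply: (rintegrable_le mI01 _ bai) => //; exact: slice_meas.
  split => //; rewrite -intIZ; last exact: (rintegrable_norm ai).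
  apply: le_intI => //; first exact: (rintegrable_norm si).
  exact: aeW.
have [_ _ e1] := fubini_tslice ui; have [_ _ e2] := fubini_slice ui.
have -> : intI (fun x => a x * prim b x) = intQ u.
  rewrite e1; apply: eq_intI => x _; rewrite -intIZ//.
  exact: cut_itg.
have <- : intI (fun y => b y * (intI a - prim a y)) = intQ u.
  rewrite e2; apply: eq_intI => y _; rewrite -intIB//; last exact: cut_itg.
  have abi := rintegrableB mI01 ai (cut_itg y ai).
  rewrite -intIZ//.
  have mZ := rintegrable_meas (rintegrableZ mI01 (b y) abi).
  apply: eq_intI_ae => //.
    rewrite (_ : slice u y = fun x => (a x * (y < x)%R%:R) * b y); last first.
      by apply/funext => x; rewrite /slice /u /=; ring.
    apply: measurable_funM => //; apply: measurable_funM => //.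
    rewrite (_ : (fun x => (y < x)%R%:R) = fun x => if y < x then 1 else 0 : R).
      apply: measurable_funTS; apply: measurable_fun_ifT => //.
      exact: measurable_fun_ltr.
    by apply/funext => x; case: ifP.
  exists [set y]; split => //; first exact: lebesgue_measure_set1.
  move=> x /= /not_implyP [Ix h]; apply: contrapT => /eqP xy; apply: h.
  rewrite /slice /u /cut /=; case: ltgtP xy => //= _ _; ring.
rewrite -intID//.
- rewrite -intIZ//; apply: eq_intI => x _; ring.
- rewrite (_ : (fun _ => _) = fun y => intI a * b y - b y * prim a y); last first.
    by apply/funext => y; ring.
  apply: (rintegrableB mI01); first exact: (rintegrableZ mI01).
  apply: (itgI_bounded (prim_meas ai) (M := intI (fun y => `|a y|))) => // x _.
  exact: prim_bound.
- apply: (itgI_bounded (prim_meas ai) (M := intI (fun y => `|a y|))) => // x _.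
  exact: prim_bound.
Qed.

End Primitives.

(** * Absolutely continuous functions and the lemma of du Bois-Reymond *)

Section DuBoisReymond.
Context {R : realType}.
Local Notation leb := (@lebesgue_measure R).
Implicit Types (a b A B h g k : R -> R) (phi eta : R -> R) (x y : R).

Lemma abscont_prim a : itgI a -> abscont (prim a) a.
Proof. by move=> ai; split => // x _; rewrite (prim_le0 a (lexx 0)) add0r. Qed.

Lemma abscont_cst c A a : abscont A a -> abscont (fun x => c + A x) a.
Proof. by move=> [ai Aa]; split => // x x01; rewrite Aa// addrA. Qed.

Lemma abscontD A B a b : abscont A a -> abscont B b ->
  abscont (fun x => A x + B x) (fun x => a x + b x).
Proof.
move=> [ai Aa] [bi Bb]; split; first exact: (rintegrableD mI01).
move=> x x01; rewrite Aa// Bb// addrACA; congr (_ + _).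
rewrite -intID; [|exact: cut_itg..].
by apply: eq_intI => y _; rewrite /cut mulrDr.
Qed.

Lemma abscontZ c A a : abscont A a -> abscont (fun x => c * A x) (fun x => c * a x).
Proof.
move=> [ai Aa]; split; first exact: (rintegrableZ mI01).
move=> x x01; rewrite Aa// mulrDr; congr (_ + _).
rewrite -intIZ; last exact: cut_itg.
by apply: eq_intI => y _; rewrite /cut mulrCA.
Qed.

Lemma abscontB A B a b : abscont A a -> abscont B b ->
  abscont (fun x => A x - B x) (fun x => a x - b x).
Proof.
move=> Aa /(abscontZ (-1)) Bb; have := abscontD Aa Bb.
have E (f g : R -> R) : (fun x => f x + -1 * g x) = (fun x => f x - g x).
  by apply/funext => x; rewrite mulN1r.
by rewrite !E.
Qed.

(** On the interval from 0 to x this is [prim_parts] for the two derivatives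
    cut off at x, plus the terms that come from the initial values. *)
Lemma abscontM A B a b : abscont A a -> abscont B b ->
  abscont (fun x => A x * B x) (fun x => a x * B x + b x * A x).
Proof.
move=> Aa Bb; have [ai Ae] := Aa; have [bi Be] := Bb.
have iaB := abscont_itg Bb ai; have ibA := abscont_itg Aa bi.
split; first exact: (rintegrableD mI01).
move=> x /andP[x0 x1].
have := prim_parts (cut_itg x ai) (cut_itg x bi).
have cutcut c y : I01 y -> y < x -> prim (cut x c) y = prim c y.
  move=> Iy yx; apply: eq_intI => w _; rewrite /cut.
  by have [wy|] := ltP w y; rewrite ?mul0r// mul1r (lt_trans wy yx) mul1r.
have cutp c e : intI (fun y => cut x c y * prim (cut x e) y) =
    intI (fun y => cut x c y * prim e y).
  apply: eq_intI => y Iy; rewrite /cut; have [yx|] := ltP y x; rewrite ?mul0r//.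
  by rewrite cutcut.
rewrite !cutp => E.
have i1 := cut_itg x ai; have i2 := cut_itg x bi.
have i3 := abscont_itg (abscont_prim bi) i1; have i4 := abscont_itg (abscont_prim ai) i2.
rewrite [A x]Ae ?x0// [B x]Be ?x0//.
have -> : prim (fun z => a z * B z + b z * A z) x =
    intI (fun y => (B 0 * cut x a y + A 0 * cut x b y) +
      (cut x a y * prim b y + cut x b y * prim a y)).
  apply: eq_intI => y; rewrite /I01 /= in_itv /= => /andP[y0 y1].
  by rewrite /cut Ae ?(ltW y0) ?(ltW y1)// Be ?(ltW y0) ?(ltW y1)//; ring.
rewrite intID; [|exact: (rintegrableD mI01 (rintegrableZ mI01 _ i1) (rintegrableZ mI01 _ i2))
  |exact: (rintegrableD mI01)].
rewrite intID; [|exact: (rintegrableZ mI01)..].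
rewrite [X in _ + (_ + X)]intID// E !intIZ// /prim; ring.
Qed.

Lemma test_itg phi : test_function I01 phi -> itgI phi.
Proof.
move=> tp; have [M M0 PM] := test_bounded tp.
apply: (rintegrable_le mI01 (g := fun=> M)) => //; first exact: test_meas.
exact: (rintegrable_cst mI01 fin_I01).
Qed.

Lemma test_out phi x : test_function I01 phi -> ~ I01 x -> phi x = 0.
Proof. by move=> [_ [K [_ KI Kp]]] nI; apply: Kp => /KI. Qed.

Lemma prim_deriv phi : test_function I01 phi ->
  (forall x, derivable (prim phi) x 1) /\ derive1 (prim phi) = phi.
Proof.
move=> tp; have [sp _] := tp.
have phiE : phi \_ I01 = phi.
  apply/funext => x; rewrite patchE; case: ifPn => // /negP nI.
  by rewrite (test_out tp)// => Ix; apply: nI; exact/mem_set.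
have phii := test_itg tp.
have primF : prim phi = fun x => \int[leb]_(y in `]-oo, x]) phi y.
  by apply/funext => x; rewrite primE// phiE.
have main x : derivable (prim phi) x 1 /\ derive1 (prim phi) x = phi x.
  rewrite primF; apply: (@continuous_FTC1 _ phi -oo%O x (x + 1)) => //.
  - by rewrite ltrDl.
  - have pT : leb.-integrable setT (EFin \o phi).
      by move/itgI_patch: phii; rewrite phiE.
    by apply: integrableS pT => //; exact: measurable_itv.
  - exact: ltNyr.
  - exact: (smooth_continuous sp).
split; first by move=> x; exact: (main x).1.
by apply/funext => x; exact: (main x).2.
Qed.

Lemma test0 phi : test_function I01 phi -> phi 0 = 0.
Proof. by move=> tp; apply: test_out => //; rewrite /I01 /= in_itv /= ltxx. Qed.

Lemma test1 phi : test_function I01 phi -> phi 1 = 0.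
Proof. by move=> tp; apply: test_out => //; rewrite /I01 /= in_itv /= ltxx andbF. Qed.

Lemma test_abscont phi : test_function I01 phi -> abscont phi (derive1 phi).
Proof.
move=> tp; have td := test_derive1 tp.
have [dp dpE] := prim_deriv td.
split; first exact: test_itg.
move=> x _; rewrite (test0 tp) add0r.
have dphi := smooth_derivable tp.1.
have : (fun y => phi y - prim (derive1 phi) y) x =
       (fun y => phi y - prim (derive1 phi) y) 0.
  apply: (@is_derive_0_is_cst _ (fun y => phi y - prim (derive1 phi) y)) => y.
  have D1 : is_derive y 1 phi (derive1 phi y).
    by rewrite derive1E; apply: DeriveDef.
  have D2 : is_derive y 1 (prim (derive1 phi)) (derive1 phi y).
    by rewrite -[in derive1 phi y]dpE derive1E; apply: DeriveDef.
  by have := is_deriveB D1 D2; rewrite subrr.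
by rewrite (test0 tp) (prim_le0 _ (lexx 0)) subrr => /eqP; rewrite subr_eq0 => /eqP.
Qed.

(** The integral is the only obstruction to the existence of a primitive with
    compact support. *)
Lemma prim_test phi : test_function I01 phi -> intI phi = 0 ->
  test_function I01 (prim phi) /\ derive1 (prim phi) = phi.
Proof.
move=> tp p0; have [dp dpE] := prim_deriv tp; split => //.
split; first by apply: smoothP => //; rewrite dpE; exact: tp.1.
have [c [d [c0 d1 pcd]]] := test_support tp.
exists `[c, d]%classic; split; first exact: segment_compact.
  move=> x; rewrite /I01 /= !in_itv /= => /andP[cx xd].
  by rewrite (lt_le_trans c0 cx) (le_lt_trans xd d1).
move=> x; rewrite /= in_itv /= => /negP; rewrite negb_and -!ltNge => /orP[xc|dx].
  rewrite -[RHS](intI_cst (0 : R)); apply: eq_intI => y _; rewrite /cut.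
  have [yx|] := ltP y x; rewrite ?mul0r// pcd ?mulr0// in_itv /= negb_and -!leNgt.
  by rewrite (ltW (lt_trans yx xc)).
rewrite -[RHS]p0; apply: eq_intI => y _; rewrite /cut.
have [yx|xy] := ltP y x; rewrite ?mul1r// pcd ?mulr0// in_itv /= negb_and -!leNgt.
by rewrite (le_trans (ltW dx) xy) orbT.
Qed.

(** The primitive is continuous, hence constant as soon as it is constant on
    the rationals; by Lebesgue differentiation its derivative is almost
    everywhere the integrand. *)
Lemma prim_rat_ae0 k : itgI k ->
  (forall p q : rat, 0 < ratr p :> R -> p < q -> ratr q < 1 :> R ->
     prim k (ratr q) = prim k (ratr p)) ->
  {ae leb, forall x, I01 x -> k x = 0}.
Proof.
move=> ki kpq.
pose c := prim k (ratr 2^-1).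
have half0 : 0 < ratr 2^-1 :> R by rewrite ltr0q.
have half1 : ratr 2^-1 < 1 :> R by rewrite -(rmorph1 (ratr : rat -> R)) ltr_rat.
have rc (q : rat) : 0 < ratr q :> R -> ratr q < 1 :> R -> prim k (ratr q) = c.
  move=> q0 q1; rewrite /c; have [lt|lt|->//] := ltgtP q 2^-1.
    by rewrite (kpq q 2^-1).
  by rewrite (kpq 2^-1 q).
have xc x : I01 x -> prim k x = c.
  rewrite /I01 /= in_itv /= => /andP[x0 x1].
  apply/eqP; rewrite -subr_eq0 -normr_le0; apply/ler_addgt0Pr => e e0.
  have [d d0 Hd] := prim_unif ki e0.
  have /rat_in_itvoo [q] : x < Order.min (x + d) 1 by rewrite lt_min ltrDl d0.
  rewrite in_itv /= => /andP[xq]; rewrite lt_min => /andP[qd q1].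
  rewrite -(rc q)//; last exact: lt_trans x0 xq.
  rewrite add0r ltW// Hd// distrC gtr0_norm ?subr_gt0//; lra.
have ki' : leb.-integrable setT (EFin \o (k \_ I01)) by exact/itgI_patch.
have : {ae leb, forall x, derivable (prim k) x 1 /\ derive1 (prim k) x = (k \_ I01) x}.
  rewrite (_ : prim k = fun x => \int[leb]_(y in `]-oo, x]) (k \_ I01) y).
    apply: FTC1Ny.
      by move=> y; apply: integrableS ki' => //; exact: measurable_itv.
    exact: (integrable_locally mI01 ki).
  by apply/funext => x; rewrite primE.
apply: filterS => x [_ dx] Ix.
move: dx; rewrite patchE mem_set// => <-.
rewrite derive1E (@near_eq_derive _ _ _ _ (cst c)) ?derive_cst//.
have : nbhs x (I01 : set R) by apply: open_nbhs_nbhs; split => //; exact: interval_open.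
by apply: filterS => y; exact: xc.
Qed.

(** The bumps tend boundedly to indicators of intervals. Only rational
    intervals are used, so that countably many test functions decide whether a
    function vanishes. *)
Lemma bump_int0_ae k : itgI k ->
  (forall (p q : rat) n, 0 < ratr p :> R -> p < q -> ratr q < 1 :> R ->
     intI (fun x => k x * bump (ratr p) (ratr q) n x) = 0) ->
  {ae leb, forall x, I01 x -> k x = 0}.
Proof.
move=> ki H; apply: prim_rat_ae0 => // p q p0 pq q1.
have mk := rintegrable_meas ki.
pose f n x := k x * bump (ratr p) (ratr q) n x.
pose f0 x := k x * \1_(`]ratr p, ratr q[%classic) x : R.
have pq' : ratr p < ratr q :> R by rewrite ltr_rat.
have mf0 : measurable_fun I01 f0.
  by apply: measurable_funM => //; apply: measurable_indic; exact: measurable_itv.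
have tb n : test_function I01 (bump (ratr p) (ratr q) n : R -> R) by exact: test_bump.
have mfn n : measurable_fun I01 (f n).
  by apply: measurable_funM => //; exact: test_meas.
have f0i : itgI f0.
  apply: (rintegrable_le mI01 _ (rintegrable_norm ki)) => // x _.
  rewrite normrM ler_piMr// ger0_norm ?indicE ?ler0n//.
  by case: (_ \in _).
have cvf : {ae leb, forall x, I01 x -> (EFin \o f n) x @[n --> \oo] --> (EFin \o f0) x}.
  apply: aeW => x _; apply: cvg_EFin; first by near=> n.
  by apply: cvgMr; exact: cvg_bump.
have dom : {ae leb, forall x n, I01 x ->
    (`|(EFin \o f n) x| <= (EFin \o (fun x => `|k x|%R)) x)%E}.
  apply: aeW => x n _; rewrite lee_fin /f normrM ler_piMr// ger0_norm ?bump_ge0//.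
  exact: bump_le1.
have [_ _ lim] := dominated_convergence mI01
  (fun n => (measurable_EFinP _ _).2 (mfn n)) ((measurable_EFinP _ _).2 mf0)
  cvf (rintegrable_norm ki) dom.
have If n : (\int[leb]_(x in I01) (EFin \o f n) x)%E = 0%E.
  have fi : itgI (f n).
    apply: (rintegrable_le mI01 (mfn n) (rintegrable_norm ki)) => x _.
    by rewrite normrM ler_piMr// ger0_norm ?bump_ge0// bump_le1.
  rewrite -(fineK (integrable_fin_num mI01 fi)).
  by rewrite -[fine _]/(intI (f n)) H.
have I0 : intI f0 = 0.
  move: lim; rewrite (_ : [sequence _]_n = cst 0%E); last by apply/funext => n; exact: If.
  move=> lim; rewrite /intI /Rintegral.
  have := cvg_unique _ lim (cvg_cst 0%E) => /(_ (@ereal_hausdorff _)) E.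
  by rewrite -[integral _ _ _]/(integral leb I01 (EFin \o f0)) E.
apply/eqP; rewrite -subr_eq0 -intIB; [|exact: cut_itg..]; apply/eqP.
rewrite -I0; apply: eq_intI_ae => //.
  by apply: rintegrable_meas (rintegrableB mI01 (cut_itg _ ki) (cut_itg _ ki)).
exists [set ratr p]; split => //; first exact: lebesgue_measure_set1.
move=> x /= /not_implyP [Ix h]; apply: contrapT => /eqP xp; apply: h.
rewrite /cut /f0 indicE.
have -> : (x \in `]ratr p, ratr q[%classic) = (ratr p < x < ratr q).
  by apply/idP/idP => [/set_mem|xpq]; [|apply/mem_set]; rewrite /= in_itv.
move: xp; rewrite neq_lt => /orP[xp|px].
  by rewrite (lt_trans xp pq') xp ltNge (ltW xp) subrr mulr0.
by rewrite px /= [x < ratr p]ltNge (ltW px) mul0r subr0 mulrC.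
Unshelve. all: by end_near. Qed.

Lemma test_int0_ae k : itgI k ->
  (forall eta, test_function I01 eta -> intI (fun x => k x * eta x) = 0) ->
  {ae leb, forall x, I01 x -> k x = 0}.
Proof. by move=> ki H; apply: bump_int0_ae => // p q n p0 _ q1; exact/H/test_bump. Qed.

Definition unit_bump : R -> R :=
  let e := bump (4^-1) (3 / 4) 0 in fun x => (intI e)^-1 * e x.

Lemma test_unit_bump : test_function I01 unit_bump.
Proof.
have [se [K [cK KI Kp]]] : test_function I01 (bump (4^-1) (3 / 4 : R) 0).
  by apply: test_bump; lra.
split; first by apply: smoothM => //; exact: smooth_cst.
by exists K; split => // x /Kp; rewrite /unit_bump => ->; rewrite mulr0.
Qed.

Lemma int_unit_bump : intI unit_bump = 1.
Proof.
have tb : test_function I01 (bump (4^-1) (3 / 4 : R) 0) by apply: test_bump; lra.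
have bi := test_itg tb.
rewrite /unit_bump intIZ// mulVf//; apply/negP => /eqP b0.
have := rintegral_eq0_ae mI01 bi (fun x _ => bump_ge0 _ _ _ _).
rewrite -[\int[leb]_(_ in _) _]/(intI _) b0 lexx => /(_ isT) [N [mN N0 sN]].
have : (leb (`]4^-1, 3 / 4[%classic)%R <= leb N)%E.
  apply: le_measure => /=; [by apply/mem_set; exact: measurable_itv|exact/mem_set|].
  move=> x; rewrite /= in_itv /= => /andP[x1 x2]; apply: sN => /= H.
  have : bump 4^-1 (3 / 4) 0 x = 0.
    by apply: H; rewrite /I01 /= in_itv /=; apply/andP; split; lra.
  by apply/eqP; rewrite gt_eqF//; apply: bump_gt0; rewrite x1 x2.
rewrite N0 lebesgue_measure_itv /= lte_fin ifT; last by lra.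
by rewrite -EFinD lee_fin; lra.
Qed.

(** The bump is corrected by a multiple of a fixed bump of integral 1 so that
    it has a primitive with compact support. Outside of its range of parameters
    the value is 0, which keeps the family made of test functions. *)
Definition bump_prim (p q : rat) n : R -> R :=
  if (0 < ratr p :> R) && (ratr q < 1 :> R) then
    prim (fun x => bump (ratr p) (ratr q) n x
                   - intI (bump (ratr p) (ratr q : R) n) * unit_bump x)
  else fun=> 0.

Lemma test_lin (c d : R) phi eta : test_function I01 phi -> test_function I01 eta ->
  test_function I01 (fun x => c * phi x + d * eta x).
Proof.
move=> [sp [K [cK KI Kp]]] [se [L [cL LI Lp]]]; split.
  by apply: smoothD; apply: smoothM => //; exact: smooth_cst.
exists (K `|` L); split; first exact: compactU.
  by move=> x [/KI|/LI].
move=> x nx; rewrite Kp ?Lp ?mulr0 ?addr0//; first by move=> Lx; apply: nx; right.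
by move=> Kx; apply: nx; left.
Qed.

Lemma bump_primP (p q : rat) n : 0 < ratr p :> R -> ratr q < 1 :> R ->
  test_function I01 (bump_prim p q n) /\
  derive1 (bump_prim p q n) = (fun x => bump (ratr p) (ratr q) n x
                   - intI (bump (ratr p) (ratr q : R) n) * unit_bump x).
Proof.
move=> p0 q1; rewrite /bump_prim p0 q1 /=.
have tb : test_function I01 (bump (ratr p) (ratr q : R) n) by exact: test_bump.
have ti := test_itg tb; have ui := test_itg test_unit_bump.
apply: prim_test.
  have := test_lin 1 (- intI (bump (ratr p) (ratr q : R) n)) tb test_unit_bump.
  by congr (test_function _ _); apply/funext => x; rewrite mul1r mulNr.
rewrite intIB//; last exact: (rintegrableZ mI01).
by rewrite intIZ// int_unit_bump mulr1 subrr.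
Qed.

(** A sequence of test functions that suffices to recognize weak derivatives.
    Since it is countable, an identity that holds for each test function on
    almost every slice holds on almost every slice for the whole sequence. *)
Definition bump_seq (i : nat) : R -> R :=
  if unpickle i is Some (p, q, n) then bump_prim p q n else fun=> 0.

Lemma test_cst0 : test_function I01 (fun _ : R => 0 : R).
Proof.
split; first exact: smooth_cst.
by exists set0; split => //; exact: compact0.
Qed.

Lemma test_bump_seq i : test_function I01 (bump_seq i).
Proof.
rewrite /bump_seq; case: unpickle => [[[p q] n]|]; last exact: test_cst0.
rewrite /bump_prim; case: ifP => [/andP[p0 q1]|_]; last exact: test_cst0.
by have [] := bump_primP n p0 q1; rewrite /bump_prim p0 q1.
Qed.

Lemma abscont_parts A a phi : abscont A a -> test_function I01 phi ->
  intI (fun x => A x * derive1 phi x) = - intI (fun x => a x * phi x).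
Proof.
move=> Aa tp; have ap := test_abscont tp.
have := abscont_int (abscontM Aa ap); rewrite (test0 tp) (test1 tp) !mulr0 subr0.
rewrite intID; [|exact: (abscont_itg ap Aa.1)|exact: (abscont_itg Aa ap.1)].
move/eqP; rewrite addr_eq0 => /eqP ->; rewrite opprK.
by apply: eq_intI => x _; rewrite mulrC.
Qed.

Lemma itg_test a phi : itgI a -> test_function I01 phi -> itgI (fun x => a x * phi x).
Proof. by move=> ai tp; exact: (abscont_itg (test_abscont tp)). Qed.

(** Subtracting a primitive of g reduces the claim to g = 0. A function
    orthogonal to the derivatives of the corrected bumps is orthogonal to the
    bumps after subtraction of its mean against [unit_bump], so this mean is
    the constant it equals. *)
Lemma du_bois_reymond h g : itgI h -> itgI g ->
  (forall i, intI (fun x => h x * derive1 (bump_seq i) x) =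
             - intI (fun x => g x * bump_seq i x)) ->
  exists A, abscont A g /\ {ae leb, forall x, I01 x -> h x = A x}.
Proof.
move=> hi gi H.
have pi : itgI (prim g).
  by have := abscont_itg (abscont_prim gi) (rintegrable_cst mI01 fin_I01 1);
     under eq_fun do rewrite mul1r.
pose H0 x := h x - prim g x; have H0i : itgI H0 by exact: (rintegrableB mI01).
pose c := intI (fun x => H0 x * unit_bump x).
have tu := test_unit_bump.
exists (fun x => c + prim g x); split; first exact: abscont_cst (abscont_prim gi).
suff : {ae leb, forall x, I01 x -> H0 x - c = 0}.
  apply: filterS => x /[apply]; rewrite /H0 => /eqP.
  by rewrite subr_eq0 subr_eq addrC => /eqP ->; rewrite addrC.
have ci : itgI (fun _ : R => c) by exact: (rintegrable_cst mI01 fin_I01).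
apply: bump_int0_ae; first exact: (rintegrableB mI01).
move=> p q n p0 pq q1; pose e := bump (ratr p) (ratr q : R) n.
have te : test_function I01 e by exact: test_bump.
have [tp dp] := bump_primP n p0 q1.
have := H (pickle (p, q, n)); rewrite /bump_seq pickleK => Hp.
have : intI (fun x => H0 x * derive1 (bump_prim p q n) x) = 0.
  have td := test_derive1 tp.
  have := abscont_parts (abscont_prim gi) tp; rewrite -Hp => E.
  rewrite -[RHS](subrr (intI (fun x => h x * derive1 (bump_prim p q n) x))) -{2}E -intIB.
  - by apply: eq_intI => x _; rewrite /H0 mulrBl.
  - exact: itg_test.
  - exact: itg_test.
rewrite dp -/e => E0.
have e1 : itgI (fun x => H0 x * e x) by exact: itg_test.
have e2 : itgI (fun x => H0 x * unit_bump x) by exact: itg_test.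
have ei := test_itg te.
have -> : intI (fun x => (H0 x - c) * e x) = intI (fun x => H0 x * e x) - c * intI e.
  rewrite -intIZ// -intIB//; last exact: (rintegrableZ mI01).
  by apply: eq_intI => x _; rewrite mulrBl.
rewrite -E0 mulrC -[X in _ - X]intIZ// -intIB//; last exact: (rintegrableZ mI01).
by apply: eq_intI => x _; ring.
Qed.

End DuBoisReymond.

(** * Weak derivatives in one variable *)

Section WeakDerivatives.
Context {R : realType}.
Local Notation leb := (@lebesgue_measure R).
Implicit Types (a b c A B g k : R -> R) (phi eta : R -> R) (x y : R).

Lemma L2I_itg a : L2I a -> itgI a.
Proof. by move=> ai; exact: (sqintegrable_rint mI01 fin_I01). Qed.

Lemma L2I_sq a : L2I a -> itgI (fun x => a x ^+ 2).
Proof. by move=> []. Qed.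

Lemma L2I_mul a b : L2I a -> L2I b -> itgI (fun x => a x * b x).
Proof. exact: (sqintegrable_mul mI01). Qed.

Lemma L2ID a b : L2I a -> L2I b -> L2I (fun x => a x + b x).
Proof. exact: (sqintegrableD mI01). Qed.

Lemma L2IZ (c : R) a : L2I a -> L2I (fun x => c * a x).
Proof. exact: (sqintegrableZ mI01). Qed.

Lemma L2IB a b : L2I a -> L2I b -> L2I (fun x => a x - b x).
Proof. exact: (sqintegrableB mI01). Qed.

Lemma intI_ae_itg a b : itgI a -> itgI b ->
  {ae leb, forall x, I01 x -> a x = b x} -> intI a = intI b.
Proof. by move=> ai bi; exact: (eq_intI_ae (rintegrable_meas ai) (rintegrable_meas bi)). Qed.

Lemma weak_deriv_abscont a b : weak_deriv a b ->
  exists A, abscont A b /\ {ae leb, forall x, I01 x -> a x = A x}.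
Proof.
move=> [ai bi ab]; apply: du_bois_reymond; [exact: L2I_itg..|].
by move=> i; apply: ab; exact: test_bump_seq.
Qed.

Lemma weak_deriv_unique a b c : weak_deriv a b -> weak_deriv a c ->
  {ae leb, forall x, I01 x -> b x = c x}.
Proof.
move=> [_ bi ab] [_ ci ac].
have : {ae leb, forall x, I01 x -> b x - c x = 0}.
  apply: test_int0_ae; first exact: (rintegrableB mI01 (L2I_itg bi) (L2I_itg ci)).
  move=> eta te; have := ab _ te; rewrite (ac _ te) => /eqP.
  rewrite eqr_opp => /eqP E.
  rewrite -[RHS](subrr (intI (fun x => b x * eta x))) -{2}E -intIB.
  - by apply: eq_intI => x _; rewrite mulrBl.
  - by apply: itg_test => //; exact: L2I_itg.
  - by apply: itg_test => //; exact: L2I_itg.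
by apply: filterS => x /[apply] /eqP; rewrite subr_eq0 => /eqP.
Qed.

Lemma weak_derivD a b a' b' : weak_deriv a a' -> weak_deriv b b' ->
  weak_deriv (fun x => a x + b x) (fun x => a' x + b' x).
Proof.
move=> [ai a'i aa'] [bi b'i bb']; split; [exact: L2ID..|] => phi tp.
have td := test_derive1 tp.
transitivity (intI (fun x => a x * derive1 phi x) + intI (fun x => b x * derive1 phi x)).
  rewrite -intID; [|by apply: itg_test => //; exact: L2I_itg..].
  by apply: eq_intI => x _; rewrite mulrDl.
rewrite (aa' _ tp) (bb' _ tp) -opprD -intID; [|by apply: itg_test => //; exact: L2I_itg..].
by congr (- _); apply: eq_intI => x _; rewrite mulrDl.
Qed.

Lemma weak_derivZ (c : R) a a' : weak_deriv a a' ->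
  weak_deriv (fun x => c * a x) (fun x => c * a' x).
Proof.
move=> [ai a'i aa']; split; [exact: L2IZ..|] => phi tp.
have td := test_derive1 tp.
transitivity (c * intI (fun x => a x * derive1 phi x)).
  rewrite -intIZ; last by apply: itg_test => //; exact: L2I_itg.
  by apply: eq_intI => x _; rewrite mulrA.
rewrite (aa' _ tp) mulrN -intIZ; last by apply: itg_test => //; exact: L2I_itg.
by congr (- _); apply: eq_intI => x _; rewrite mulrA.
Qed.

(** Cauchy-Schwarz against the constant 1, from the integral of (|a| - m)^2
    with m the mean of |a|. *)
Lemma sqr_intI a : L2I a -> intI (fun x => `|a x|) ^+ 2 <= intI (fun x => a x ^+ 2).
Proof.
move=> ai; set m := intI _.
have ni : itgI (fun x => `|a x|) by exact: (rintegrable_norm (L2I_itg ai)).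
have : 0 <= intI (fun x => (a x ^+ 2 - (2 * m) * `|a x|) + m ^+ 2).
  apply: intI_ge0 => x _; rewrite -(real_normK (num_real (a x))).
  by have := sqr_ge0 (`|a x| - m); nra.
have i1 : itgI (fun x => (2 * m) * `|a x|) by exact: (rintegrableZ mI01).
have i2 : itgI (fun _ : R => m ^+ 2) by exact: (rintegrable_cst mI01 fin_I01).
rewrite intID//; last exact: (rintegrableB mI01 (L2I_sq ai)).
rewrite intIB//; last exact: L2I_sq.
rewrite intIZ// intI_cst -/m; lra.
Qed.

Lemma abscont_L2 A a : abscont A a -> L2I A.
Proof.
move=> Aa; split; first exact: abscont_meas Aa.
have [M M0 AM] := abscont_bounded Aa.
apply: (rintegrable_le mI01 (g := fun=> M ^+ 2)).
- by apply: measurable_funX; exact: abscont_meas Aa.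
- exact: (rintegrable_cst mI01 fin_I01).
- move=> x; rewrite /I01 /= in_itv /= => /andP[x0 x1].
  rewrite normrX ler_sqr ?nnegrE//; apply: AM.
  by rewrite !ltW.
Qed.

(** The oscillation of A is at most the integral of |a|, so A(x)^2 is at most 2
    A(y)^2 + 2 |a|^2 for every y; it remains to average over y. This is the
    embedding of H^1 into bounded functions, up to the end points. *)
Lemma abscont_sup A a x : abscont A a -> L2I a -> 0 <= x <= 1 ->
  A x ^+ 2 <= 2 * (intI (fun y => A y ^+ 2) + intI (fun y => a y ^+ 2)).
Proof.
move=> Aa ai x01; have [ai' Ae] := Aa.
have AL := abscont_L2 Aa.
have ni : itgI (fun x => `|a x|) by exact: (rintegrable_norm ai').
have key y : I01 y -> A x ^+ 2 <= 2 * A y ^+ 2 + 2 * intI (fun x => a x ^+ 2).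
  rewrite /I01 /= in_itv /= => /andP[y0 y1].
  have E : A x = A y + (prim a x - prim a y).
    by rewrite Ae// [A y]Ae ?(ltW y0) ?(ltW y1)//; ring.
  have le : `|prim a x - prim a y| <= intI (fun x => `|a x|).
    rewrite -intIB; [|exact: cut_itg..].
    have ci := rintegrableB mI01 (cut_itg x ai') (cut_itg y ai').
    apply: (le_trans (norm_intI ci)); apply: le_intI => //.
      exact: (rintegrable_norm ci).
    apply: aeW => w _; rewrite /cut -mulrBl normrM ler_piMl//.
    by case: (w < x); case: (w < y); rewrite ?subrr ?subr0 ?sub0r ?normrN ?normr0 ?normr1 ?ler01.
  have le2 : (prim a x - prim a y) ^+ 2 <= intI (fun x => a x ^+ 2).
    apply: le_trans (sqr_intI ai).
    by rewrite -(real_normK (num_real (_ - _))) ler_sqr ?nnegrE// (le_trans _ le).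
  rewrite E; have := sqr_ge0 (A y - (prim a x - prim a y)); nra.
rewrite -(intI_cst (A x ^+ 2)).
have -> : 2 * (intI (fun y => A y ^+ 2) + intI (fun y => a y ^+ 2)) =
    intI (fun y => 2 * A y ^+ 2 + 2 * intI (fun y => a y ^+ 2)).
  rewrite intID ?intI_cst ?intIZ ?mulrDr//; first exact: L2I_sq.
    exact: (rintegrableZ mI01 _ (L2I_sq AL)).
  exact: (rintegrable_cst mI01 fin_I01).
apply: le_intI.
- exact: (rintegrable_cst mI01 fin_I01).
- apply: (rintegrableD mI01); first exact: (rintegrableZ mI01 _ (L2I_sq AL)).
  exact: (rintegrable_cst mI01 fin_I01).
- by apply: aeW => y; exact: key.
Qed.

Lemma weak_deriv_sup a b : weak_deriv a b -> {ae leb, forall x, I01 x ->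
  a x ^+ 2 <= 2 * (intI (fun y => a y ^+ 2) + intI (fun y => b y ^+ 2))}.
Proof.
move=> ab; have [ai bi _] := ab; have [A [Ab aA]] := weak_deriv_abscont ab.
have -> : intI (fun y => a y ^+ 2) = intI (fun y => A y ^+ 2).
  apply: intI_ae_itg; [exact: L2I_sq|exact: L2I_sq (abscont_L2 Ab)|].
  by apply: filterS aA => x /[apply] ->.
apply: filterS aA => x /[swap] Ix /(_ Ix) ->; apply: (abscont_sup Ab bi).
by move: Ix; rewrite /I01 /= in_itv /= => /andP[/ltW -> /ltW ->].
Qed.

(** Test functions vanish at the end points and approach [a] in H^1; by
    [abscont_sup] the values of the continuous representative at the end points
    are limits of zeros. *)
Lemma H10_abscont a b : H10 a -> weak_deriv a b ->
  exists A, [/\ abscont A b, {ae leb, forall x, I01 x -> a x = A x}, A 0 = 0 & A 1 = 0].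
Proof.
move=> [c [ac Hc]] ab.
have [A [Ab aA]] := weak_deriv_abscont ab.
have bc := weak_deriv_unique ab ac.
have [ai bi _] := ab; have [_ ci _] := ac.
suff bnd x : 0 <= x <= 1 -> (forall phi, test_function I01 phi -> phi x = 0) -> A x = 0.
  exists A; split => //; apply: bnd; rewrite ?lexx ?ler01// => phi; [exact: test0|exact: test1].
move=> x01 px; apply/eqP; rewrite -sqrf_eq0 eq_le sqr_ge0 andbT.
apply/ler_addgt0Pr => e e0; rewrite add0r.
have se0 : 0 < Num.sqrt (e / 2) by rewrite sqrtr_gt0 divr_gt0.
have [phi [tp]] := Hc _ se0.
rewrite /normH1 ltr_sqrt ?divr_gt0// => lt.
have Ap := abscontB Ab (test_abscont tp).
have dL : L2I (derive1 phi) by exact: abscont_L2 (test_abscont (test_derive1 tp)).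
have pL : L2I phi by exact: abscont_L2 (test_abscont tp).
have := abscont_sup Ap (L2IB bi dL) x01.
rewrite (px _ tp) subr0 => h; apply: (le_trans h).
have -> : intI (fun y => (A y - phi y) ^+ 2) = intI (fun y => (a y - phi y) ^+ 2).
  apply: intI_ae_itg; [exact: L2I_sq (abscont_L2 Ap)|exact: L2I_sq (L2IB ai pL)|].
  by apply: filterS aA => y /[apply] ->.
have -> : intI (fun y => (b y - derive1 phi y) ^+ 2) = intI (fun y => (c y - derive1 phi y) ^+ 2).
  apply: intI_ae_itg; [exact: L2I_sq (L2IB bi dL)|exact: L2I_sq (L2IB ci dL)|].
  by apply: filterS bc => y /[apply] ->.
rewrite -intID; [|exact: L2I_sq (L2IB ai pL)|exact: L2I_sq (L2IB ci dL)].
by rewrite -ler_pdivlMl// mulrC ltW.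
Qed.

End WeakDerivatives.

(** * Slices of functions on the square and trilinear bounds *)

Section SlicesOfTheSquare.
Context {R : realType}.
Local Notation leb := (@lebesgue_measure R).
Implicit Types (u v w p q r g : R * R -> R) (a b : R -> R) (phi eta : R -> R) (x t : R).

Lemma L2Q_itg u : L2Q u -> itgQ u.
Proof. by move=> ui; exact: (sqintegrable_rint mQ01 fin_Q01). Qed.

Lemma L2Q_sq u : L2Q u -> itgQ (fun z => u z ^+ 2).
Proof. by move=> []. Qed.

Lemma L2Q_mul u v : L2Q u -> L2Q v -> itgQ (fun z => u z * v z).
Proof. exact: (sqintegrable_mul mQ01). Qed.

Lemma L2QD u v : L2Q u -> L2Q v -> L2Q (fun z => u z + v z).
Proof. exact: (sqintegrableD mQ01). Qed.

Lemma L2QZ (c : R) u : L2Q u -> L2Q (fun z => c * u z).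
Proof. exact: (sqintegrableZ mQ01). Qed.

Lemma L2QB u v : L2Q u -> L2Q v -> L2Q (fun z => u z - v z).
Proof. exact: (sqintegrableB mQ01). Qed.

Lemma itgQD u v : itgQ u -> itgQ v -> itgQ (fun z => u z + v z).
Proof. exact: (rintegrableD mQ01). Qed.

Lemma itgQB u v : itgQ u -> itgQ v -> itgQ (fun z => u z - v z).
Proof. exact: (rintegrableB mQ01). Qed.

Lemma itgQZ (c : R) u : itgQ u -> itgQ (fun z => c * u z).
Proof. exact: (rintegrableZ mQ01). Qed.

Lemma itgQN u : itgQ u -> itgQ (fun z => - u z).
Proof. exact: (rintegrableN mQ01). Qed.

Lemma L2Q_slice u : L2Q u -> {ae leb, forall t, I01 t -> L2I (slice u t)}.
Proof.
move=> [mu ui]; have [ae _ _] := fubini_slice ui.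
apply: filterS ae => t /[swap] It /(_ It) si; split => //.
exact: slice_meas.
Qed.

(** The factor in H^1 is bounded by its norm and the two others are square
    integrable. The weight e balances their norms: the three factors will have
    size s, and e = |s| then makes the bound cubic in s. *)
Lemma triple_1d a b c c' (e : R) : 0 < e -> L2I a -> L2I b -> weak_deriv c c' ->
  itgI (fun x => a x * b x * c x) /\
  intI (fun x => `|a x * b x * c x|) <=
    2^-1 * (e * intI (fun x => b x ^+ 2) +
      e^-1 * (2 * (intI (fun x => c x ^+ 2) + intI (fun x => c' x ^+ 2))
              * intI (fun x => a x ^+ 2))).
Proof.
move=> e0 ai bi cc'; have [ci c'i _] := cc'; set V := 2 * _.
have V0 : 0 <= V.
  by rewrite mulr_ge0// addr_ge0//; apply: intI_ge0 => x _; exact: sqr_ge0.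
have i1 : itgI (fun x => e * b x ^+ 2) by exact: (rintegrableZ mI01 _ (L2I_sq bi)).
have i2 : itgI (fun x => (e^-1 * V) * a x ^+ 2).
  exact: (rintegrableZ mI01 _ (L2I_sq ai)).
have -> : 2^-1 * (e * intI (fun x => b x ^+ 2) + e^-1 * (V * intI (fun x => a x ^+ 2))) =
    intI (fun x => 2^-1 * (e * b x ^+ 2 + (e^-1 * V) * a x ^+ 2)).
  rewrite intIZ; last exact: (rintegrableD mI01 i1 i2).
  rewrite intID// !intIZ; [by rewrite mulrA|exact: L2I_sq|exact: L2I_sq].
apply: (rintegrable_ae_le mI01).
- apply: measurable_funM; last by case: ci.
  by apply: measurable_funM; [case: ai|case: bi].
- by apply: (rintegrableZ mI01); exact: (rintegrableD mI01 i1 i2).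
- apply: filterS (weak_deriv_sup cc') => x /[swap] Ix /(_ Ix) cV.
  have eI : e^-1 * e = 1 by rewrite mulVf// gt_eqF.
  have ei0 : 0 < e^-1 by rewrite invr_gt0.
  have h1 : e^-1 * (a x ^+ 2 * c x ^+ 2) <= (e^-1 * V) * a x ^+ 2.
    by rewrite -mulrA ler_wpM2l ?(ltW ei0)// mulrC ler_wpM2r// sqr_ge0.
  have h2 : 2 * `|a x * b x * c x| <= e * b x ^+ 2 + e^-1 * (a x ^+ 2 * c x ^+ 2).
    have -> : e * b x ^+ 2 + e^-1 * (a x ^+ 2 * c x ^+ 2) =
        e * (`|b x| ^+ 2 + (e^-1 * `|a x * c x|) ^+ 2).
      rewrite !exprMn !real_normK ?num_real// exprMn; field; exact: lt0r_neq0.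
    have -> : 2 * `|a x * b x * c x| = e * (2 * `|b x| * (e^-1 * `|a x * c x|)).
      rewrite !normrM; field; exact: lt0r_neq0.
    rewrite ler_wpM2l ?(ltW e0)//.
    by have := sqr_ge0 (`|b x| - e^-1 * `|a x * c x|); nra.
  lra.
Qed.

Definition LinfL2 (S : R) p := measurable_fun Q01 p /\
  {ae leb, forall t, I01 t -> L2I (slice p t) /\ intI (fun x => slice p t x ^+ 2) <= S}.

Lemma triple_Q p q r rx (e S : R) : 0 < e -> LinfL2 S p -> L2Q q -> L2Q r ->
  is_Dx r rx ->
  itgQ (fun z => p z * q z * r z) /\
  `|intQ (fun z => p z * q z * r z)| <=
    2^-1 * (e * intQ (fun z => q z ^+ 2) +
      e^-1 * (2 * (intQ (fun z => r z ^+ 2) + intQ (fun z => rx z ^+ 2)) * S)).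
Proof.
move=> e0 [mp pS] qi ri [rxi rrx].
have [aq iq ->] := fubini_slice (L2Q_sq qi).
have [ar ir ->] := fubini_slice (L2Q_sq ri).
have [ax ix ->] := fubini_slice (L2Q_sq rxi).
set Q := fun t => _ in iq *; set P := fun t => _ in ir *; set X := fun t => _ in ix *.
pose G t := 2^-1 * (e * Q t + (e^-1 * (2 * S)) * (P t + X t)).
have i1 : itgI (fun t => e * Q t) by exact: (rintegrableZ mI01).
have i2 : itgI (fun t => P t + X t) by exact: (rintegrableD mI01).
have i3 : itgI (fun t => (e^-1 * (2 * S)) * (P t + X t)) by exact: (rintegrableZ mI01).
have iG : itgI G by exact: (rintegrableZ mI01 _ (rintegrableD mI01 i1 i3)).
have -> : 2^-1 * (e * intI Q + e^-1 * (2 * (intI P + intI X) * S)) = intI G.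
  rewrite /G intIZ; last exact: (rintegrableD mI01 i1 i3).
  by rewrite intID// !intIZ// intID//; ring.
apply: tonelli_slice => //.
  apply: measurable_funM; last by case: ri.
  by apply: measurable_funM => //; case: qi.
have qs := L2Q_slice qi.
apply: filterS3 pS qs rrx => t + + + It => /(_ It) [pt pS] /(_ It) qt /(_ It) rt.
have [ti le] := triple_1d e0 pt qt rt; split => //.
apply: (le_trans le); rewrite /G; apply: ler_wpM2l; first by rewrite invr_ge0.
rewrite lerD2l -!mulrA ler_wpM2l ?invr_ge0 ?(ltW e0)// ler_wpM2l// mulrC.
rewrite ler_wpM2r//.
by rewrite addr_ge0//; apply: intI_ge0 => x _; exact: sqr_ge0.
Qed.

Lemma test_meas2 phi : test_function I01 phi ->
  measurable_fun Q01 (fun z : R * R => phi z.1) /\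
  measurable_fun Q01 (fun z : R * R => phi z.2).
Proof.
move=> tp; split; apply: measurable_funTS.
  by apply: measurableT_comp; [exact: test_meas|exact: measurable_fst].
by apply: measurableT_comp; [exact: test_meas|exact: measurable_snd].
Qed.

Lemma itgQ_test1 u phi : itgQ u -> test_function I01 phi -> itgQ (fun z => u z * phi z.1).
Proof.
move=> ui tp; have [M M0 PM] := test_bounded tp.
apply: (rintegrable_le mQ01 (g := fun z => M * `|u z|)).
- by apply: measurable_funM; [exact: rintegrable_meas ui|have [] := test_meas2 tp].
- exact: (rintegrableZ mQ01 _ (rintegrable_norm ui)).
- by move=> z _; rewrite normrM mulrC ler_wpM2r.
Qed.

Lemma itgQ_test2 u phi : itgQ u -> test_function I01 phi -> itgQ (fun z => u z * phi z.2).
Proof.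
move=> ui tp; have [M M0 PM] := test_bounded tp.
apply: (rintegrable_le mQ01 (g := fun z => M * `|u z|)).
- by apply: measurable_funM; [exact: rintegrable_meas ui|have [] := test_meas2 tp].
- exact: (rintegrableZ mQ01 _ (rintegrable_norm ui)).
- by move=> z _; rewrite normrM mulrC ler_wpM2r.
Qed.

(** The integral over the slice is orthogonal to all test functions of time,
    hence vanishes almost everywhere. *)
Lemma slice_ae0 u : itgQ u ->
  (forall eta, test_function I01 eta -> intQ (fun z => u z * eta z.2) = 0) ->
  {ae leb, forall t, I01 t -> intI (slice u t) = 0}.
Proof.
move=> ui H; have [au iu _] := fubini_slice ui.
apply: test_int0_ae => // eta te; rewrite -(H _ te).
have uei := itgQ_test2 ui te.
have [_ ie ->] := fubini_slice uei.
apply: intI_ae_itg => //; first exact: itg_test.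
apply: filterS au => t /[apply] si.
rewrite mulrC -intIZ//; apply: eq_intI => x _; rewrite /slice /= mulrC.
by [].
Qed.

Lemma tslice_ae0 u : itgQ u ->
  (forall phi, test_function I01 phi -> intQ (fun z => u z * phi z.1) = 0) ->
  {ae leb, forall x, I01 x -> intI (tslice u x) = 0}.
Proof.
move=> ui H; have [au iu _] := fubini_tslice ui.
apply: test_int0_ae => // eta te; rewrite -(H _ te).
have uei := itgQ_test1 ui te.
have [_ ie ->] := fubini_tslice uei.
apply: intI_ae_itg => //; first exact: itg_test.
apply: filterS au => t /[apply] si.
rewrite mulrC -intIZ//; apply: eq_intI => x _; rewrite /tslice /= mulrC.
by [].
Qed.

Lemma intQ_slice0 u : itgQ u -> {ae leb, forall t, I01 t -> intI (slice u t) = 0} ->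
  intQ u = 0.
Proof.
move=> ui u0; have [_ iu ->] := fubini_slice ui.
rewrite -[RHS](intI_cst (0 : R)); apply: intI_ae_itg => //.
exact: (rintegrable_cst mI01 fin_I01).
Qed.

(** [Dx u] is chosen among the weak derivatives; whenever there is one, it is
    one. *)
Lemma DxP u : L2H1 u -> [/\ L2Q u, L2Q (Dx u) & is_Dx u (Dx u)].
Proof.
move=> [ui [g ug]]; have H := xgetI (fun=> 0) ug.
by split => //; case: H.
Qed.

Lemma is_Dx_lin (c : R) u v g h : is_Dx u g -> is_Dx v h ->
  is_Dx (fun z => c * u z + v z) (fun z => c * g z + h z).
Proof.
move=> [gi ug] [hi vh]; split; first by apply: L2QD => //; exact: L2QZ.
by apply: filterS2 ug vh => t + + It => /(_ It) ug /(_ It) vh;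
  exact: weak_derivD (weak_derivZ c ug) vh.
Qed.

(** Weak derivatives are unique almost everywhere on almost every slice, so
    integrals do not depend on the choice made by [Dx]. *)
Lemma is_Dx_unique u g h : is_Dx u g -> is_Dx u h ->
  intQ (fun z => g z ^+ 2) = intQ (fun z => h z ^+ 2).
Proof.
move=> [gi ug] [hi uh].
have [ag ig ->] := fubini_slice (L2Q_sq gi).
have [ah ih ->] := fubini_slice (L2Q_sq hi).
apply: intI_ae_itg => //.
apply: filterS3 ug uh (filterI ag ah) => t + + [+ +] It => /(_ It) ug /(_ It) uh /(_ It) gt /(_ It) ht.
apply: intI_ae_itg => //.
by apply: filterS (weak_deriv_unique ug uh) => x /[apply]; rewrite /slice => ->.
Qed.

End SlicesOfTheSquare.

(** * The elliptic equation tested with the velocity of another geodesic *)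

Section Elliptic.
Context {R : realType}.
Local Notation leb := (@lebesgue_measure R).
Implicit Types (u v w r g z rho : R * R -> R) (a b : R -> R) (phi eta : R -> R) (x t : R).

Lemma eq_itgQ (f h : R * R -> R) : (forall p, f p = h p) -> itgQ f -> itgQ h.
Proof. by move=> /funext ->. Qed.

(** The weak equation says that M = lambda a1 - eps q_x is absolutely
    continuous with M' = k. Now q g_x and M g vanish at the ends because q and
    g lie in H^1_0, where q stands for v_xx: these are the boundary conditions
    v_xx = 0 and v = 0. Integrating their derivatives moves all derivatives
    onto the right factors. The existence of q_x comes from q in H^1_0. *)
Lemma elliptic_1d (lambda eps : R) (q qx a1 k g g1 g2 : R -> R) :
  weak_deriv q qx -> H10 q -> L2I a1 -> itgI k ->
  weak_deriv g g1 -> weak_deriv g1 g2 -> H10 g ->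
  (forall i, intI (fun x => eps * q x * derive1 (derive1 (bump_seq i)) x +
     lambda * a1 x * derive1 (bump_seq i) x + k x * bump_seq i x) = 0) ->
  intI (fun x => eps * q x * g2 x + lambda * a1 x * g1 x + k x * g x) = 0.
Proof.
move=> qqx Hq a1i ki gg1 g1g2 Hg H.
have [Q [Qqx qQ Q0 Q1]] := H10_abscont Hq qqx.
have [G [Gg1 gG G0 G1]] := H10_abscont Hg gg1.
have [D [Dg2 gD]] := weak_deriv_abscont g1g2.
have [qi qxi qw] := qqx; have [_ g1i _] := gg1; have [_ g2i _] := g1g2.
pose m x := lambda * a1 x - eps * qx x.
have mL : L2I m by apply: L2IB; exact: L2IZ.
have [M [Mk mM]] : exists M, abscont M k /\ {ae leb, forall x, I01 x -> m x = M x}.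
  apply: du_bois_reymond => //; first exact: L2I_itg.
  move=> i; have tp := test_bump_seq (R := R) i; have td := test_derive1 tp.
  have tdd := test_derive1 td.
  have i1 := itg_test (L2I_itg qi) tdd; have i2 := itg_test (L2I_itg qxi) td.
  have i3 := itg_test (L2I_itg a1i) td; have i4 := itg_test ki tp.
  have E : intI (fun x => eps * (q x * derive1 (derive1 (bump_seq i)) x) +
     lambda * (a1 x * derive1 (bump_seq i) x) + k x * bump_seq i x) = 0.
    by rewrite -[RHS](H i); apply: eq_intI => x _; ring.
  have iZ1 : itgI (fun x => eps * (q x * derive1 (derive1 (bump_seq i)) x)).
    exact: (rintegrableZ mI01).
  have iZ2 : itgI (fun x => lambda * (a1 x * derive1 (bump_seq i) x)).
    exact: (rintegrableZ mI01).
  have iZ3 : itgI (fun x => eps * (qx x * derive1 (bump_seq i) x)).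
    exact: (rintegrableZ mI01).
  move: E; rewrite intID//; last exact: (rintegrableD mI01).
  rewrite intID// intIZ// (qw _ td) mulrN -intIZ// => /eqP; rewrite addr_eq0 => /eqP <-.
  by rewrite addrC -intIB//; apply: eq_intI => x _; rewrite /m; ring.
(* the end point terms q g_x vanish since q is in H^1_0 *)
have e1 : intI (fun x => q x * g2 x) = - intI (fun x => qx x * g1 x).
  have := abscont_int (abscontM Qqx Dg2); rewrite Q0 Q1 !mul0r subr0.
  rewrite intID; [|exact: (abscont_itg Dg2 Qqx.1)|exact: (abscont_itg Qqx Dg2.1)].
  rewrite addrC => /eqP; rewrite addr_eq0 => /eqP E.
  transitivity (intI (fun x => g2 x * Q x)).
    apply: intI_ae_itg; [exact: L2I_mul|exact: (abscont_itg Qqx Dg2.1)|].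
    by apply: filterS qQ => x /[apply] ->; rewrite mulrC.
  rewrite E; congr (- _).
  apply: intI_ae_itg; [exact: (abscont_itg Dg2 Qqx.1)|exact: L2I_mul|].
  by apply: filterS gD => x /[apply] ->.
(* the end point terms M g vanish since g is in H^1_0 *)
have e2 : intI (fun x => k x * g x) = - intI (fun x => m x * g1 x).
  have := abscont_int (abscontM Mk Gg1); rewrite G0 G1 !mulr0 subr0.
  rewrite intID; [|exact: (abscont_itg Gg1 Mk.1)|exact: (abscont_itg Mk Gg1.1)].
  move/eqP; rewrite addr_eq0 => /eqP E.
  transitivity (intI (fun x => k x * G x)).
    apply: eq_intI_ae.
    - apply: measurable_funM; first exact: rintegrable_meas ki.
      by case: gg1 => -[].
    - exact: rintegrable_meas (abscont_itg Gg1 Mk.1).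
    - by apply: filterS gG => x /[apply] ->.
  rewrite E; congr (- _).
  apply: intI_ae_itg; [exact: (abscont_itg Mk Gg1.1)|exact: L2I_mul|].
  by apply: filterS mM => x /[apply] ->; rewrite mulrC.
have kg : itgI (fun x => k x * g x).
  apply: (rintegrable_ae_eq mI01 _ (abscont_itg Gg1 ki)).
    by apply: measurable_funM; [exact: rintegrable_meas ki|case: gg1 => -[]].
  by apply: filterS gG => x /[apply] ->.
have i1 : itgI (fun x => eps * (q x * g2 x)) by exact: (rintegrableZ mI01 _ (L2I_mul qi g2i)).
have i2 : itgI (fun x => lambda * (a1 x * g1 x)).
  exact: (rintegrableZ mI01 _ (L2I_mul a1i g1i)).
transitivity (intI (fun x => eps * (q x * g2 x) + lambda * (a1 x * g1 x) + k x * g x)).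
  by apply: eq_intI => x _; ring.
rewrite intID//; last exact: (rintegrableD mI01).
rewrite intID// [X in X + _ + _]intIZ; last exact: L2I_mul.
rewrite e1 e2 mulrN -intIZ; last exact: L2I_mul.
have i3 : itgI (fun x => eps * (qx x * g1 x)) by exact: (rintegrableZ mI01 _ (L2I_mul qxi g1i)).
have -> : intI (fun x => m x * g1 x) =
    intI (fun x => lambda * (a1 x * g1 x)) - intI (fun x => eps * (qx x * g1 x)).
  by rewrite -intIB//; apply: eq_intI => x _; rewrite /m; ring.
ring.
Qed.

(** Testing with phi(x) eta(t) isolates the equation on almost every slice, for
    all functions of [bump_seq] at once; there [elliptic_1d] applies, and the
    slices are integrated over t. *)
Lemma elliptic_tested (kappa lambda eps S : R) v vx vxx z rx g gx gxx :
  L2Q v -> is_Dx v vx -> is_Dx vx vxx ->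
  {ae leb, forall t, I01 t -> H10 (slice vxx t)} ->
  L2Q z -> LinfL2 S z -> L2Q rx ->
  L2Q g -> is_Dx g gx -> is_Dx gx gxx -> {ae leb, forall t, I01 t -> H10 (slice g t)} ->
  (forall phi eta, test_function I01 phi -> test_function I01 eta ->
     intQ (fun p => eps * vxx p * (derive1 (derive1 phi) p.1 * eta p.2)
       + lambda * vx p * (derive1 phi p.1 * eta p.2) + kappa * v p * (phi p.1 * eta p.2)
       + z p * rx p * (phi p.1 * eta p.2)) = 0) ->
  intQ (fun p => eps * (vxx p * gxx p) + lambda * (vx p * gx p)
     + kappa * (v p * g p)) = - intQ (fun p => z p * rx p * g p).
Proof.
move=> vi Dv Dvx Hvxx zi zS rxi gi Dg Dgx Hg ell.
have [vxi _] := Dv; have [vxxi _] := Dvx; have [gxi wgx] := Dg; have [gxxi wgxx] := Dgx.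
pose k p := kappa * v p + z p * rx p.
have ki : itgQ k by apply: itgQD; [exact/itgQZ/L2Q_itg|exact: L2Q_mul].
have [zrg _] := triple_Q ltr01 zS rxi gi Dg.
have ti1 : itgQ (fun p => eps * (vxx p * gxx p)) by exact/itgQZ/L2Q_mul.
have ti2 : itgQ (fun p => lambda * (vx p * gx p)) by exact/itgQZ/L2Q_mul.
have ti3 : itgQ (fun p => kappa * (v p * g p)) by exact/itgQZ/L2Q_mul.
have tot : itgQ (fun p => eps * vxx p * gxx p + lambda * vx p * gx p
    + k p * g p).
  apply: eq_itgQ (itgQD (itgQD (itgQD ti1 ti2) ti3) zrg) => p.
  by rewrite /k; ring.
apply/eqP; rewrite -addr_eq0 -intQD//; last by apply: itgQD => //; exact: itgQD.
apply/eqP; transitivity (intQ (fun p => eps * vxx p * gxx p +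
    lambda * vx p * gx p + k p * g p)).
  by apply: eq_intQ => p _; rewrite /k; ring.
apply: intQ_slice0 => //.
have loc : {ae leb, forall t, forall i, I01 t -> intI (slice (fun p =>
    eps * vxx p * derive1 (derive1 (bump_seq i)) p.1 +
    lambda * vx p * derive1 (bump_seq i) p.1 + k p * bump_seq i p.1) t) = 0}.
  apply: ae_foralln => i.
  have tp := test_bump_seq (R := R) i; have td := test_derive1 tp.
  have tdd := test_derive1 td.
  have j1 : itgQ (fun p => eps * vxx p * derive1 (derive1 (bump_seq i)) p.1).
    exact: (itgQ_test1 (itgQZ eps (L2Q_itg vxxi)) tdd).
  have j2 : itgQ (fun p => lambda * vx p * derive1 (bump_seq i) p.1).
    exact: (itgQ_test1 (itgQZ lambda (L2Q_itg vxi)) td).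
  have j3 : itgQ (fun p => k p * bump_seq i p.1) by exact: (itgQ_test1 ki tp).
  apply: slice_ae0; first exact: itgQD (itgQD j1 j2) j3.
  move=> eta te; rewrite -[RHS](ell _ _ tp te).
  by apply: eq_intQ => p _; rewrite /k; ring.
have [ak _ _] := fubini_slice ki.
have vxs := L2Q_slice vxi.
apply: filterS3 (filterI wgxx wgx) (filterI Hg ak) (filterI vxs (filterI Hvxx loc)) => t.
move=> [wgxxt wgxt] [Hgt kt] [vxt [Hvt lt]] It.
have [b [qb _]] := Hvt It.
by apply: (elliptic_1d qb (Hvt It) (vxt It) (kt It) (wgxt It) (wgxxt It) (Hgt It)) => i; exact: (lt i It).
Qed.

End Elliptic.

(** * Weak time derivatives *)

Section WeakTimeDerivatives.
Context {R : realType}.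
Local Notation leb := (@lebesgue_measure R).
Implicit Types (u v w r g z rho : R * R -> R) (a b : R -> R) (phi eta : R -> R) (x t : R).

(** The weak equation in (x, t) tested with phi(x) eta(t) becomes, for almost
    every x, a weak equation in t along the line through x. *)
Lemma time_abscont u w : itgQ u -> itgQ w ->
  (forall phi eta, test_function I01 phi -> test_function I01 eta ->
     intQ (fun p => u p * (phi p.1 * derive1 eta p.2) + w p * (phi p.1 * eta p.2)) = 0) ->
  {ae leb, forall x, I01 x -> exists A, abscont A (tslice w x) /\
     {ae leb, forall t, I01 t -> u (x, t) = A t}}.
Proof.
move=> ui wi H.
have loc : {ae leb, forall x, forall i, I01 x -> intI (tslice (fun p =>
    u p * derive1 (bump_seq i) p.2 + w p * bump_seq i p.2) x) = 0}.
  apply: ae_foralln => i.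
  have te := test_bump_seq (R := R) i; have td := test_derive1 te.
  apply: tslice_ae0; first exact: itgQD (itgQ_test2 ui td) (itgQ_test2 wi te).
  move=> phi tp; rewrite -[RHS](H _ _ tp te).
  by apply: eq_intQ => p _; ring.
have [au _ _] := fubini_tslice ui; have [aw _ _] := fubini_tslice wi.
apply: filterS3 loc au aw => x loc + + Ix => /(_ Ix) ux /(_ Ix) wx.
apply: du_bois_reymond => // i.
have te := test_bump_seq (R := R) i; have td := test_derive1 te.
apply/eqP; rewrite -addr_eq0 -intID; [|exact: itg_test|exact: itg_test].
by rewrite (loc i Ix).
Qed.

Lemma space_parts u ux v vx phi t :
  weak_deriv (slice u t) (slice ux t) -> weak_deriv (slice v t) (slice vx t) ->
  test_function I01 phi ->
  intI (fun x => u (x, t) * v (x, t) * derive1 phi x) =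
  - intI (fun x => (ux (x, t) * v (x, t) + vx (x, t) * u (x, t)) * phi x).
Proof.
move=> wu wv tp; have [ui uxi _] := wu; have [vi vxi _] := wv.
have [U [Uux uU]] := weak_deriv_abscont wu; have [V [Vvx vV]] := weak_deriv_abscont wv.
have UV := abscontM Uux Vvx.
have := abscont_parts UV tp => E.
have td := test_derive1 tp.
transitivity (intI (fun x => U x * V x * derive1 phi x)).
  apply: intI_ae_itg.
  - by apply: (itg_test (a := fun x => u (x, t) * v (x, t))) => //; exact: (L2I_mul ui vi).
  - by apply: itg_test => //; exact: L2I_itg (abscont_L2 UV).
  - by apply: filterS2 uU vV => x + + Ix => /(_ Ix); rewrite /slice => -> /(_ Ix) ->.
rewrite E; congr (- _); apply: intI_ae_itg.
- by apply: itg_test => //; exact: UV.1.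
- apply: (itg_test (a := fun x => ux (x, t) * v (x, t) + vx (x, t) * u (x, t))) => //.
  by apply: (rintegrableD mI01); [exact: (L2I_mul uxi vi)|exact: (L2I_mul vxi ui)].
- by apply: filterS2 uU vV => x + + Ix => /(_ Ix); rewrite /slice => -> /(_ Ix) ->.
Qed.

Lemma space_parts_Q u ux v vx phi eta : L2Q u -> L2Q v -> is_Dx u ux -> is_Dx v vx ->
  test_function I01 phi -> test_function I01 eta ->
  intQ (fun p => u p * v p * (derive1 phi p.1 * eta p.2)) =
  - intQ (fun p => (ux p * v p + vx p * u p) * (phi p.1 * eta p.2)).
Proof.
move=> ui vi [uxi wu] [vxi wv] tp te; have td := test_derive1 tp.
have uv := L2Q_mul ui vi.
have D := itgQD (L2Q_mul uxi vi) (L2Q_mul vxi ui).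
have j1 := itgQ_test2 (itgQ_test1 uv td) te.
have j2 := itgQ_test2 (itgQ_test1 D tp) te.
apply/eqP; rewrite -addr_eq0; apply/eqP.
transitivity (intQ (fun p => u p * v p * derive1 phi p.1 * eta p.2
   + (ux p * v p + vx p * u p) * phi p.1 * eta p.2)).
  by rewrite intQD//; congr (_ + _); apply: eq_intQ => p _; rewrite mulrA.
apply: intQ_slice0; first exact: itgQD.
have [ad _ _] := fubini_slice j1; have [aD _ _] := fubini_slice j2.
apply: filterS2 (filterI ad aD) (filterI wu wv) => t [+ +] [+ +] It.
move=> /(_ It) i1 /(_ It) i2 /(_ It) wut /(_ It) wvt.
have [sui suxi _] := wut; have [svi svxi _] := wvt.
have k1 : itgI (fun x => u (x, t) * v (x, t) * derive1 phi x).
  by apply: (itg_test (a := fun x => u (x, t) * v (x, t))) => //; exact: (L2I_mul sui svi).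
have k2 : itgI (fun x => (ux (x, t) * v (x, t) + vx (x, t) * u (x, t)) * phi x).
  apply: (itg_test (a := fun x => ux (x, t) * v (x, t) + vx (x, t) * u (x, t))) => //.
  by apply: (rintegrableD mI01); [exact: (L2I_mul suxi svi)|exact: (L2I_mul svxi sui)].
have E := space_parts wut wvt tp.
transitivity (eta t * intI (fun x => u (x, t) * v (x, t) * derive1 phi x) +
   eta t * intI (fun x => (ux (x, t) * v (x, t) + vx (x, t) * u (x, t)) * phi x)).
  rewrite -intIZ// -intIZ// -intID; [|exact: (rintegrableZ mI01)..].
  by apply: eq_intI => x _; rewrite /slice /=; ring.
by rewrite E mulrN addNr.
Qed.

End WeakTimeDerivatives.

(** * Traces at the initial and final time *)

Section TimeTrace.
Context {R : realType}.
Local Notation leb := (@lebesgue_measure R).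
Implicit Types (u v w r g rho : R * R -> R) (a b : R -> R) (phi eta : R -> R) (x t : R).

(** By the lemma of Fatou the lower limit of the F n has integral 0, and it is
    the limit wherever the limit exists. *)
Lemma cvg_int0_ae (F : nat -> R -> R) : (forall n, itgI (F n)) ->
  (forall n x, I01 x -> 0 <= F n x) -> intI (F n) @[n --> \oo] --> (0 : R) ->
  {ae leb, forall x, I01 x -> forall L : R, F n x @[n --> \oo] --> L -> L = 0}.
Proof.
move=> Fi F0 IF.
have mF n : measurable_fun I01 (EFin \o F n).
  by apply/measurable_EFinP; exact: rintegrable_meas (Fi n).
have := fatou leb mI01 mF (fun n x Ix => F0 n x Ix).
have E n : (\int[leb]_(x in I01) (EFin \o F n) x)%E = (intI (F n))%:E.
  by rewrite /intI /Rintegral fineK//; exact: (integrable_fin_num mI01 (Fi n)).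
rewrite (_ : (fun n => \int[leb]_(x in I01) (EFin \o F n) x)%E = fun n => (intI (F n))%:E);
  last by apply/funext => n; exact: E.
have cE : (intI (F n))%:E @[n --> \oo] --> (0 : R)%:E.
  by apply: cvg_EFin => //; near=> n.
have [-> _] := cvg_limn_einf_sup cE.
set G := fun x => limn_einf _ => le0.
have mG : measurable_fun I01 G.
  apply: (measurableT_comp (f := -%E)) => //.
  apply: (@measurable_fun_limn_esup _ _ _ I01 (fun n x => (- (EFin \o F n) x)%E)).
  by move=> n; exact: measurableT_comp.
have G0 x : I01 x -> (0 <= G x)%E.
  move=> Ix; rewrite /G limn_einf_lim (cvg_lim _ (@cvg_einfs_sup _ _))//.
  apply: le_trans (ereal_sup_ubound _); last by exists 0%N.
  by apply: le_ereal_inf_tmp => _ [m /= nm <-]; rewrite lee_fin F0.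
have aeG : {ae leb, forall x, I01 x -> G x = 0%E}.
  have := (ae_eq_integral_abs leb mI01 mG).1.
  have -> : (\int[leb]_(x in I01) `|G x| = 0)%E.
    apply/eqP; rewrite eq_le; apply/andP; split; last exact: integral_ge0.
    apply: le_trans le0; rewrite le_eqVlt; apply/orP; left; apply/eqP.
    by apply: eq_integral => x /set_mem Ix; rewrite gee0_abs// G0.
  by move=> /(_ erefl); apply: filterS => x /= H Ix; have [] := H Ix.
apply: filterS aeG => x /[swap] Ix /(_ Ix) Gx L FL.
have cL : (F n x)%:E @[n --> \oo] --> L%:E by apply: cvg_EFin => //; near=> n.
have [E1 _] := cvg_limn_einf_sup cL.
by move: Gx; rewrite /G E1 => -[].
Unshelve. all: by end_near. Qed.

Lemma itgQ_fst a : itgI a -> itgQ (fun p : R * R => a p.1).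
Proof.
move=> ai.
have ma : measurable_fun (Q01 : set (R * R)) (fun p => a p.1).
  apply: (measurable_comp (F := I01)) => //.
  - exact: mI01.
  - by move=> _ [[x y] [/= Ix Iy] <-].
  - exact: rintegrable_meas ai.
  - by apply: measurable_funTS; exact: measurable_fst.
have [] := @tonelli_slice _ (fun p => a p.1) (fun=> intI (fun x => `|a x|)) => //.
  exact: (rintegrable_cst mI01 fin_I01).
exact: aeW.
Qed.

Lemma itgQ_snd_mul u a (M : R) : itgQ u -> measurable_fun I01 a ->
  (forall t, I01 t -> `|a t| <= M) -> itgQ (fun p => u p * a p.2).
Proof.
move=> ui ma aM.
have ma2 : measurable_fun (Q01 : set (R * R)) (fun p => a p.2).
  apply: (measurable_comp (F := I01)) => //.
  - exact: mI01.
  - by move=> _ [[x y] [/= Ix Iy] <-].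
  - by apply: measurable_funTS; exact: measurable_snd.
apply: (rintegrable_le mQ01 (g := fun z => M * `|u z|)).
- by apply: measurable_funM => //; exact: rintegrable_meas ui.
- exact: (rintegrableZ mQ01 _ (rintegrable_norm ui)).
- by move=> [x t] [_ It]; rewrite normrM mulrC ler_wpM2r// aM.
Qed.

Lemma normI_int a : L2I a -> intI (fun x => `|a x|) <= normI a.
Proof.
move=> ai; have h := sqr_intI ai.
have n0 : 0 <= intI (fun x => `|a x|) by exact: intI_ge0.
by rewrite -(ger0_norm n0) -sqrtr_sqr /normI ler_wsqrtr.
Qed.

(** Weights of mass 1 that concentrate at time t0. *)
Definition concentrates (t0 : R) (kap : nat -> R -> R) :=
  [/\ forall n, measurable_fun I01 (kap n),
      forall n, exists M, forall t, I01 t -> `|kap n t| <= M,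
      forall n t, I01 t -> 0 <= kap n t,
      forall n, intI (kap n) = 1 &
      forall n t, I01 t -> n.+1%:R^-1 < `|t - t0| -> kap n t = 0].

(** The weighted means of |u(x, t) - u(x, t0)| over times close to t0 tend to 0
    in L^1(0,1) because u is continuous in time with values in L^2. On a line
    where u is almost everywhere equal to the continuous A they tend to |A(t0)
    - u(x, t0)|, which is therefore 0 for almost every x. *)
Lemma time_trace u (t0 : R) kap : C0L2 u -> L2Q u -> 0 <= t0 <= 1 -> concentrates t0 kap ->
  {ae leb, forall x, I01 x -> forall A a, abscont A a ->
     {ae leb, forall t, I01 t -> u (x, t) = A t} -> A t0 = u (x, t0)}.
Proof.
move=> [uL uC] ui t01 [mk bk k0 k1 ks].
have t01' : t0 \in `[0, 1] by rewrite in_itv.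
have kapi n : itgI (kap n).
  have [M kM] := bk n.
  exact: (rintegrable_le mI01 (mk n) (rintegrable_cst mI01 fin_I01 M) (kM)).
have ut0 := uL _ t01'.
pose d (p : R * R) : R := `|u p - u (p.1, t0)|.
have di : itgQ d.
  have h : itgQ (fun p => u p - u (p.1, t0)).
    apply: itgQB; first exact: L2Q_itg.
    exact: (itgQ_fst (L2I_itg ut0)).
  exact: (rintegrable_norm h).
pose dn n (p : R * R) : R := d p * kap n p.2.
have dni n : itgQ (dn n).
  have [M kM] := bk n; exact: (itgQ_snd_mul di (mk n) kM).
pose F n x := intI (tslice (dn n) x).
have Fi n : itgI (F n) by have [] := fubini_tslice (dni n).
have F0 n x : I01 x -> 0 <= F n x.
  by move=> Ix; apply: intI_ge0 => t It; apply: mulr_ge0; [exact: normr_ge0|exact: k0].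
have FE n : intI (F n) = intQ (dn n) by have [_ _ ->] := fubini_tslice (dni n).
have IF : intI (F n) @[n --> \oo] --> (0 : R).
  apply/cvgr0Pnorm_le => e e0.
  have := uC _ t01' _ e0 => /nbhs_ballP[del /= del0 Hdel].
  near=> n.
  have nd : n.+1%:R^-1 < del by near: n; exact: near_infty_natSinv_lt (PosNum del0).
  rewrite ger0_norm; last by apply: intI_ge0 => x; exact: F0.
  rewrite FE; have [_ si ->] := fubini_slice (dni n).
  have ie : itgI (fun t => e * kap n t) by exact: (rintegrableZ mI01 _ (kapi n)).
  rewrite -[e]mulr1 -(k1 n) -intIZ//; apply: le_intI => //.
  apply: aeW => t It.
  have t01t : t \in `[0, 1].
    by move: It; rewrite /I01 /= !in_itv /= => /andP[/ltW -> /ltW ->].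
  have L2d : L2I (fun x => u (x, t) - u (x, t0)) by apply: L2IB; [exact: uL|exact: ut0].
  have -> : intI (slice (dn n) t) = kap n t * intI (fun x => `|u (x, t) - u (x, t0)|).
    rewrite -intIZ; last exact: (rintegrable_norm (L2I_itg L2d)).
    by apply: eq_intI => x _; rewrite /slice /dn /d /= mulrC.
  have [lt|le] := ltP (n.+1%:R^-1) `|t - t0|; first by rewrite ks// mul0r mulr0.
  rewrite mulrC ler_wpM2r ?k0// (le_trans (normI_int L2d))// ltW// Hdel//.
  by rewrite /ball /= distrC (le_lt_trans le nd).
have := cvg_int0_ae Fi F0 IF; apply: filterS => x H Ix A a Aa uA.
apply/eqP; rewrite -subr_eq0 -normr_eq0; apply/eqP; apply: (H Ix).
have [ai Ae] := Aa.
pose L := `|A t0 - u (x, t0)|; rewrite -/L.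
have mA := abscont_meas Aa.
have FxE n : F n x = intI (fun t => `|A t - u (x, t0)| * kap n t).
  apply: eq_intI_ae.
  - by apply: tslice_meas => //; exact: rintegrable_meas (dni n).
  - apply: measurable_funM => //; apply: measurableT_comp => //.
    exact: measurable_funB.
  - by apply: filterS uA => t /[apply] ut; rewrite /tslice /dn /d /= ut.
have Ai : itgI A by exact: L2I_itg (abscont_L2 Aa).
apply/cvgrPdist_le => e e0; have [del del0 Hdel] := prim_unif ai e0.
near=> n.
have nd : n.+1%:R^-1 < del by near: n; exact: near_infty_natSinv_lt (PosNum del0).
have Li : itgI (fun t => L * kap n t) by exact: (rintegrableZ mI01 _ (kapi n)).
have [M kM] := bk n.
have AKi : itgI (fun t => `|A t - u (x, t0)| * kap n t).
  have h : itgI (fun t => A t - u (x, t0)).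
    by apply: (rintegrableB mI01 Ai); exact: (rintegrable_cst mI01 fin_I01).
  exact: (itgI_bounded (mk n) kM (rintegrable_norm h)).
rewrite FxE -[L]mulr1 -(k1 n) -intIZ// -intIB//.
have Di := rintegrableB mI01 Li AKi.
apply: (le_trans (norm_intI Di)).
rewrite -[e]mulr1 -(k1 n) -intIZ//; apply: le_intI.
- exact: (rintegrable_norm Di).
- exact: (rintegrableZ mI01 _ (kapi n)).
apply: aeW => t It; rewrite -mulrBl normrM [X in _ * X]ger0_norm ?k0//.
have [lt|le] := ltP (n.+1%:R^-1) `|t - t0|; first by rewrite ks// mulr0 mulr0.
rewrite ler_wpM2r ?k0// (le_trans (ler_dist_dist _ _))//.
have -> : A t0 - u (x, t0) - (A t - u (x, t0)) = prim a t0 - prim a t.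
  rewrite [A t0]Ae// [A t]Ae; first by ring.
  by move: It; rewrite /I01 /= in_itv /= => /andP[/ltW -> /ltW ->].
by rewrite ltW// Hdel// distrC (le_lt_trans le nd).
Unshelve. all: by end_near. Qed.

Lemma prim_cst1 x : 0 <= x <= 1 -> prim (fun=> 1) x = x.
Proof.
move=> /andP[x0 x1]; rewrite /prim /intI.
transitivity (\int[leb]_(y in I01 `&` `]-oo, x[%classic) (1 : R)).
  rewrite Rintegral_mkcondr; apply: eq_Rintegral => y _.
  rewrite patchE /cut mulr1.
  have -> : (y \in `]-oo, x[%classic) = (y < x).
    by apply/idP/idP => [/set_mem|yx]; [|apply/mem_set]; rewrite /= in_itv.
  by case: (y < x).
have -> : I01 `&` `]-oo, x[%classic = `]0, x[%classic.
  apply/seteqP; split => y; rewrite /I01 /= !in_itv /=; first by move=> [/andP[-> _] ->].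
  by move=> /andP[-> yx]; rewrite (lt_le_trans yx x1).
rewrite Rintegral_cst; last exact: measurable_itv.
suff E : leb `]0, x[%classic = x%:E by rewrite mul1r; apply: (congr1 fine E).
rewrite lebesgue_measure_itv /= lte_fin; case: ltP => [_|x0'].
  by rewrite oppr0 adde0.
by congr EFin; apply/eqP; rewrite eq_le x0 x0'.
Qed.

Lemma cst1_itg : itgI (fun _ : R => 1 : R).
Proof. exact: (rintegrable_cst mI01 fin_I01). Qed.

Lemma int_ltl x : 0 <= x <= 1 -> intI (fun t => (t < x)%R%:R) = x.
Proof.
by move=> x01; rewrite -[RHS]prim_cst1//; apply: eq_intI => t _; rewrite /cut mulr1.
Qed.

Lemma ltl_itg x : itgI (fun t => (t < x)%R%:R : R).
Proof.
have := cut_itg x cst1_itg; congr (is_true (itgI _)).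
by apply/funext => t; rewrite /cut mulr1.
Qed.

Lemma concentrates0 : concentrates 0 (fun n t => n.+1%:R * (t < n.+1%:R^-1)%R%:R).
Proof.
have n0 n : 0 < n.+1%:R :> R by rewrite ltr0n.
have c01 n : 0 <= (n.+1%:R^-1 : R) <= 1.
  by rewrite invr_ge0 ler0n /= invf_le1// ler1n.
split => n.
- by apply: measurable_funM => //; exact: meas_ltl.
- exists n.+1%:R => t _; rewrite ger0_norm; last by rewrite mulr_ge0.
  by rewrite ler_piMr//; case: (t < _).
- by move=> t _; rewrite mulr_ge0.
- by rewrite intIZ ?int_ltl//; [rewrite divff// gt_eqF|exact: ltl_itg].
- move=> t; rewrite /I01 /= in_itv /= => /andP[t0 _].
  by rewrite subr0 gtr0_norm// => lt; rewrite ltNge (ltW lt) mulr0.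
Qed.

(** The weight is written with the indicator of the complementary interval,
    whose integral is already known. *)
Lemma concentrates1 : concentrates 1 (fun n t => n.+1%:R * (1 - (t < 1 - n.+1%:R^-1)%R%:R)).
Proof.
have n0 n : 0 < n.+1%:R :> R by rewrite ltr0n.
have c01 n : 0 <= 1 - (n.+1%:R^-1 : R) <= 1.
  by rewrite subr_ge0 invf_le1// ler1n lerBlDr lerDl invr_ge0 ler0n.
have b01 n t : 0 <= (1 - (t < 1 - n.+1%:R^-1)%R%:R : R) <= 1.
  by case: (t < _); rewrite ?subr0 ?subrr ?lexx ?ler01.
split => n.
- by apply: measurable_funM => //; apply: measurable_funB => //; exact: meas_ltl.
- exists n.+1%:R => t _; have /andP[h0 h1] := b01 n t.
  rewrite ger0_norm; last by rewrite mulr_ge0.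
  by rewrite ler_piMr.
- by move=> t _; have /andP[h0 _] := b01 n t; rewrite mulr_ge0.
- rewrite intIZ; last exact: (rintegrableB mI01 cst1_itg (ltl_itg _)).
  rewrite intIB; [|exact: cst1_itg|exact: ltl_itg].
  by rewrite int_ltl// intI_cst subKr divff// gt_eqF.
- move=> t; rewrite /I01 /= in_itv /= => /andP[_ t1].
  rewrite distrC gtr0_norm ?subr_gt0// => lt.
  have -> : t < 1 - n.+1%:R^-1 by rewrite ltrBrDr -ltrBrDl.
  by rewrite subrr mulr0.
Qed.

End TimeTrace.

(** * Integration by parts in time *)

Section TimeParts.
Context {R : realType}.
Local Notation leb := (@lebesgue_measure R).
Implicit Types (u v w r g z rho : R * R -> R) (a b : R -> R) (phi eta : R -> R) (x t : R).

Lemma le_intI_sqrD a b : L2I a -> L2I b ->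
  intI (fun x => (a x + b x) ^+ 2) <=
  2 * intI (fun x => a x ^+ 2) + 2 * intI (fun x => b x ^+ 2).
Proof.
move=> ai bi; have i1 : itgI (fun x => 2 * a x ^+ 2) by exact: (rintegrableZ mI01 _ (L2I_sq ai)).
have i2 : itgI (fun x => 2 * b x ^+ 2) by exact: (rintegrableZ mI01 _ (L2I_sq bi)).
rewrite -intIZ; last exact: L2I_sq.
rewrite -[X in _ + X]intIZ; last exact: L2I_sq.
rewrite -intID//; apply: le_intI.
- exact: L2I_sq (L2ID ai bi).
- exact: (rintegrableD mI01).
- by apply: aeW => x _; have := sqr_ge0 (a x - b x); nra.
Qed.

Lemma intQN u : itgQ u -> intQ (fun p => - u p) = - intQ u.
Proof.
by move=> ui; rewrite -mulN1r -intQZ//; apply: eq_intQ => p _; rewrite mulN1r.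
Qed.

(** A function that is locally bounded near each point of a compact interval is
    bounded. *)
Lemma C0L2_bounded u : C0L2 u -> exists S : R, forall t, 0 <= t <= 1 ->
  intI (fun x => u (x, t) ^+ 2) <= S.
Proof.
move=> [uL uC].
have K := (compact_near_coveringP _).1 (@segment_compact R 0 1).
pose P M t := t \in `[0, 1] -> intI (fun x => u (x, t) ^+ 2) <= M.
have cov : forall t, `[0, 1]%classic t -> \forall t' \near t & M \near +oo, P M t'.
  move=> t0 t01; have t01' : t0 \in `[0, 1] by [].
  have u0 := uL _ t01'.
  near=> t M.
  have h1 : t \in `[0, 1] -> normI (fun x => u (x, t) - u (x, t0)) < 1.
    by near: t; exact: uC.
  have h2 : 2 * 1 + 2 * intI (fun x => u (x, t0) ^+ 2) <= M.
    by near: M; apply: nbhs_pinfty_ge; exact: num_real.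
  move=> /= tM; have ut := uL _ tM; have dL := L2IB ut u0.
  apply: le_trans h2; apply: (le_trans (y := 2 * intI (fun x => (u (x, t) - u (x, t0)) ^+ 2)
      + 2 * intI (fun x => u (x, t0) ^+ 2))).
    rewrite (_ : (fun x => u (x, t) ^+ 2) = fun x => ((u (x, t) - u (x, t0)) + u (x, t0)) ^+ 2).
      exact: le_intI_sqrD.
    by apply/funext => x; rewrite subrK.
  rewrite lerD2r ler_wpM2l//.
  have i0 : 0 <= intI (fun x => (u (x, t) - u (x, t0)) ^+ 2).
    by apply: intI_ge0 => x _; exact: sqr_ge0.
  rewrite -(sqr_sqrtr i0) -[1](expr1n _ 2) ler_sqr ?nnegrE ?sqrtr_ge0//.
  exact: ltW (h1 tM).
have H := K R (pinfty_nbhs R) P _ cov.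
near (pinfty_nbhs R) => M.
exists M => t t01; have t01' : t \in `[0, 1] by rewrite in_itv.
have : `[0, 1]%classic `<=` P M by near: M; exact: H.
exact.
Unshelve. all: by end_near. Qed.

Lemma LinfL2_C0L2 u : C0L2 u -> L2Q u -> exists S, LinfL2 S u.
Proof.
move=> uC [mu _]; have [S HS] := C0L2_bounded uC.
exists S; split => //; apply: aeW => t It; split.
  apply: uC.1; move: It; rewrite /I01 /= !in_itv /= => /andP[/ltW -> /ltW ->] //.
by apply: HS; move: It; rewrite /I01 /= !in_itv /= => /andP[/ltW -> /ltW ->].
Qed.

(** The two integrands add up to the derivative of z v rho, and v vanishes at
    both ends. *)
Lemma triple_parts z zx rho rhox v vx t :
  weak_deriv (slice z t) (slice zx t) -> weak_deriv (slice rho t) (slice rhox t) ->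
  weak_deriv (slice v t) (slice vx t) -> H10 (slice v t) ->
  itgI (slice (fun p => (zx p * v p + vx p * z p) * rho p) t) ->
  itgI (slice (fun p => z p * rhox p * v p) t) ->
  intI (slice (fun p => (zx p * v p + vx p * z p) * rho p) t) +
  intI (slice (fun p => z p * rhox p * v p) t) = 0.
Proof.
move=> wz wr wv Hv i1 i2.
have [A [Azx zA]] := weak_deriv_abscont wz; have [B [Bzx rB]] := weak_deriv_abscont wr.
have [V [Vvx vV V0 V1]] := H10_abscont Hv wv.
have AVB := abscontM (abscontM Azx Vvx) Bzx.
have := abscont_int AVB; rewrite V0 V1 !mulr0 !mul0r subr0 => <-.
rewrite -intID//; apply: intI_ae_itg; [exact: (rintegrableD mI01)|exact: AVB.1|].
apply: filterS3 zA rB vV => x + + + Ix => /(_ Ix) + /(_ Ix) + /(_ Ix).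
by rewrite /slice => -> -> ->; ring.
Qed.

(** Along almost every line x = const, z and rho are absolutely continuous in
    time with derivatives Z = - (z v_i)_x and W = z_j - rho_x v_j. The product
    rule on these lines, integrated over x, leaves the integral of Z rho + W z,
    and the x-derivative in Z is moved onto rho by [triple_parts]. The
    velocities v_i, v_j are unrelated: z and rho may come from different
    geodesics. *)
Lemma time_parts z zx rho rhox zj vi vix vixx vj vjx :
  C0L2 z -> L2Q z -> is_Dx z zx -> C0L2 rho -> L2Q rho -> is_Dx rho rhox -> L2Q zj ->
  L2Q vi -> is_Dx vi vix -> is_Dx vix vixx ->
  {ae leb, forall t, I01 t -> H10 (slice vi t)} ->
  L2Q vj -> is_Dx vj vjx ->
  (forall phi eta, test_function I01 phi -> test_function I01 eta ->
    intQ (fun p => z p * (phi p.1 * derive1 eta p.2)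
                   + z p * vi p * (derive1 phi p.1 * eta p.2)) = 0) ->
  (forall phi eta, test_function I01 phi -> test_function I01 eta ->
    intQ (fun p => rho p * (phi p.1 * derive1 eta p.2)
                   + rho p * (vjx p * (phi p.1 * eta p.2) + vj p * (derive1 phi p.1 * eta p.2))
                   + zj p * (phi p.1 * eta p.2)) = 0) ->
  intI (fun x => z (x, 1) * rho (x, 1)) - intI (fun x => z (x, 0) * rho (x, 0)) =
  intQ (fun p => z p * rhox p * vi p) + intQ (fun p => z p * zj p)
  - intQ (fun p => z p * rhox p * vj p).
Proof.
move=> zC zi Dz rC ri Dr zji vii Dvi Dvix Hvi vji Dvj cons trans.
have [zxi wz] := Dz; have [rxi wr] := Dr; have [vixi wv] := Dvi; have [vjxi _] := Dvj.
have [S zS] := LinfL2_C0L2 zC zi; have [S' rS] := LinfL2_C0L2 rC ri.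
pose Z p := - (zx p * vi p + vix p * z p).
pose W p := zj p - rhox p * vj p.
have Zi : itgQ Z by apply: itgQN; apply: itgQD; exact: L2Q_mul.
have Wi : itgQ W by apply: itgQB; [exact: L2Q_itg|exact: L2Q_mul].
have zZ : forall phi eta, test_function I01 phi -> test_function I01 eta ->
    intQ (fun p => z p * (phi p.1 * derive1 eta p.2) + Z p * (phi p.1 * eta p.2)) = 0.
  move=> phi eta tp te; have td := test_derive1 te; have tdp := test_derive1 tp.
  have j1 : itgQ (fun p => z p * (phi p.1 * derive1 eta p.2)).
    apply: eq_itgQ (itgQ_test2 (itgQ_test1 (L2Q_itg zi) tp) td) => p; exact: esym (mulrA _ _ _).
  have j2 : itgQ (fun p => z p * vi p * (derive1 phi p.1 * eta p.2)).
    apply: eq_itgQ (itgQ_test2 (itgQ_test1 (L2Q_mul zi vii) tdp) te) => p; exact: esym (mulrA _ _ _).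
  have j3 : itgQ (fun p => Z p * (phi p.1 * eta p.2)).
    apply: eq_itgQ (itgQ_test2 (itgQ_test1 Zi tp) te) => p; exact: esym (mulrA _ _ _).
  have j4 : itgQ (fun p => (zx p * vi p + vix p * z p) * (phi p.1 * eta p.2)).
    apply: eq_itgQ (itgQN j3) => p; rewrite /Z; ring.
  rewrite intQD// -[RHS](cons _ _ tp te) intQD// (space_parts_Q zi vii Dz Dvi tp te).
  by congr (_ + _); rewrite -intQN//; apply: eq_intQ => p _; rewrite /Z; ring.
have rW : forall phi eta, test_function I01 phi -> test_function I01 eta ->
    intQ (fun p => rho p * (phi p.1 * derive1 eta p.2) + W p * (phi p.1 * eta p.2)) = 0.
  move=> phi eta tp te; have td := test_derive1 te; have tdp := test_derive1 tp.
  have j2 : itgQ (fun p => rho p * vj p * (derive1 phi p.1 * eta p.2)).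
    apply: eq_itgQ (itgQ_test2 (itgQ_test1 (L2Q_mul ri vji) tdp) te) => p; exact: esym (mulrA _ _ _).
  have D := itgQD (L2Q_mul rxi vji) (L2Q_mul vjxi ri).
  have j4 : itgQ (fun p => (rhox p * vj p + vjx p * rho p) * (phi p.1 * eta p.2)).
    apply: eq_itgQ (itgQ_test2 (itgQ_test1 D tp) te) => p; exact: esym (mulrA _ _ _).
  have j1 : itgQ (fun p => rho p * (phi p.1 * derive1 eta p.2)).
    apply: eq_itgQ (itgQ_test2 (itgQ_test1 (L2Q_itg ri) tp) td) => p; exact: esym (mulrA _ _ _).
  have j3 : itgQ (fun p => W p * (phi p.1 * eta p.2)).
    apply: eq_itgQ (itgQ_test2 (itgQ_test1 Wi tp) te) => p; exact: esym (mulrA _ _ _).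
  pose X p := rho p * (phi p.1 * derive1 eta p.2) + W p * (phi p.1 * eta p.2)
    + (rhox p * vj p + vjx p * rho p) * (phi p.1 * eta p.2).
  have iX : itgQ X by apply: itgQD => //; exact: itgQD.
  have := trans _ _ tp te.
  rewrite (_ : intQ _ = intQ (fun p => X p + rho p * vj p * (derive1 phi p.1 * eta p.2))).
    rewrite intQD// (space_parts_Q ri vji Dr Dvj tp te) => <-.
    rewrite -[X in X = _](addrK (intQ (fun p => (rhox p * vj p + vjx p * rho p) * (phi p.1 * eta p.2)))).
    by rewrite -intQD//; exact: itgQD.
  by apply: eq_intQ => p _; rewrite /X /W; ring.
have [zxv _] := triple_Q ltr01 rS zxi vii Dvi.
have [zrv _] := triple_Q ltr01 zS ri vixi Dvix.
have vixi' := Dvix.1.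
have [zrxvi _] := triple_Q ltr01 zS rxi vii Dvi.
have [zrxvj _] := triple_Q ltr01 zS rxi vji Dvj.
have Zr : itgQ (fun p => (zx p * vi p + vix p * z p) * rho p).
  apply: eq_itgQ (itgQD zxv zrv) => p; ring.
have Wz : itgQ (fun p => z p * zj p - z p * rhox p * vj p).
  by apply: itgQB => //; exact: L2Q_mul.
have tot : itgQ (fun p => Z p * rho p + W p * z p).
  apply: eq_itgQ (itgQD (itgQN Zr) Wz) => p; rewrite /Z /W; ring.
have [_ si sE] := fubini_tslice tot.
have L01 (t : R) : 0 <= t <= 1 -> itgI (fun x => z (x, t) * rho (x, t)).
  by move=> t01; apply: L2I_mul; [apply: zC.1|apply: rC.1]; rewrite in_itv.
have x0 : 0 <= (0 : R) <= 1 by rewrite lexx ler01.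
have x1 : 0 <= (1 : R) <= 1 by rewrite lexx ler01.
transitivity (intQ (fun p => Z p * rho p + W p * z p)).
  rewrite sE -intIB; [|exact: L01..].
  apply: intI_ae_itg => //; first exact: (rintegrableB mI01 (L01 _ x1) (L01 _ x0)).
  have zA := time_abscont (L2Q_itg zi) Zi zZ; have rB := time_abscont (L2Q_itg ri) Wi rW.
  have z0 := time_trace zC zi x0 (@concentrates0 R).
  have z1 := time_trace zC zi x1 (@concentrates1 R).
  have r0 := time_trace rC ri x0 (@concentrates0 R).
  have r1 := time_trace rC ri x1 (@concentrates1 R).
  apply: filterS3 (filterI zA rB) (filterI z0 z1) (filterI r0 r1) => x.
  move=> [+ +] [+ +] [+ +] Ix => /(_ Ix) [A [AZ zA']] /(_ Ix) [B [BW rB']].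
  move=> /(_ Ix _ _ AZ zA') <- /(_ Ix _ _ AZ zA') <-.
  move=> /(_ Ix _ _ BW rB') <- /(_ Ix _ _ BW rB') <-.
  have AB := abscontM AZ BW; rewrite -(abscont_int AB).
  apply: eq_intI_ae; [exact: rintegrable_meas AB.1| |].
    by apply: tslice_meas => //; exact: rintegrable_meas tot.
  apply: filterS2 zA' rB' => t + + It => /(_ It) zt /(_ It) rt.
  by rewrite /tslice zt rt.
have E : intQ (fun p => (zx p * vi p + vix p * z p) * rho p) = - intQ (fun p => z p * rhox p * vi p).
  apply/eqP; rewrite -addr_eq0 -intQD//; apply/eqP.
  apply: intQ_slice0; first exact: itgQD.
  have [a1 _ _] := fubini_slice Zr; have [a2 _ _] := fubini_slice zrxvi.
  apply: filterS3 (filterI wz wr) (filterI wv Hvi) (filterI a1 a2) => t.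
  move=> [+ +] [+ +] [+ +] It => /(_ It) wzt /(_ It) wrt /(_ It) wvt /(_ It) Ht /(_ It) i1 /(_ It) i2.
  by rewrite -(triple_parts wzt wrt wvt Ht i1 i2) -intID.
have -> : intQ (fun p => Z p * rho p + W p * z p) =
    intQ (fun p => - ((zx p * vi p + vix p * z p) * rho p) + (z p * zj p - z p * rhox p * vj p)).
  by apply: eq_intQ => p _; rewrite /Z /W; ring.
rewrite intQD//; last exact: itgQN.
rewrite intQN// E opprK intQB//; last exact: L2Q_mul.
by rewrite addrA.
Qed.

End TimeParts.

(** * The exact energy identity between two geodesics *)

Section EnergyIdentity.
Context {R : realType}.
Local Notation leb := (@lebesgue_measure R).
Variables kappa lambda eps : R.

(** The Euler-Lagrange system tested with products phi(x) eta(t). The weak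
    derivatives are named instead of chosen by [Dx], since each of them may be
    replaced by any other weak derivative. *)
Record el_solution (rho rx v vx vxx z zx : R * R -> R) : Prop := ElSolution {
  el_rhoC : C0L2 rho; el_rhoL : L2Q rho; el_rhoD : is_Dx rho rx;
  el_zC : C0L2 z; el_zL : L2Q z; el_zD : is_Dx z zx;
  el_vL : L2Q v; el_vD : is_Dx v vx; el_vDD : is_Dx vx vxx;
  el_vH : {ae leb, forall t, I01 t -> H10 (slice v t)};
  el_vxxH : {ae leb, forall t, I01 t -> H10 (slice vxx t)};
  el_elliptic : forall phi eta, test_function I01 phi -> test_function I01 eta ->
     intQ (fun p => eps * vxx p * (derive1 (derive1 phi) p.1 * eta p.2)
       + lambda * vx p * (derive1 phi p.1 * eta p.2) + kappa * v p * (phi p.1 * eta p.2)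
       + z p * rx p * (phi p.1 * eta p.2)) = 0;
  el_conservation : forall phi eta, test_function I01 phi -> test_function I01 eta ->
    intQ (fun p => z p * (phi p.1 * derive1 eta p.2)
                   + z p * v p * (derive1 phi p.1 * eta p.2)) = 0;
  el_transport : forall phi eta, test_function I01 phi -> test_function I01 eta ->
    intQ (fun p => rho p * (phi p.1 * derive1 eta p.2)
                   + rho p * (vx p * (phi p.1 * eta p.2) + v p * (derive1 phi p.1 * eta p.2))
                   + z p * (phi p.1 * eta p.2)) = 0 }.

Lemma euler_lagrange_solution rho0 rho1 rho v z :
  euler_lagrange kappa lambda eps rho0 rho1 rho v z ->
  el_solution rho (Dx rho) v (Dx v) (Dx (Dx v)) z (Dx z).
Proof.
move=> [[[rC r1] [v1 vx1 vH] [zC z1]] [ell vxxH] cons trans _].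
have [ri rxi rD] := DxP r1; have [zi zxi zD] := DxP z1.
have [vi vxi vD] := DxP v1; have [_ _ vxD] := DxP vx1.
split => //.
- move=> phi eta tp te; rewrite -[RHS](ell _ (test_tensor tp te)).
  rewrite (tensor_dx tp.1 te.1) (tensor_dx (test_derive1 tp).1 te.1).
  by apply: eq_intQ => p _; rewrite -!addrA; congr (_ + _).
- move=> phi eta tp te; rewrite -[RHS](cons _ (test_tensor tp te)).
  by rewrite (tensor_dx tp.1 te.1) (tensor_dt tp.1 te.1).
- move=> phi eta tp te; rewrite -[RHS](trans _ (test_tensor tp te)).
  by rewrite (tensor_dx tp.1 te.1) (tensor_dt tp.1 te.1).
Qed.

Definition energy (v vx vxx z : R * R -> R) : R :=
  2^-1 * intQ (fun p => kappa * v p ^+ 2 + lambda * vx p ^+ 2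
                        + eps * vxx p ^+ 2 + z p ^+ 2).

Definition trilinear (p q r : R * R -> R) : R := intQ (fun w => p w * q w * r w).

Lemma el_work rho rx v vx vxx z zx g gx gxx :
  el_solution rho rx v vx vxx z zx ->
  L2Q g -> is_Dx g gx -> is_Dx gx gxx -> {ae leb, forall t, I01 t -> H10 (slice g t)} ->
  intQ (fun p => eps * (vxx p * gxx p) + lambda * (vx p * gx p)
     + kappa * (v p * g p)) = - trilinear z rx g.
Proof.
move=> [rC ri rD zC zi zD vi vD vDD vH vxxH ell _ _] gi gD gDD gH.
have [S zS] := LinfL2_C0L2 zC zi.
exact: (elliptic_tested vi vD vDD vxxH zi zS rD.1 gi gD gDD gH ell).
Qed.

(** The quadratic part in v of the energy is the work of the elliptic equation
    on its own solution. *)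
Lemma el_energy rho rx v vx vxx z zx : el_solution rho rx v vx vxx z zx ->
  energy v vx vxx z = 2^-1 * (intQ (fun p => z p * z p) - trilinear z rx v).
Proof.
move=> el; have E := el_work el (el_vL el) (el_vD el) (el_vDD el) (el_vH el).
rewrite addrC -E /energy; congr (_ * _).
have [vi vxi vxxi zi] : [/\ L2Q v, L2Q vx, L2Q vxx & L2Q z].
  by split; [exact: el_vL el|exact: (el_vD el).1|exact: (el_vDD el).1|exact: el_zL el].
rewrite -intQD; [|by apply: itgQD; [apply: itgQD|]; apply: itgQZ; exact: L2Q_mul
  |exact: L2Q_mul].
by apply: eq_intQ => p _; ring.
Qed.

Lemma el_time rho rx v vx vxx z zx rho' rx' v' vx' vxx' z' zx' :
  el_solution rho rx v vx vxx z zx -> el_solution rho' rx' v' vx' vxx' z' zx' ->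
  intI (fun x => z (x, 1) * rho' (x, 1)) - intI (fun x => z (x, 0) * rho' (x, 0)) =
  trilinear z rx' v + intQ (fun p => z p * z' p) - trilinear z rx' v'.
Proof.
move=> e e'; apply: (time_parts (el_zC e) (el_zL e) (el_zD e) (el_rhoC e') (el_rhoL e')
  (el_rhoD e') (el_zL e') (el_vL e) (el_vD e) (el_vDD e) (el_vH e) (el_vL e') (el_vD e')
  (el_conservation e) (el_transport e')).
Qed.

Lemma trilinear_itg (z rx v vx : R * R -> R) : C0L2 z -> L2Q z -> L2Q rx -> L2Q v -> is_Dx v vx ->
  itgQ (fun w => z w * rx w * v w).
Proof.
move=> zC zi rxi vi vD; have [S zS] := LinfL2_C0L2 zC zi.
by have [] := triple_Q ltr01 zS rxi vi vD.
Qed.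

(** [el_time] for the four pairs of solutions expresses the differences of <z,
    z> by b and values of T, and [el_work] does the same for B. The values of T
    with mixed arguments cancel by the symmetry of B and of <.,.>, up to those
    that make up T on the increments. *)
Lemma energy_identity rho rx v vx vxx z zx rho' rx' v' vx' vxx' z' zx' :
  el_solution rho rx v vx vxx z zx -> el_solution rho' rx' v' vx' vxx' z' zx' ->
  let b t := intI (fun x => (z' (x, t) + z (x, t)) * (rho' (x, t) - rho (x, t))) in
  energy v' vx' vxx' z' - energy v vx vxx z = 2^-1 * (b 1 - b 0)
    - 2^-1 * trilinear (fun p => z' p - z p) (fun p => rx' p - rx p) (fun p => v' p - v p).
Proof.
move=> e e' b.
have bE t : 0 <= t <= 1 -> b t =
    intI (fun x => z' (x, t) * rho' (x, t)) - intI (fun x => z' (x, t) * rho (x, t))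
    + intI (fun x => z (x, t) * rho' (x, t)) - intI (fun x => z (x, t) * rho (x, t)).
  move=> t01; have t01' : t \in `[0, 1] by rewrite in_itv.
  have zi := (el_zC e).1 _ t01'; have zi' := (el_zC e').1 _ t01'.
  have ri := (el_rhoC e).1 _ t01'; have ri' := (el_rhoC e').1 _ t01'.
  have i1 : itgI (fun x => z' (x, t) * rho' (x, t)) by exact: L2I_mul.
  have i2 : itgI (fun x => z' (x, t) * rho (x, t)) by exact: L2I_mul.
  have i3 : itgI (fun x => z (x, t) * rho' (x, t)) by exact: L2I_mul.
  have i4 : itgI (fun x => z (x, t) * rho (x, t)) by exact: L2I_mul.
  rewrite -intIB// -intID//; last exact: (rintegrableB mI01).
  rewrite -intIB//; last by apply: (rintegrableD mI01) => //; exact: (rintegrableB mI01).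
  by apply: eq_intI => x _; ring.
have T8 : trilinear (fun p => z' p - z p) (fun p => rx' p - rx p) (fun p => v' p - v p) =
    (trilinear z' rx' v' - trilinear z rx' v') - (trilinear z' rx v' - trilinear z rx v')
    - ((trilinear z' rx' v - trilinear z rx' v) - (trilinear z' rx v - trilinear z rx v)).
  have ii u w h hx (uC : C0L2 u) (uL : L2Q u) (wL : L2Q w) (hL : L2Q h) (hD : is_Dx h hx) :
    itgQ (fun q => u q * w q * h q) := trilinear_itg uC uL wL hL hD.
  have [zC zL zC' zL'] : [/\ C0L2 z, L2Q z, C0L2 z' & L2Q z'] by split; [exact: el_zC e|exact: el_zL e|exact: el_zC e'|exact: el_zL e'].
  have rL := (el_rhoD e).1; have rL' := (el_rhoD e').1.
  have vL := el_vL e; have vL' := el_vL e'; have vD := el_vD e; have vD' := el_vD e'.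
  have j1 := ii _ _ _ _ zC' zL' rL' vL' vD'; have j2 := ii _ _ _ _ zC zL rL' vL' vD'.
  have j3 := ii _ _ _ _ zC' zL' rL vL' vD'; have j4 := ii _ _ _ _ zC zL rL vL' vD'.
  have j5 := ii _ _ _ _ zC' zL' rL' vL vD; have j6 := ii _ _ _ _ zC zL rL' vL vD.
  have j7 := ii _ _ _ _ zC' zL' rL vL vD; have j8 := ii _ _ _ _ zC zL rL vL vD.
  have k1 := itgQB j1 j2; have k2 := itgQB j3 j4; have k3 := itgQB j5 j6; have k4 := itgQB j7 j8.
  have l1 := itgQB k1 k2; have l2 := itgQB k3 k4.
  rewrite /trilinear -(intQB j1 j2) -(intQB j3 j4) -(intQB j5 j6) -(intQB j7 j8).
  rewrite -(intQB k1 k2) -(intQB k3 k4) -(intQB l1 l2).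
  by apply: eq_intQ => p _; ring.
have w1 := el_work e (el_vL e') (el_vD e') (el_vDD e') (el_vH e').
have w2 := el_work e' (el_vL e) (el_vD e) (el_vDD e) (el_vH e).
(* the symmetry of the bilinear form B *)
have W : trilinear z rx v' = trilinear z' rx' v.
  apply: oppr_inj; rewrite -w1 -w2; apply: eq_intQ => p _; ring.
have zz : intQ (fun p => z p * z' p) = intQ (fun p => z' p * z p).
  by apply: eq_intQ => p _; rewrite mulrC.
have t00 := el_time e e; have t01 := el_time e e'.
have t10 := el_time e' e; have t11 := el_time e' e'.
rewrite (el_energy e) (el_energy e') T8 !bE ?lexx ?ler01//.
move: t00 t01 t10 t11; rewrite zz W.
lra.
Qed.

End EnergyIdentity.

(** * Consequences of the second-order expansions *)

Section Expansions.
Context {R : realType}.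
Local Notation leb := (@lebesgue_measure R).
Implicit Types (u v w g h rho : R * R -> R) (a b : R -> R) (s t x : R).

(** Where there is no weak derivative, [Dx] is the zero function. *)
Lemma Dx_L2Q u : L2Q (Dx u).
Proof.
rewrite /Dx; case: xgetP => [g _ [gi _] //|_].
split; first exact: measurable_cst.
rewrite (_ : (fun _ => _) = fun=> 0%:E); first exact: integrable0.
by apply/funext => p; rewrite expr0n.
Qed.

Lemma le_intQ_sqrD u v : L2Q u -> L2Q v ->
  intQ (fun p => (u p + v p) ^+ 2) <=
  2 * intQ (fun p => u p ^+ 2) + 2 * intQ (fun p => v p ^+ 2).
Proof.
move=> ui vi; have i1 := itgQZ 2 (L2Q_sq ui); have i2 := itgQZ 2 (L2Q_sq vi).
rewrite -intQZ; last exact: L2Q_sq.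
rewrite -[X in _ + X]intQZ; last exact: L2Q_sq.
rewrite -intQD//; apply: le_intQ.
- exact: L2Q_sq (L2QD ui vi).
- exact: itgQD.
- by move=> p _; have := sqr_ge0 (u p - v p); nra.
Qed.

Lemma intQ_sqrZ (c : R) u : L2Q u ->
  intQ (fun p => (c * u p) ^+ 2) = c ^+ 2 * intQ (fun p => u p ^+ 2).
Proof.
move=> ui; rewrite -intQZ; last exact: L2Q_sq.
by apply: eq_intQ => p _; rewrite exprMn.
Qed.

Lemma intI_sqrZ (c : R) a : L2I a ->
  intI (fun x => (c * a x) ^+ 2) = c ^+ 2 * intI (fun x => a x ^+ 2).
Proof.
move=> ai; rewrite -intIZ; last exact: L2I_sq.
by apply: eq_intI => x _; rewrite exprMn.
Qed.

(** The part of the norm of H^1 in space that the remainder estimate uses. *)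
Definition controlsQ (N : (R * R -> R) -> R) := forall u, L2H1 u ->
  [/\ 0 <= N u, intQ (fun p => u p ^+ 2) <= N u ^+ 2
    & intQ (fun p => Dx u p ^+ 2) <= N u ^+ 2].

Lemma le_sqr_sqrt (a b c : R) : 0 <= a -> 0 <= b -> 0 <= c -> a <= b ->
   a <= (c + Num.sqrt b) ^+ 2.
Proof.
move=> a0 b0 c0 ab; apply: (le_trans ab).
rewrite -{1}(sqr_sqrtr b0) ler_sqr ?nnegrE ?addr_ge0 ?sqrtr_ge0//.
by rewrite lerDr.
Qed.

Lemma norm_L2H2_controlsQ : controlsQ norm_L2H2.
Proof.
move=> u u1; have [ui uxi _] := DxP u1; have uxxi := Dx_L2Q (Dx u).
rewrite /norm_L2H2; split; first exact: sqrtr_ge0.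
- rewrite -[Num.sqrt _]add0r; apply: le_sqr_sqrt => //.
  + by apply: intQ_ge0 => p _; exact: sqr_ge0.
  + by apply: intQ_ge0 => p _; rewrite !addr_ge0 ?sqr_ge0.
  + apply: le_intQ; first exact: L2Q_sq.
      by apply: itgQD; [apply: itgQD|]; exact: L2Q_sq.
    by move=> p _; rewrite -addrA lerDl addr_ge0 ?sqr_ge0.
- rewrite -[Num.sqrt _]add0r; apply: le_sqr_sqrt => //.
  + by apply: intQ_ge0 => p _; exact: sqr_ge0.
  + by apply: intQ_ge0 => p _; rewrite !addr_ge0 ?sqr_ge0.
  + apply: le_intQ; first exact: L2Q_sq.
      by apply: itgQD; [apply: itgQD|]; exact: L2Q_sq.
    by move=> p _; rewrite [_ + Dx u p ^+ 2]addrC -addrA lerDl addr_ge0 ?sqr_ge0.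
Qed.

(** The supremum is that of a bounded set because u is bounded in time. *)
Lemma C0L2_sup u t : C0L2 u -> 0 <= t <= 1 ->
  normI (slice u t) <= sup [set normI (slice u t) | t in `[0, 1]].
Proof.
move=> uC t01; have [S HS] := C0L2_bounded uC.
apply: ub_le_sup; last by exists t => //=; rewrite in_itv.
exists (Num.sqrt S) => _ [t' /= + <-]; rewrite in_itv /= => t'01.
by rewrite /normI ler_wsqrtr// HS.
Qed.

Lemma norm_C0L2_controlsQ u : C0L2_L2H1 u ->
  [/\ 0 <= norm_C0L2_L2H1 u, intQ (fun p => Dx u p ^+ 2) <= norm_C0L2_L2H1 u ^+ 2
    & forall t, 0 <= t <= 1 -> intI (fun x => u (x, t) ^+ 2) <= norm_C0L2_L2H1 u ^+ 2].
Proof.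
move=> [uC u1]; have [ui uxi _] := DxP u1; rewrite /norm_C0L2_L2H1.
set S := sup _; set D := Num.sqrt _.
have D0 : 0 <= D by exact: sqrtr_ge0.
have uS t : 0 <= t <= 1 -> normI (slice u t) <= S by move=> t01; exact: C0L2_sup.
have S0 : 0 <= S.
  by apply: le_trans (uS 0 _); [exact: sqrtr_ge0|rewrite lexx ler01].
split; first exact: addr_ge0.
- apply: le_sqr_sqrt => //.
  + by apply: intQ_ge0 => p _; exact: sqr_ge0.
  + by apply: intQ_ge0 => p _; rewrite addr_ge0 ?sqr_ge0.
  + apply: le_intQ; first exact: L2Q_sq.
      by apply: itgQD; exact: L2Q_sq.
    by move=> p _; rewrite lerDr sqr_ge0.
- move=> t t01.
  have i0 : 0 <= intI (fun x => u (x, t) ^+ 2) by apply: intI_ge0 => x _; exact: sqr_ge0.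
  rewrite -(sqr_sqrtr i0) ler_sqr ?nnegrE ?sqrtr_ge0 ?addr_ge0//.
  by apply: (le_trans (uS t t01)); rewrite lerDl.
Qed.

Lemma normI_lt a (e : R) : 0 < e -> (normI a < e) = (intI (fun x => a x ^+ 2) < e ^+ 2).
Proof.
move=> e0; have i0 : 0 <= intI (fun x => a x ^+ 2) by apply: intI_ge0 => x _; exact: sqr_ge0.
by rewrite -[in RHS](sqr_sqrtr i0) ltr_sqr ?nnegrE ?sqrtr_ge0 ?(ltW e0).
Qed.

Lemma C0L2_lin (c : R) u v : C0L2 u -> C0L2 v -> C0L2 (fun p => c * u p + v p).
Proof.
move=> [uL uC] [vL vC]; split => [t t01|t t01 e e0].
  by apply: L2ID; [apply: L2IZ; exact: uL|exact: vL].
pose k := `|c| + 1; have k0 : 0 < k by rewrite ltr_wpDl.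
(* chosen so that 2 (c^2 + 1) d^2 <= 4 k^2 d^2 = e^2 *)
pose d := e / (2 * k); have d0 : 0 < d by rewrite divr_gt0// mulr_gt0.
apply: filterS2 (uC t t01 d d0) (vC t t01 d d0) => t' H1 H2 t'01.
move: (H1 t'01) (H2 t'01); rewrite !normI_lt// => h1 h2.
have Lu := L2IB (uL _ t'01) (uL _ t01); have Lv := L2IB (vL _ t'01) (vL _ t01).
have -> : intI (fun x => (c * u (x, t') + v (x, t') - (c * u (x, t) + v (x, t))) ^+ 2) =
    intI (fun x => (c * (u (x, t') - u (x, t)) + (v (x, t') - v (x, t))) ^+ 2).
  by apply: eq_intI => x _; ring.
apply: (le_lt_trans (le_intI_sqrD (L2IZ c Lu) Lv)); rewrite (intI_sqrZ c Lu).
have c2 : c ^+ 2 <= k ^+ 2.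
  by rewrite -(real_normK (num_real c)) ler_sqr ?nnegrE ?(ltW k0)// lerDl.
have k1 : 1 <= k ^+ 2 by rewrite expr_ge1// /k ?lerDr// ltW.
have ed : e ^+ 2 = 4 * (k ^+ 2 * d ^+ 2).
  by rewrite /d; field; rewrite gt_eqF.
rewrite ed.
have i0 : 0 <= intI (fun x => (u (x, t') - u (x, t)) ^+ 2).
  by apply: intI_ge0 => x _; exact: sqr_ge0.
set U := intI _ in h1 i0 *; set V := intI _ in h2 *.
have : c ^+ 2 * U <= k ^+ 2 * d ^+ 2.
  by apply: ler_pM => //; [exact: sqr_ge0|exact: ltW].
have : V < k ^+ 2 * d ^+ 2 by apply: (lt_le_trans h2); rewrite ler_peMl// sqr_ge0.
lra.
Qed.

Lemma L2H1_lin (c : R) u v : L2H1 u -> L2H1 v -> L2H1 (fun p => c * u p + v p).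
Proof.
move=> u1 v1; have [ui _ uD] := DxP u1; have [vi _ vD] := DxP v1.
split; first by apply: L2QD => //; exact: L2QZ.
by eexists; exact: (is_Dx_lin c uD vD).
Qed.

Lemma sq_combine_Q (s : R) u v w h : L2Q u -> L2Q v -> L2Q w -> L2Q h -> `|s| <= 1 ->
  intQ (fun p => w p ^+ 2) <= 0 -> intQ (fun p => h p ^+ 2) <= (s ^+ 2) ^+ 2 ->
  intQ (fun p => (s ^+ 2 * u p + (s * v p + (-1 * w p + h p))) ^+ 2) <=
  (2 * intQ (fun p => u p ^+ 2) + 4 * intQ (fun p => v p ^+ 2) + 8) * s ^+ 2.
Proof.
move=> ui vi wi hi s1 w0 h0.
have i1 := L2QD (L2QZ (-1) wi) hi; have i2 := L2QD (L2QZ s vi) i1.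
have e1 := le_intQ_sqrD (L2QZ (s ^+ 2) ui) i2.
have e2 := le_intQ_sqrD (L2QZ s vi) i1.
have e3 := le_intQ_sqrD (L2QZ (-1) wi) hi.
rewrite (intQ_sqrZ (s ^+ 2) ui) in e1; rewrite (intQ_sqrZ s vi) in e2.
rewrite (intQ_sqrZ (-1) wi) in e3.
have U0 : 0 <= intQ (fun p => u p ^+ 2) by apply: intQ_ge0 => p _; exact: sqr_ge0.
have s2 : s ^+ 2 <= 1 by rewrite -(real_normK (num_real s)) expr_le1.
have s20 : 0 <= s ^+ 2 by exact: sqr_ge0.
have s4 : (s ^+ 2) ^+ 2 <= s ^+ 2 by rewrite expr2 ler_piMr.
have s4U : (s ^+ 2) ^+ 2 * intQ (fun p => u p ^+ 2) <= s ^+ 2 * intQ (fun p => u p ^+ 2).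
  by rewrite ler_wpM2r.
move: e1 e2 e3 w0 h0 U0 s4U.
move: (intQ (fun p => (s ^+ 2 * u p + _) ^+ 2)) (intQ (fun p => (s * v p + _) ^+ 2)).
move: (intQ (fun p => (-1 * w p + _) ^+ 2)).
move: (intQ (fun p => u p ^+ 2)) (intQ (fun p => v p ^+ 2)) (intQ (fun p => w p ^+ 2)) (intQ (fun p => h p ^+ 2)).
move=> U V W H X Y Z *; nra.
Qed.

Lemma sq_combine_I (s : R) a b (c d : R -> R) : L2I a -> L2I b -> L2I c -> L2I d -> `|s| <= 1 ->
  intI (fun p => c p ^+ 2) <= 0 -> intI (fun p => d p ^+ 2) <= (s ^+ 2) ^+ 2 ->
  intI (fun p => (s ^+ 2 * a p + (s * b p + (-1 * c p + d p))) ^+ 2) <=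
  (2 * intI (fun p => a p ^+ 2) + 4 * intI (fun p => b p ^+ 2) + 8) * s ^+ 2.
Proof.
move=> ui vi wi hi s1 w0 h0.
have i1 := L2ID (L2IZ (-1) wi) hi; have i2 := L2ID (L2IZ s vi) i1.
have e1 := le_intI_sqrD (L2IZ (s ^+ 2) ui) i2.
have e2 := le_intI_sqrD (L2IZ s vi) i1.
have e3 := le_intI_sqrD (L2IZ (-1) wi) hi.
rewrite (intI_sqrZ (s ^+ 2) ui) in e1; rewrite (intI_sqrZ s vi) in e2.
rewrite (intI_sqrZ (-1) wi) in e3.
have U0 : 0 <= intI (fun p => a p ^+ 2) by apply: intI_ge0 => p _; exact: sqr_ge0.
have s2 : s ^+ 2 <= 1 by rewrite -(real_normK (num_real s)) expr_le1.
have s20 : 0 <= s ^+ 2 by exact: sqr_ge0.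
have s4 : (s ^+ 2) ^+ 2 <= s ^+ 2 by rewrite expr2 ler_piMr.
have s4U : (s ^+ 2) ^+ 2 * intI (fun p => a p ^+ 2) <= s ^+ 2 * intI (fun p => a p ^+ 2).
  by rewrite ler_wpM2r.
move: e1 e2 e3 w0 h0 U0 s4U.
move: (intI (fun p => (s ^+ 2 * a p + _) ^+ 2)) (intI (fun p => (s * b p + _) ^+ 2)).
move: (intI (fun p => (-1 * c p + _) ^+ 2)).
move: (intI (fun p => a p ^+ 2)) (intI (fun p => b p ^+ 2)) (intI (fun p => c p ^+ 2)) (intI (fun p => d p ^+ 2)).
move=> U V W H X Y Z *; nra.
Qed.

Definition remainder2 (us : R -> R * R -> R) u0 u1 u2 s : R * R -> R :=
  fun p => us s p - (u0 p + s * u1 p + s ^+ 2 * u2 p).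

(** At s = 0 this says that the remainder has norm 0: the expansion at 0
    identifies the geodesic with parameter 0 with the leading coefficient. *)
Lemma expansion2_near N us u0 u1 u2 : expansion2 N us u0 u1 u2 ->
  \forall s \near 0, N (remainder2 us u0 u1 u2 s) <= s ^+ 2.
Proof.
move=> /eqoP /(_ 1 ltr01); apply: filterS => s; rewrite mul1r.
by rewrite [X in _ <= X]ger0_norm ?sqr_ge0//; apply: le_trans; exact: ler_norm.
Qed.

Lemma remainder2_lin us u0 u1 u2 s : remainder2 us u0 u1 u2 s =
  fun p => - s ^+ 2 * u2 p + (- s * u1 p + (-1 * u0 p + us s p)).
Proof. by apply/funext => p; rewrite /remainder2; ring. Qed.

(** The leading coefficient cancels, which leaves terms of order s and the two
    remainders. *)
Lemma increment_lin us u0 u1 u2 s : (fun p => -1 * us 0 p + us s p) =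
  fun p => s ^+ 2 * u2 p + (s * u1 p +
    (-1 * remainder2 us u0 u1 u2 0 p + remainder2 us u0 u1 u2 s p)).
Proof. by apply/funext => p; rewrite /remainder2 expr0n /=; ring. Qed.

Lemma remainder2_L2H1 us u0 u1 u2 s : L2H1 u0 -> L2H1 u1 -> L2H1 u2 -> L2H1 (us s) ->
  L2H1 (remainder2 us u0 u1 u2 s).
Proof. by move=> *; rewrite remainder2_lin; do 3![apply: L2H1_lin => //]. Qed.

Lemma remainder2_C0L2 us u0 u1 u2 s : C0L2 u0 -> C0L2 u1 -> C0L2 u2 -> C0L2 (us s) ->
  C0L2 (remainder2 us u0 u1 u2 s).
Proof. by move=> *; rewrite remainder2_lin; do 3![apply: C0L2_lin => //]. Qed.

Lemma Dx_increment us u0 u1 u2 s : L2H1 u0 -> L2H1 u1 -> L2H1 u2 ->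
  L2H1 (us 0) -> L2H1 (us s) -> `|s| <= 1 ->
  intQ (fun p => Dx (remainder2 us u0 u1 u2 0) p ^+ 2) <= 0 ->
  intQ (fun p => Dx (remainder2 us u0 u1 u2 s) p ^+ 2) <= (s ^+ 2) ^+ 2 ->
  intQ (fun p => (Dx (us s) p - Dx (us 0) p) ^+ 2) <=
  (2 * intQ (fun p => Dx u2 p ^+ 2) + 4 * intQ (fun p => Dx u1 p ^+ 2) + 8) * s ^+ 2.
Proof.
move=> h0 h1 h2 k0 ks s1.
have [_ _ D0] := DxP k0; have [_ _ Ds] := DxP ks.
have [_ L1 D1] := DxP h1; have [_ L2 D2] := DxP h2.
have [_ Lr0 Dr0] := DxP (remainder2_L2H1 h0 h1 h2 k0).
have [_ Lrs Drs] := DxP (remainder2_L2H1 h0 h1 h2 ks).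
have := is_Dx_lin (-1) D0 Ds; rewrite (increment_lin us u0 u1 u2 s) => E1.
have E2 := is_Dx_lin (s ^+ 2) D2 (is_Dx_lin s D1 (is_Dx_lin (-1) Dr0 Drs)).
have := is_Dx_unique E1 E2 => E r0 rs.
have -> : intQ (fun p => (Dx (us s) p - Dx (us 0) p) ^+ 2) =
    intQ (fun p => (-1 * Dx (us 0) p + Dx (us s) p) ^+ 2).
  by apply: eq_intQ => p _; rewrite mulN1r addrC.
by rewrite E; apply: sq_combine_Q.
Qed.

End Expansions.

(** * The cubic remainder and the expansion of the metric *)

Section CubicRemainder.
Context {R : realType}.
Local Notation leb := (@lebesgue_measure R).
Implicit Types (u v w g h rho : R * R -> R) (a b : R -> R) (s t x : R).

(** The weighted form of Cauchy-Schwarz; with e of the size of s^2 it turns a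
    factor a of size s^2 into a bound of size s^2. *)
Lemma young_I (e : R) a b : 0 < e -> L2I a -> L2I b ->
  `|intI (fun x => a x * b x)| <=
  2^-1 * (e^-1 * intI (fun x => a x ^+ 2) + e * intI (fun x => b x ^+ 2)).
Proof.
move=> e0 ai bi; have abi := L2I_mul ai bi.
have i1 : itgI (fun x => e^-1 * a x ^+ 2) by exact: (rintegrableZ mI01 _ (L2I_sq ai)).
have i2 : itgI (fun x => e * b x ^+ 2) by exact: (rintegrableZ mI01 _ (L2I_sq bi)).
apply: (le_trans (norm_intI abi)).
rewrite -intIZ; last exact: L2I_sq.
rewrite -intIZ; last exact: L2I_sq.
rewrite -intID// -intIZ; last exact: (rintegrableD mI01).
apply: le_intI; first exact: (rintegrable_norm abi).
  by apply: (rintegrableZ mI01); exact: (rintegrableD mI01).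
apply: aeW => x _.
have -> : e^-1 * a x ^+ 2 + e * b x ^+ 2 = e * ((e^-1 * `|a x|) ^+ 2 + `|b x| ^+ 2).
  by rewrite exprMn !real_normK ?num_real//; field; exact: lt0r_neq0.
have -> : `|a x * b x| = 2^-1 * (e * (2 * (e^-1 * `|a x|) * `|b x|)).
  by rewrite normrM; field; exact: lt0r_neq0.
rewrite ler_wpM2l ?invr_ge0// ler_wpM2l ?(ltW e0)//.
by have := sqr_ge0 (e^-1 * `|a x| - `|b x|); nra.
Qed.

(** Three factors of size s give a product of size |s|^3: this is [triple_Q]
    with weight |s|. *)
Lemma trilinear_small (z rx v vx : R * R -> R) (Cz Cr Cv s : R) : s != 0 ->
  measurable_fun Q01 z ->
  (forall t, 0 <= t <= 1 -> L2I (slice z t) /\ intI (fun x => z (x, t) ^+ 2) <= Cz * s ^+ 2) ->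
  L2Q rx -> intQ (fun p => rx p ^+ 2) <= Cr * s ^+ 2 ->
  L2Q v -> is_Dx v vx ->
  intQ (fun p => v p ^+ 2) + intQ (fun p => vx p ^+ 2) <= Cv * s ^+ 2 -> 0 <= Cz ->
  `|trilinear z rx v| <= 2^-1 * (Cr + 2 * Cv * Cz) * (`|s| * s ^+ 2).
Proof.
move=> s0 mz zb rL rb vL vD vb Cz0.
have zL : LinfL2 (Cz * s ^+ 2) z.
  split => //; apply: aeW => t; rewrite /I01 /= in_itv /= => /andP[t0 t1].
  by apply: zb; rewrite !ltW.
have ns : 0 < `|s| by rewrite normr_gt0.
have [_ le] := triple_Q ns zL rL vL vD.
apply: (le_trans le); rewrite -[leRHS]mulrA ler_wpM2l ?invr_ge0// [leRHS]mulrDl lerD//.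
  by rewrite mulrCA ler_wpM2l.
have -> : s ^+ 2 = `|s| ^+ 2 by rewrite real_normK ?num_real.
have ss : s ^+ 2 = `|s| ^+ 2 by rewrite real_normK ?num_real.
have -> : 2 * Cv * Cz * (`|s| * `|s| ^+ 2) = `|s|^-1 * (2 * (Cv * s ^+ 2) * (Cz * `|s| ^+ 2)).
  by rewrite ss; field; rewrite gt_eqF.
rewrite ler_wpM2l ?invr_ge0// ler_wpM2r ?mulr_ge0 ?sqr_ge0//.
by rewrite ler_wpM2l.
Qed.

Lemma nearR_le1 : \forall s \near (0 : R), `|s| <= 1.
Proof. exact: (nbhs0_le (V := R)). Qed.

Lemma intI_sq_ge0 a : 0 <= intI (fun x => a x ^+ 2).
Proof. by apply: intI_ge0 => x _; exact: sqr_ge0. Qed.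

Lemma intQ_sq_ge0 u : 0 <= intQ (fun p => u p ^+ 2).
Proof. by apply: intQ_ge0 => p _; exact: sqr_ge0. Qed.

Lemma sqr_le_norm (N s : R) : 0 <= N -> N <= s ^+ 2 -> N ^+ 2 <= (s ^+ 2) ^+ 2.
Proof. by move=> N0 Ns; rewrite ler_sqr ?nnegrE ?sqr_ge0. Qed.

Lemma sqr_le_norm0 (N : R) : 0 <= N -> N <= 0 ^+ 2 -> N ^+ 2 <= 0.
Proof. by move=> N0 Ns; have := sqr_le_norm N0 Ns; rewrite !expr0n. Qed.

Lemma combine_ge0 (p q : R) : 0 <= p -> 0 <= q -> 0 <= 2 * p + 4 * q + 8.
Proof. by move=> p0 q0; rewrite !addr_ge0// mulr_ge0. Qed.

Lemma endpoint_arith (q S1 S2 U Y p r : R) : q * U <= q * S2 -> Y <= 2 * p + 2 * r ->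
  p <= 0 -> r <= q -> 0 <= q * S1 -> 0 <= q ->
  2 * (q * U) + 2 * Y <= (2 * S2 + 4 * S1 + 8) * q.
Proof. by move=> *; nra. Qed.

(** Increments have size s. The sum of the two values at time 0 is 2 u0 + s u1
    up to order s^2; the second-order coefficient only enters through its norm.
    *)
Lemma C0L2_expansion us u0 u1 u2 : C0L2_L2H1 u0 -> C0L2_L2H1 u1 -> C0L2_L2H1 u2 ->
  (\forall s \near 0, C0L2_L2H1 (us s)) -> expansion2 norm_C0L2_L2H1 us u0 u1 u2 ->
  exists2 C : R, 0 <= C & \forall s \near 0,
    [/\ forall t, 0 <= t <= 1 -> intI (fun x => (us s (x, t) - us 0 (x, t)) ^+ 2) <= C * s ^+ 2,
        intI (fun x => ((us s (x, 0) + us 0 (x, 0)) - (2 * u0 (x, 0) + s * u1 (x, 0))) ^+ 2)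
          <= C * (s ^+ 2) ^+ 2
      & intQ (fun p => (Dx (us s) p - Dx (us 0) p) ^+ 2) <= C * s ^+ 2].
Proof.
move=> h0 h1 h2 hs ex.
have nr := expansion2_near ex.
have k0 := nbhs_singleton hs; have nr0 := nbhs_singleton nr.
have [S1 HS1] := C0L2_bounded h1.1; have [S2 HS2] := C0L2_bounded h2.1.
have z01 : 0 <= (0 : R) <= 1 by rewrite lexx ler01.
have S10 : 0 <= S1 := le_trans (intI_sq_ge0 _) (HS1 _ z01).
have S20 : 0 <= S2 := le_trans (intI_sq_ge0 _) (HS2 _ z01).
have rem s : C0L2_L2H1 (us s) -> C0L2_L2H1 (remainder2 us u0 u1 u2 s).
  move=> ks; split.
    by apply: remainder2_C0L2; [exact: h0.1|exact: h1.1|exact: h2.1|exact: ks.1].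
  by apply: remainder2_L2H1; [exact: h0.2|exact: h1.2|exact: h2.2|exact: ks.2].
have [N0 DN0 IN0] := norm_C0L2_controlsQ (rem _ k0).
have sq0 := sqr_le_norm0 N0 nr0.
have A0 := combine_ge0 S20 S10.
have B0 := combine_ge0 (intQ_sq_ge0 (Dx u2)) (intQ_sq_ge0 (Dx u1)).
eexists; first exact: (addr_ge0 A0 B0).
have C1 (a b c : R) : 0 <= a -> 0 <= b -> 0 <= c -> a * c <= (a + b) * c.
  by move=> *; rewrite ler_wpM2r// lerDl.
have C2 (a b c : R) : 0 <= a -> 0 <= b -> 0 <= c -> b * c <= (a + b) * c.
  by move=> *; rewrite ler_wpM2r// lerDr.
apply: filterS3 nearR_le1 hs nr => s s1 ks ns.
have [Ns DNs INs] := norm_C0L2_controlsQ (rem _ ks).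
have sqs := sqr_le_norm Ns ns.
have in01 (t : R) : 0 <= t <= 1 -> t \in `[0, 1] by rewrite in_itv.
split.
- move=> t t01; have tm := in01 _ t01.
  apply: le_trans (C1 _ _ _ A0 B0 (sqr_ge0 s)).
  have -> : intI (fun x => (us s (x, t) - us 0 (x, t)) ^+ 2) =
     intI (fun x => (s ^+ 2 * u2 (x, t) + (s * u1 (x, t) +
       (-1 * remainder2 us u0 u1 u2 0 (x, t) + remainder2 us u0 u1 u2 s (x, t)))) ^+ 2).
    by apply: eq_intI => x _; rewrite /remainder2; ring.
  have := sq_combine_I (h2.1.1 _ tm) (h1.1.1 _ tm) ((rem _ k0).1.1 _ tm) ((rem _ ks).1.1 _ tm) s1
    (le_trans (IN0 _ t01) sq0) (le_trans (INs _ t01) sqs).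
  move=> H; apply: (le_trans H); rewrite ler_wpM2r ?sqr_ge0// lerD2r lerD// ler_wpM2l//.
    exact: HS2.
  exact: HS1.
- have tm := in01 _ z01.
  have r0L := (rem _ k0).1.1 _ tm; have rsL := (rem _ ks).1.1 _ tm; have u2L := h2.1.1 _ tm.
  have -> : intI (fun x => ((us s (x, 0) + us 0 (x, 0)) - (2 * u0 (x, 0) + s * u1 (x, 0))) ^+ 2) =
     intI (fun x => (s ^+ 2 * u2 (x, 0) + (remainder2 us u0 u1 u2 0 (x, 0)
       + remainder2 us u0 u1 u2 s (x, 0))) ^+ 2).
    by apply: eq_intI => x _; rewrite /remainder2; ring.
  apply: le_trans (C1 _ _ _ A0 B0 (sqr_ge0 (s ^+ 2))).
  have e1 := le_intI_sqrD (L2IZ (s ^+ 2) u2L) (L2ID r0L rsL).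
  rewrite (intI_sqrZ (s ^+ 2) u2L) in e1.
  have e2 := le_intI_sqrD r0L rsL.
  have e3 := le_trans (IN0 _ z01) sq0; have e4 := le_trans (INs _ z01) sqs.
  have e5 : (s ^+ 2) ^+ 2 * intI (fun x => slice u2 0 x ^+ 2) <= (s ^+ 2) ^+ 2 * S2.
    by rewrite ler_wpM2l ?sqr_ge0//; exact: HS2.
  have e6 : 0 <= (s ^+ 2) ^+ 2 * S1 by rewrite mulr_ge0// sqr_ge0.
  have e7 := sqr_ge0 (s ^+ 2).
  apply: (le_trans e1).
  exact: (endpoint_arith e5 e2 e3 e4 e6 e7).
- apply: le_trans (C2 _ _ _ A0 B0 (sqr_ge0 s)).
  exact: (Dx_increment h0.2 h1.2 h2.2 k0.2 ks.2 s1 (le_trans DN0 sq0) (le_trans DNs sqs)).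
Qed.

Lemma H1_expansion us u0 u1 u2 : L2H1 u0 -> L2H1 u1 -> L2H1 u2 ->
  (\forall s \near 0, L2H1 (us s)) -> expansion2 norm_L2H2 us u0 u1 u2 ->
  exists2 C : R, 0 <= C & \forall s \near 0,
    intQ (fun p => (us s p - us 0 p) ^+ 2) +
    intQ (fun p => (Dx (us s) p - Dx (us 0) p) ^+ 2) <= C * s ^+ 2.
Proof.
move=> h0 h1 h2 hs ex.
have nr := expansion2_near ex.
have k0 := nbhs_singleton hs; have nr0 := nbhs_singleton nr.
have rem s : L2H1 (us s) -> L2H1 (remainder2 us u0 u1 u2 s).
  by move=> ks; exact: remainder2_L2H1.
have [N0 IN0 DN0] := norm_L2H2_controlsQ (rem _ k0).
have sq0 := sqr_le_norm0 N0 nr0.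
have A0 := combine_ge0 (intQ_sq_ge0 u2) (intQ_sq_ge0 u1).
have B0 := combine_ge0 (intQ_sq_ge0 (Dx u2)) (intQ_sq_ge0 (Dx u1)).
eexists; first exact: (addr_ge0 A0 B0).
apply: filterS3 nearR_le1 hs nr => s s1 ks ns.
have [Ns INs DNs] := norm_L2H2_controlsQ (rem _ ks).
have sqs := sqr_le_norm Ns ns.
rewrite mulrDl; apply: lerD; last first.
  exact: (Dx_increment h0 h1 h2 k0 ks s1 (le_trans DN0 sq0) (le_trans DNs sqs)).
have -> : intQ (fun p => (us s p - us 0 p) ^+ 2) =
    intQ (fun p => (s ^+ 2 * u2 p + (s * u1 p +
       (-1 * remainder2 us u0 u1 u2 0 p + remainder2 us u0 u1 u2 s p))) ^+ 2).
  by apply: eq_intQ => p _; rewrite /remainder2; ring.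
exact: (sq_combine_Q h2.1 h1.1 (rem _ k0).1 (rem _ ks).1 s1 (le_trans IN0 sq0) (le_trans INs sqs)).
Qed.

End CubicRemainder.

Theorem lemma3p2 (R : realType) (kappa lambda eps : R)
    (hkappa : 0 < kappa) (heps : 0 < eps) (hlambda : 0 <= lambda)
    (rho0 rho1 theta : R -> R)
    (hrho0 : H1 rho0) (hrho1 : H1 rho1)
    (htheta : forall s : R, H1 (fun x => rho0 x + s * theta x))
    (f v z : R * R -> R)
    (hmin : minimizing_geodesic kappa lambda eps rho0 rho1 f v z)
    (rhos vs zs : R -> R * R -> R)
    (hmins : \forall s \near (0 : R),
       minimizing_geodesic kappa lambda eps
         (fun x => rho0 x + s * theta x) rho1 (rhos s) (vs s) (zs s))
    (hEL : \forall s \near (0 : R),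
       euler_lagrange kappa lambda eps
         (fun x => rho0 x + s * theta x) rho1 (rhos s) (vs s) (zs s))
    (f1 f2 v1 v2 z1 z2 : R * R -> R)
    (hexp : geodesic_expansion rhos vs zs f f1 f2 v v1 v2 z z1 z2) :
  (fun s : R => dHV2 kappa lambda eps (fun x => rho0 x + s * theta x) rho1
                - dHV2 kappa lambda eps rho0 rho1) =
  (fun s : R => - s * (\int[lebesgue_measure]_(x in `]0, 1[) (z (x, 0) * theta x))
                - s ^+ 2 / 2
                  * (\int[lebesgue_measure]_(x in `]0, 1[) (z1 (x, 0) * theta x)))
    +o_ (0 : R) (fun s : R => s ^+ 2).
Proof.
apply/eqaddoP => e e0.
have [[[F0 F1 F2] [Z0 Z1 Z2]] [V0 V1 V2] er ev ez] := hexp.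
have thL : L2I theta.
  have [b0 [r0L _ _]] := hrho0; have [b1 [r1L _ _]] := htheta 1.
  rewrite (_ : theta = fun x => rho0 x + 1 * theta x - rho0 x); first exact: L2IB.
  by apply/funext => x; ring.
have [Cr Cr0 nr] : exists2 C : R, 0 <= C & \forall s \near 0,
    [/\ forall t : R, 0 <= t <= 1 ->
          intI (fun x => (rhos s (x, t) - rhos 0 (x, t)) ^+ 2) <= C * s ^+ 2,
        intI (fun x => ((rhos s (x, 0) + rhos 0 (x, 0)) - (2 * f (x, 0) + s * f1 (x, 0))) ^+ 2)
          <= C * (s ^+ 2) ^+ 2
      & intQ (fun p => (Dx (rhos s) p - Dx (rhos 0) p) ^+ 2) <= C * s ^+ 2].
  apply: (C0L2_expansion F0 F1 F2 _ er); apply: filterS hEL => s [[? _ _] _ _ _ _] //.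
have [Cz Cz0 nz] := C0L2_expansion Z0 Z1 Z2
  (filterS (fun s (H : euler_lagrange _ _ _ _ _ _ _ _) => let: And5 (And3 _ _ h) _ _ _ _ := H in h) hEL) ez.
have [Cv Cv0 nv] : exists2 C : R, 0 <= C & \forall s \near 0,
    intQ (fun p => (vs s p - vs 0 p) ^+ 2) +
    intQ (fun p => (Dx (vs s) p - Dx (vs 0) p) ^+ 2) <= C * s ^+ 2.
  have [v0' _ _] := V0; have [v1' _ _] := V1; have [v2' _ _] := V2.
  by apply: (H1_expansion v0' v1' v2' _ ev); apply: filterS hEL => s [[_ [? _ _] _] _ _ _ _].
have EL0 := nbhs_singleton hEL; have min0 := nbhs_singleton hmins.
have zr0 : (fun x => rho0 x + 0 * theta x) = rho0.
  by apply/funext => x; rewrite mul0r addr0.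
rewrite zr0 in min0 EL0.
set T0 := intI (fun x => theta x ^+ 2).
have T00 : 0 <= T0 by exact: intI_sq_ge0.
pose K := 2^-1 * (2^-1 * (Cz + T0) + 2^-1 * (Cr + 2 * Cv * Cz)).
have K0 : 0 <= K.
  rewrite /K; apply: mulr_ge0 => //; apply: addr_ge0; apply: mulr_ge0 => //.
    exact: addr_ge0.
  by apply: addr_ge0 => //; apply: mulr_ge0 => //; exact: mulr_ge0.
near=> s.
have sK : `|s| <= e / (K + 1).
  by near: s; apply: (nbhs0_le (V := R)); rewrite divr_gt0// ltr_wpDl.
have ELs : euler_lagrange kappa lambda eps
         (fun x => rho0 x + s * theta x) rho1 (rhos s) (vs s) (zs s) by near: s.
have mins : minimizing_geodesic kappa lambda eps
         (fun x => rho0 x + s * theta x) rho1 (rhos s) (vs s) (zs s) by near: s.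
have [_ _ rb] : [/\ forall t : R, 0 <= t <= 1 ->
          intI (fun x => (rhos s (x, t) - rhos 0 (x, t)) ^+ 2) <= Cr * s ^+ 2,
        intI (fun x => ((rhos s (x, 0) + rhos 0 (x, 0)) - (2 * f (x, 0) + s * f1 (x, 0))) ^+ 2)
          <= Cr * (s ^+ 2) ^+ 2
      & intQ (fun p => (Dx (rhos s) p - Dx (rhos 0) p) ^+ 2) <= Cr * s ^+ 2] by near: s.
have [zb yb _] : [/\ forall t : R, 0 <= t <= 1 ->
          intI (fun x => (zs s (x, t) - zs 0 (x, t)) ^+ 2) <= Cz * s ^+ 2,
        intI (fun x => ((zs s (x, 0) + zs 0 (x, 0)) - (2 * z (x, 0) + s * z1 (x, 0))) ^+ 2)
          <= Cz * (s ^+ 2) ^+ 2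
      & intQ (fun p => (Dx (zs s) p - Dx (zs 0) p) ^+ 2) <= Cz * s ^+ 2] by near: s.
have vb : intQ (fun p => (vs s p - vs 0 p) ^+ 2) +
    intQ (fun p => (Dx (vs s) p - Dx (vs 0) p) ^+ 2) <= Cv * s ^+ 2 by near: s.
(* the weights |s| and s^2 used below must be positive *)
have [s00|sn0] := eqVneq s 0.
  by rewrite s00 /= !fctE zr0 subrr oppr0 expr0n /= !mul0r !subr0 normr0 mulr0.
set I0 := \int[lebesgue_measure]_(x in _) _; set I1 := \int[lebesgue_measure]_(x in _) _.
have I0E : intI (fun x => z (x, 0) * theta x) = I0 by [].
have I1E : intI (fun x => z1 (x, 0) * theta x) = I1 by [].
have el0 := euler_lagrange_solution EL0; have els := euler_lagrange_solution ELs.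
have z01 : 0 <= (0 : R) <= 1 by rewrite lexx ler01.
have o01 : 0 <= (1 : R) <= 1 by rewrite lexx ler01.
have in01 (t : R) : 0 <= t <= 1 -> t \in `[0, 1] by rewrite in_itv.
have zsL (t : R) : 0 <= t <= 1 -> L2I (slice (zs s) t) by move=> /in01; exact: (el_zC els).1.
have z0L (t : R) : 0 <= t <= 1 -> L2I (slice (zs 0) t) by move=> /in01; exact: (el_zC el0).1.
have rsL (t : R) : 0 <= t <= 1 -> L2I (slice (rhos s) t) by move=> /in01; exact: (el_rhoC els).1.
have r0L (t : R) : 0 <= t <= 1 -> L2I (slice (rhos 0) t) by move=> /in01; exact: (el_rhoC el0).1.
have ZL : L2I (slice z 0) by exact: (Z0.1.1 _ (in01 _ z01)).
have Z1L : L2I (slice z1 0) by exact: (Z1.1.1 _ (in01 _ z01)).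
pose b (t : R) := intI (fun x => (zs s (x, t) + zs 0 (x, t)) * (rhos s (x, t) - rhos 0 (x, t))).
pose T := trilinear (fun p => zs s p - zs 0 p) (fun p => Dx (rhos s) p - Dx (rhos 0) p)
  (fun p => vs s p - vs 0 p).
have DE : dHV2 kappa lambda eps (fun x => rho0 x + s * theta x) rho1
    - dHV2 kappa lambda eps rho0 rho1 = 2^-1 * (b 1 - b 0) - 2^-1 * T.
  by rewrite -mins.2 -min0.2; exact: (energy_identity el0 els).
have [_ _ _ _ [rs0 rs1]] := ELs; have [_ _ _ _ [r00 r01]] := EL0.
have bi (t : R) : 0 <= t <= 1 ->
    itgI (fun x => (zs s (x, t) + zs 0 (x, t)) * (rhos s (x, t) - rhos 0 (x, t))).
  move=> t01; apply: (L2I_mul (a := fun x => zs s (x, t) + zs 0 (x, t))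
    (b := fun x => rhos s (x, t) - rhos 0 (x, t))).
    exact: (L2ID (zsL _ t01) (z0L _ t01)).
  exact: (L2IB (rsL _ t01) (r0L _ t01)).
(* both geodesics end at rho1 *)
have b1 : b 1 = 0.
  rewrite -[RHS](intI_cst (0 : R)); apply: intI_ae_itg; first exact: bi.
    exact: (rintegrable_cst mI01 fin_I01).
  by apply: filterS2 rs1 r01 => x + + Ix => /(_ Ix) -> /(_ Ix) ->; rewrite subrr mulr0.
have sumL : L2I (fun x => zs s (x, 0) + zs 0 (x, 0)).
  exact: (L2ID (zsL _ z01) (z0L _ z01)).
pose P := intI (fun x => (zs s (x, 0) + zs 0 (x, 0)) * theta x).
(* they start from rho0 + s theta and from rho0 *)
have b0 : b 0 = s * P.
  rewrite -intIZ; last exact: L2I_mul.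
  apply: intI_ae_itg; first exact: bi.
    by apply: (rintegrableZ mI01); exact: L2I_mul.
  apply: filterS2 rs0 r00 => x + + Ix => /(_ Ix) -> /(_ Ix) ->; ring.
pose y (x : R) := (zs s (x, 0) + zs 0 (x, 0)) - (2 * z (x, 0) + s * z1 (x, 0)).
have linL : L2I (fun x => 2 * z (x, 0) + s * z1 (x, 0)).
  exact: (L2ID (L2IZ 2 ZL) (L2IZ s Z1L)).
have yL : L2I y by exact: (L2IB sumL linL).
pose Y := intI (fun x => y x * theta x).
have YE : P = Y + 2 * intI (fun x => z (x, 0) * theta x) + s * intI (fun x => z1 (x, 0) * theta x).
  have i1 : itgI (fun x => y x * theta x) by exact: L2I_mul.
  have i2 : itgI (fun x => z (x, 0) * theta x) by exact: (L2I_mul ZL thL).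
  have i3 : itgI (fun x => z1 (x, 0) * theta x) by exact: (L2I_mul Z1L thL).
  rewrite -(intIZ 2 i2) -(intIZ s i3) -(intID i1 (rintegrableZ mI01 2 i2)).
  rewrite -intID; [|exact: (rintegrableD mI01 i1 (rintegrableZ mI01 2 i2))|exact: (rintegrableZ mI01)].
  by apply: eq_intI => x _; rewrite /y; ring.
have s20 : 0 < s ^+ 2 by rewrite exprn_even_gt0.
have Yb : `|Y| <= 2^-1 * (Cz + T0) * s ^+ 2.
  apply: (le_trans (young_I s20 yL thL)); rewrite -[leRHS]mulrA ler_wpM2l ?invr_ge0//.
  rewrite [leRHS]mulrDl [T0 * _]mulrC lerD2r.
  by rewrite ler_pdivrMl// mulrCA -expr2.
have Tb : `|T| <= 2^-1 * (Cr + 2 * Cv * Cz) * (`|s| * s ^+ 2).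
  have dzL : L2Q (fun p => zs s p - zs 0 p) by apply: L2QB; [exact: el_zL els|exact: el_zL el0].
  apply: (trilinear_small sn0 dzL.1) vb Cz0 => //.
  - by move=> t t01; split; [exact: (L2IB (zsL _ t01) (z0L _ t01))|exact: zb].
  - by apply: L2QB; [exact: (el_rhoD els).1|exact: (el_rhoD el0).1].
  - by apply: L2QB; [exact: el_vL els|exact: el_vL el0].
  - have := is_Dx_lin (-1) (el_vD el0) (el_vD els).
    have E (g h : R * R -> R) : (fun p => -1 * g p + h p) = (fun p => h p - g p).
      by apply/funext => p; rewrite mulN1r addrC.
    by rewrite !E.
rewrite !fctE /= DE b1 b0 YE I0E I1E.
clear -e0 K0 T00 Yb Tb sK s20 Cz0 Cr0 Cv0.
clearbody T Y I0 I1 T0.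
have -> : 2^-1 * (0 - s * (Y + 2 * I0 + s * I1)) - 2^-1 * T - (- s * I0 - s ^+ 2 / 2 * I1) =
    - (2^-1 * (s * Y)) - 2^-1 * T by field.
apply: (@le_trans _ _ ((K * `|s|) * s ^+ 2)).
  apply: (le_trans (ler_normB _ _)); rewrite normrN !normrM ger0_norm ?invr_ge0//.
  have h : `|s| * `|Y| <= `|s| * (2^-1 * (Cz + T0) * s ^+ 2) by rewrite ler_wpM2l.
  have -> : K * `|s| * s ^+ 2 = 2^-1 * (`|s| * (2^-1 * (Cz + T0) * s ^+ 2)) +
      2^-1 * (2^-1 * (Cr + 2 * Cv * Cz) * (`|s| * s ^+ 2)) by rewrite /K; ring.
  by rewrite lerD// ler_wpM2l ?invr_ge0.
rewrite [`|s ^+ 2|]gtr0_norm// ler_wpM2r ?(ltW s20)//.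
move: sK; rewrite ler_pdivlMr ?ltr_wpDl// => sK.
by apply: le_trans sK; rewrite mulrC ler_wpM2l// lerDl.
Unshelve. all: by end_near. Qed.
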